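(* Let $(V_n)$, $(\epsilon_n)$, $(r_n)$, $(u_n)$ be a sequence of perturbed holomorphic cylinders (as defined in the context), and let $V=\lim_{n\to\infty}V_n$. Suppose that $\epsilon_n r_n\to\ell$ for some $\ell\in[0,\infty)$, and, if $\ell=0$, suppose in addition that $r_n\to\infty$. Then there exist positive numbers $\rho_n\to\infty$ with $\epsilon_n\rho_n\to 0$ and $\rho_n<r_n$ such that, after passing to a subsequence, the following hold: (i) The maps $u_n^-(s,t)=u_n(s-r_n,t)$ and $u_n^+(s,t)=u_n(s+r_n,t)$, restricted to $[0,\rho_n]\times\mathbb{R}/\mathbb{Z}$ and $[-\rho_n,0]\times\mathbb{R}/\mathbb{Z}$ respectively, converge uniformly to holomorphic cylinders $u_\infty^-$ defined on $[0,\infty)\times\mathbb{R}/\mathbb{Z}$ and $u_\infty^+$ defined on $(-\infty,0]\times\mathbb{R}/\mathbb{Z}$, with removable singularities $x_-$ and $x_+$ respectively. (ii) The rescaled maps $v_n(s,t)=u_n(\epsilon_n^{-1}s,\epsilon_n^{-1}t)$, defined on the rescaled central cylinder $[-\epsilon_n(r_n-\rho_n),\epsilon_n(r_n-\rho_n)]\times\mathbb{R}/\epsilon_n\mathbb{Z}$, converge uniformly to a flow line $v_\infty$ of $V$ of length $2\ell$ joining $x_-$ and $x_+$.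
   Context: Setting. Fix an integer $m\ge1$. Let $\overline{B}(1)\subset\mathbb{R}^{2m}$ be the closed unit ball and $J_0$ the standard complex structure on $\mathbb{R}^{2m}\simeq\mathbb{C}^m$. A sequence of perturbed holomorphic cylinders consists of: smooth vector fields $V_n:\overline{B}(1)\to\mathbb{R}^{2m}$ converging in $C^\infty$ (uniformly with all derivatives on $\overline{B}(1)$); real numbers $\epsilon_n>0$ with $\epsilon_n\to0$; real numbers $r_n>0$; and smooth maps $u_n:[-r_n-1,r_n+1]\times\mathbb{R}/\mathbb{Z}\to\overline{B}(1)$, with coordinates $(s,t)$, satisfying $\partial_s u_n+J_0\partial_t u_n=\epsilon_n V_n(u_n)$. A holomorphic cylinder is a map $u$ into $\overline{B}(1)$ satisfying $\partial_s u+J_0\partial_t u=0$. That $u_\infty^-$ (resp. $u_\infty^+$) has removable singularity $x_-$ (resp. $x_+$) means $u_\infty^-(s,t)\to x_-\in\overline{B}(1)$ as $s\to+\infty$ (resp. $u_\infty^+(s,t)\to x_+\in\overline{B}(1)$ as $s\to-\infty$), uniformly in $t$. Uniform convergence in (i) means $\sup_{[0,\rho_n]\times\mathbb{R}/\mathbb{Z}}|u_n^--u_\infty^-|+\sup_{[-\rho_n,0]\times\mathbb{R}/\mathbb{Z}}|u_n^+-u_\infty^+|\to0$. A flow line of $V$ of length $2\ell$ joining $x_-$ and $x_+$ is a map $v_\infty:[-\ell,\ell]\to\overline{B}(1)$ with $v_\infty'(s)=V(v_\infty(s))$, $v_\infty(-\ell)=x_-$ and $v_\infty(\ell)=x_+$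 (if $\ell=0$ this is a single point $x_-=x_+$). Uniform convergence of $v_n$ to $v_\infty$ means that $\sup|v_n(s,t)-v_\infty(s)|\to0$, where the supremum is over $s\in[-\epsilon_n(r_n-\rho_n),\epsilon_n(r_n-\rho_n)]\cap[-\ell,\ell]$ and $t\in\mathbb{R}/\epsilon_n\mathbb{Z}$. *)

(* Defs.v *)
From HB Require Import structures.
From mathcomp Require Import all_boot all_order all_algebra.
From mathcomp Require Import all_classical all_reals all_analysis.

Set Implicit Arguments.
Unset Strict Implicit.
Unset Printing Implicit Defensive.

Import Order.TTheory GRing.Theory Num.Theory.
Import numFieldNormedType.Exports.

Local Open Scope classical_set_scope.
Local Open Scope ring_scope.

Section Smoothness.
Context {R : realType} {V W : normedModType R}.
Implicit Types (A U : set V) (f g : V -> W) (vs : seq V).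

Definition iter_derive vs f : V -> W :=
  foldr (fun v g x => 'D_v g x) f vs.

(* Used for U open and V finite dimensional, where this is the usual notion. *)
Definition smooth U f : Prop :=
  forall vs x, U x ->
    {for x, continuous (iter_derive vs f)} /\
    forall v, derivable (iter_derive vs f) x v.

Definition smooth_extension A f g : Prop :=
  exists U, [/\ open U, A `<=` U, smooth U g & forall x, A x -> g x = f x].

(* A function on a closed domain A is smooth if it extends smoothly to an open
   neighbourhood of A; values of f outside A are irrelevant. *)
Definition smooth_on A f : Prop := exists g, smooth_extension A f g.

(* Iterated derivatives, up to the boundary of A, of a function f smooth on A.
   For the domains used below (a closed ball, closed strips of positive width)
   they do not depend on the extension: see [iter_derive_extension_unique]. *)
Definition iter_derive_on A vs f : V -> W :=
  iter_derive vs (get [set g | smooth_extension A f g]).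

Definition Cinfty_cvg_on A (f_ : nat -> V -> W) f : Prop :=
  forall vs, {uniform A,
    (fun n => iter_derive_on A vs (f_ n)) @ \oo --> iter_derive_on A vs f}.

Lemma iter_derive_extension_unique A f g1 g2 vs x :
  A `<=` closure A° -> smooth_extension A f g1 -> smooth_extension A f g2 ->
  A x -> iter_derive vs g1 x = iter_derive vs g2 x.
Proof.
move=> Acl [U1 [_ AU1 sg1 e1]] [U2 [_ AU2 sg2 e2]] Ax.
have AiA : A° `<=` A := @interior_subset _ A.
have inner ws y : A° y -> iter_derive ws g1 y = iter_derive ws g2 y.
  elim: ws y => [|w ws IH] y Ay /=; first by rewrite e1 ?e2//; exact: AiA.
  apply: near_eq_derive.
  by apply: filterS (open_nbhs_nbhs (conj (@open_interior _ A) Ay)) => z /IH.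
have [c1 _] := sg1 vs x (AU1 _ Ax); have [c2 _] := sg2 vs x (AU2 _ Ax).
pose d := iter_derive vs g1 \- iter_derive vs g2.
have cd : d @ x --> d x by apply: cvgB.
have d0 : d x = 0.
  apply/eqP; apply: contrapT => /negP dx0.
  have [y [Ay /eqP]] := Acl _ Ax _ (@cvgr_neq0 _ _ _ _ _ _ _ cd dx0); apply.
  by rewrite /d /= inner// subrr.
by apply/eqP; rewrite -subr_eq0; apply/eqP.
Qed.

End Smoothness.

Section Cylinders.
Context {R : realType} {m : nat}.
Local Notation E := 'rV[R]_(m + m).
Implicit Types (I : set R) (V : E -> E) (u : R * R -> E).

(* The library norm on matrices is the sup norm. *)
Definition enorm (x : E) : R := Num.sqrt (\sum_i x ord0 i ^+ 2).

Definition unit_cball : set E := [set x | enorm x <= 1].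

(* R^(2m) is identified with C^m by (x, y) |-> x + i y, x and y in R^m. *)
Definition J0 (z : E) : E := row_mx (- rsubmx z) (lsubmx z).

Definition sup_dist {T : Type} (A : set T) (f g : T -> E) : \bar R :=
  ereal_sup [set (enorm (f p - g p))%:E | p in A].

Definition strip I : set (R * R) := I `*` [set: R].

(* A map on I x R/Z is a map on I x R that is 1-periodic in the second
   variable. *)
Definition cylinder_map I u : Prop :=
  [/\ smooth_on (strip I) u,
      forall s t, I s -> u (s, t + 1) = u (s, t) &
      forall s t, I s -> unit_cball (u (s, t))].

Definition partial_s I u : R * R -> E := iter_derive_on (strip I) [:: (1, 0)] u.
Definition partial_t I u : R * R -> E := iter_derive_on (strip I) [:: (0, 1)] u.

Definition perturbed_cylinder I (eps : R) V u : Prop :=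
  cylinder_map I u /\
  forall p, strip I p ->
    partial_s I u p + J0 (partial_t I u p) = eps *: V (u p).

Definition holomorphic_cylinder I u : Prop :=
  cylinder_map I u /\
  forall p, strip I p -> partial_s I u p + J0 (partial_t I u p) = 0.

Definition removable_singularity u (F : set_system R) (x : E) : Prop :=
  unit_cball x /\
  {uniform, (fun s t => u (s, t)) @ F --> (fun _ : R => x)}.

(* Derivative relative to a subset, one-sided at the endpoints of an interval;
   no condition at an isolated point. *)
Definition is_derive_within I (v : R -> E) (s : R) (w : E) : Prop :=
  h^-1 *: (v (s + h) - v s) @[h --> within [set h | I (s + h)] 0^'] --> w.

Definition flow_line V (l : R) (xm xp : E) (v : R -> E) : Prop :=
  [/\ forall s, `[- l, l]%classic s -> unit_cball (v s),
      forall s, `[- l, l]%classic s -> is_derive_within `[- l, l] v s (V (v s)),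
      v (- l) = xm &
      v l = xp].

End Cylinders.

(* Main.v *)
(* Let f be the coordinates of u_n, solving f_s = - J0 f_t + eps_n V_n(f).  The
   energy of f - mean f (mean over the circle) is compared with that of f_t by
   the Poincare inequality; differentiating twice in s yields a convexity
   inequality, hence |f_t|^2 in L^2 of a slice is at most
   D (exp(s - r_n) + exp(- r_n - s)) away from the boundary.  So in the middle of
   the cylinder u_n is exponentially close to its circle mean a_n, whose
   derivative is eps_n V_n(a_n) up to an integrable error, whereas on the two ends
   of length rho_n = min(r_n / 2, eps_n^(-1/2)) the mean moves by at most
   C eps_n rho_n -> 0.

   Arzela-Ascoli gives locally uniform limits of u_n(s -+ r_n, t) and of the
   rescaled means; the exponential decay makes the convergence uniform and
   identifies the ends of the limits.  A limit of the ends is only known to be a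
   continuous solution of the integrated equation: smoothness follows by applying
   the same energy inequalities to differences of its Steklov averages, which
   makes their t-derivatives locally uniformly Cauchy. *)

Require Import Defs.
From HB Require Import structures.
From mathcomp Require Import all_boot all_order all_algebra.
From mathcomp Require Import all_classical all_reals all_analysis.
From mathcomp Require Import ring lra.

Import Order.TTheory GRing.Theory Num.Theory.
Import numFieldNormedType.Exports.

Local Open Scope classical_set_scope.
Local Open Scope ring_scope.

Set Implicit Arguments.
Unset Strict Implicit.
Unset Printing Implicit Defensive.

(** * Averages over the circle *)

Section UnitIntegral.
Context {R : realType}.
Implicit Types (f g F : R -> R).

(** No gradient bound is available: the maps are only bounded by 1. Everything is drawn from slice
    integrals, functions of s alone, for which one-variable calculus turns a sup bound of F on an
    interval into a bound of G on a smaller one. This requires the perturbation to be dominated by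
    F. For u itself that may fail, V being possibly nonzero at the origin; after subtracting circle
    means the Lipschitz bound of V provides it with factor 2 eps C, and 2 eps C <= 1/4 is the
    smallness needed. Pointwise control comes from a pointwise Poincare inequality, equicontinuity
    from comparison with a Steklov average, whose t-derivative is a difference quotient of a bounded
    function. The extra unit at each end of the cylinder pays for the shrinking intervals. A margin
    1/2 survives, so the limits of the ends live on open sets containing the closed half-lines, as
    smoothness up to the boundary demands. No rate of convergence is known for V_n or eps_n r_n: the
    subsequence makes the basic errors at step k at most 1/(k+1), and exponentials are weakened to
    the same scale. *)

Definition I01 f : R := \int[lebesgue_measure]_(x in `[0, 1]) f x.

Lemma I01_integrable f : continuous f ->
  lebesgue_measure.-integrable `[0%R, 1%R] (EFin \o f).
Proof.
move=> cf; apply: continuous_compact_integrable; first exact: segment_compact.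
exact: continuous_subspaceT.
Qed.

Lemma I01D f g : continuous f -> continuous g ->
  I01 (fun t => f t + g t) = I01 f + I01 g.
Proof. by move=> cf cg; rewrite /I01 RintegralD//; exact: I01_integrable. Qed.

Lemma I01B f g : continuous f -> continuous g ->
  I01 (fun t => f t - g t) = I01 f - I01 g.
Proof. by move=> cf cg; rewrite /I01 RintegralB//; exact: I01_integrable. Qed.

Lemma I01Z (c : R) f : continuous f -> I01 (fun t => c * f t) = c * I01 f.
Proof. by move=> cf; rewrite /I01 RintegralZl//; exact: I01_integrable. Qed.

Lemma I01_cst (c : R) : I01 (fun=> c) = c.
Proof.
by rewrite /I01 Rintegral_cst//= lebesgue_measure_itv/= lte01/= subr0 mulr1.
Qed.

Lemma I01_le f g : continuous f -> continuous g ->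
  (forall t, f t <= g t) -> I01 f <= I01 g.
Proof.
move=> cf cg fg; rewrite /I01 le_Rintegral//; exact: I01_integrable.
Qed.

Lemma I01_ge0 f : (forall t, 0 <= f t) -> 0 <= I01 f.
Proof. by move=> f0; apply: Rintegral_ge0. Qed.

Lemma I01_eq f g : f =1 g -> I01 f = I01 g.
Proof. by move=> fg; congr I01; apply/funext. Qed.

Lemma I01_sum n (f : 'I_n -> R -> R) : (forall i, continuous (f i)) ->
  I01 (fun t => \sum_i f i t) = \sum_i I01 (f i).
Proof.
elim: n f => [|n IH] f cf.
  by rewrite big_ord0 -[RHS](I01_cst 0); apply: I01_eq => t; rewrite big_ord0.
rewrite big_ord_recl -IH// -I01D//; last first.
  by move=> x; apply: cvg_big => [|i _]; [exact: add_continuous|exact: cf].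
by apply: I01_eq => t; rewrite big_ord_recl.
Qed.

Lemma I01_ftc F f : continuous f ->
  (forall t : R, 0 <= t <= 1 -> is_derive t 1 F (f t)) -> I01 f = F 1 - F 0.
Proof.
move=> cf dF; have cF (t : R) : 0 <= t <= 1 -> {for t, continuous F}.
  by move=> /dF [dFt _]; exact/differentiable_continuous/derivable1_diffP.
rewrite /I01 /Rintegral (@continuous_FTC2 _ f F)//.
- exact: continuous_subspaceT.
- split=> //.
  + by move=> x /[!in_itv]/= /andP[x0 x1]; have [] := dF x; rewrite ?ltW.
  + by apply/cvg_at_right_filter/cF; rewrite lexx ler01.
  + by apply/cvg_at_left_filter/cF; rewrite lexx ler01.
- move=> x /[!in_itv]/= /andP[x0 x1]; rewrite derive1E.
  by have [] := dF x; rewrite ?ltW.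
Qed.

Lemma I01_norm_le f (c : R) : continuous f ->
  (forall t, 0 <= t <= 1 -> `|f t| <= c) -> `|I01 f| <= c.
Proof.
move=> cf fc.
rewrite -(I01_cst c) (le_trans (le_normr_Rintegral _ _))//.
  exact: I01_integrable.
rewrite /I01 le_Rintegral//.
- apply: I01_integrable => x; apply: cvg_norm; exact: cf.
- apply: I01_integrable => x; exact: cvg_cst.
Qed.

End UnitIntegral.

Section Derivatives.
Context {R : realType}.

Lemma between_itv (x x' y lo hi : R) : Num.min x x' <= y <= Num.max x x' ->
  lo <= x <= hi -> lo <= x' <= hi -> lo <= y <= hi.
Proof.
move=> /andP[h1 h2] /andP[a b] /andP[c d]; apply/andP; split.
  by apply: le_trans h1; rewrite le_min a c.
by apply: le_trans h2 _; rewrite ge_max b d.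
Qed.

Lemma between_oo (x x' y lo hi : R) : Num.min x x' <= y <= Num.max x x' ->
  lo < x < hi -> lo < x' < hi -> lo < y < hi.
Proof.
move=> /andP[h1 h2] /andP[a b] /andP[c d]; apply/andP; split.
  by apply: lt_le_trans h1; rewrite lt_min a c.
by apply: le_lt_trans h2 _; rewrite gt_max b d.
Qed.

Lemma between_dist (x x' y : R) : Num.min x x' <= y <= Num.max x x' ->
  `|y - x| <= `|x' - x|.
Proof.
move=> H; set d := `|x' - x|; have d0 : 0 <= d := normr_ge0 _.
have h1 : x' - x <= d := ler_norm _.
have h2 : - (x' - x) <= d by rewrite /d -normrN ler_norm.
have hx : x - d <= x <= x + d by lra.
have hx' : x - d <= x' <= x + d by lra.
by have := between_itv H hx hx'; rewrite ler_norml; lra.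
Qed.

(** Multiplying the difference quotient by [h] gives a condition without division, the form in which
    the mean value estimates below arrive. *)
Lemma is_derive_lin (f : R -> R) (x d : R) :
  (forall e, 0 < e -> \forall h \near (0 : R), `|f (x + h) - f x - h * d| <= e * `|h|) ->
  is_derive x 1 f d.
Proof.
move=> H.
have C : h^-1 *: ((f \o shift x) (h *: (1 : R)) - f x) @[h --> 0^'] --> d.
  apply/cvgrPdist_le => e e0; have := H e e0.
  move=> /nbhs_dnbhs He; near=> h.
  have h0 : h != 0 by near: h; exact: nbhs_dnbhs_neq.
  have -> : (f \o shift x) (h *: (1 : R)) = f (x + h).
    by rewrite /= /shift/= addrC [_ *: _]mulr1.
  rewrite distrC -(ler_pM2r (_ : 0 < `|h|)) ?normr_gt0// -normrM.
  have -> : (h^-1 *: (f (x + h) - f x) - d) * h = f (x + h) - f x - h * d.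
    by rewrite mulrBl [h^-1 *: _]mulrC divfK// [d * h]mulrC.
  by near: h.
split; first by apply/cvg_ex; exists d.
exact/cvg_lim.
Unshelve. all: by end_near. Qed.

Lemma continuous_of_is_derive (f f' : R -> R) :
  (forall x : R, is_derive x 1 f (f' x)) -> continuous f.
Proof.
by move=> df t; apply/differentiable_continuous/derivable1_diffP; case: (df t).
Qed.

Lemma mvt_between (f f' : R -> R) (a b : R) : a <= b ->
  (forall x : R, a <= x <= b -> is_derive x 1 f (f' x)) ->
  exists2 c, a <= c <= b & f b - f a = f' c * (b - a).
Proof.
move=> ab df; have [||c] := @MVT_segment _ f f' a b ab.
- by move=> x /[!in_itv]/= /andP[ax xb]; apply: df; rewrite !ltW.
- apply: derivable_within_continuous => x /[!in_itv]/= xab.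
  by case: (df x xab).
- by move=> /[!in_itv]/=; exists c.
Qed.

(** Increments of both signs occur below, so the endpoints are not ordered. *)
Lemma mvt_sym (f f' : R -> R) (a b : R) :
  (forall x : R, Num.min a b <= x <= Num.max a b -> is_derive x 1 f (f' x)) ->
  exists2 c, Num.min a b <= c <= Num.max a b & f b - f a = f' c * (b - a).
Proof.
case: (leP a b) => ab df; first exact: mvt_between.
have [c cab e] := mvt_between (ltW ab) df; exists c => //.
by rewrite -opprB e -mulrN opprB.
Qed.

Lemma ndecr_of_is_derive (f f' : R -> R) (a b : R) : a <= b ->
  (forall x : R, a <= x <= b -> is_derive x 1 f (f' x)) ->
  (forall x, a <= x <= b -> 0 <= f' x) -> f a <= f b.
Proof.
move=> ab df f0; have [c cab e] := mvt_between ab df.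
by rewrite -subr_ge0 e mulr_ge0 ?f0// subr_ge0.
Qed.

End Derivatives.

(** * Integrals depending on a parameter and Steklov averages *)

Section ParameterIntegral.
Context {R : realType}.

(** Tube lemma: compactness of [0, 1] turns continuity at the points [(p, tau)] into closeness
    uniform in [tau]. The parameter ranges over a general space because both [R] and [R * R]
    occur. *)
Lemma tube_cvg (T : topologicalType) (phi : T -> R -> R) (p : T) (e : R) :
  (forall tau : R, 0 <= tau <= 1 ->
     {for (p, tau), continuous (fun q : T * R => phi q.1 q.2)}) ->
  0 < e ->
  \forall q \near p, forall tau : R, 0 <= tau <= 1 -> `|phi q tau - phi p tau| <= e.
Proof.
move=> cphi e0.
have cpt : compact `[0%R : R, 1%R]%classic by exact: segment_compact.
have nc := (compact_near_coveringP _).1 cpt.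
suff H : \forall q \near p, `[0%R : R, 1%R]%classic `<=`
    (fun tau => `|phi q tau - phi p tau| <= e).
  by apply: filterS H => q H tau tau01; apply: H; rewrite /= in_itv.
apply: nc.
move=> tau; rewrite /= in_itv/= => tau01.
have := cphi tau tau01.
move=> /cvgrPdist_le /(_ (e / 2)); rewrite divr_gt0// => /(_ isT) H.
have [[U W] /= [Up Wt] UW] := H.
exists (W, U) => //= -[t' q] /= [Wt' Uq].
have h1 := UW (q, t') (conj Uq Wt').
have h2 := UW (p, t') (conj (nbhs_singleton Up) Wt').
rewrite /= in h1 h2.
rewrite -(subrKA (phi p tau)) (splitr e) (le_trans (ler_normD _ _))// lerD//.
by rewrite distrC.
Qed.

Lemma I01_cvg (T : topologicalType) (phi : T -> R -> R) (p : T) :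
  (forall tau : R, 0 <= tau <= 1 ->
     {for (p, tau), continuous (fun q : T * R => phi q.1 q.2)}) ->
  (\forall q \near p, continuous (phi q)) ->
  {for p, continuous (fun q => I01 (phi q))}.
Proof.
move=> cphi cq; apply/cvgrPdist_le => e e0.
have cp : continuous (phi p) := nbhs_singleton cq.
near=> q.
have cq' : continuous (phi q) by near: q.
rewrite -I01B//; apply: I01_norm_le.
  by move=> x; apply: cvgB; [exact: cp|exact: cq'].
move=> t t01; rewrite distrC; move: t t01; near: q; exact: tube_cvg.
Unshelve. all: by end_near. Qed.

(** Continuity is that of the plane at the point (s, t), not relative to the strip over [A]; the two
    agree for open [A], the case of interest. *)
Definition ct2 (A : set R) (f : R -> R -> R) := forall s t : R, A s ->
  {for (s, t), continuous (fun p : R * R => f p.1 p.2)}.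

Lemma ct2_slice A f s : ct2 A f -> A s -> continuous (f s).
Proof.
move=> cf As t.
by apply: (continuous2_cvg _ (cf s t As)); [exact: cvg_cst|exact: cvg_id].
Qed.

Lemma ct2_slice1 A f s t : ct2 A f -> A s -> {for s, continuous (f^~ t)}.
Proof.
move=> cf As.
by apply: (continuous2_cvg _ (cf s t As)); [exact: cvg_id|exact: cvg_cst].
Qed.

Lemma ct2_const A (c : R) : ct2 A (fun _ _ => c).
Proof. by move=> s t _; exact: cvg_cst. Qed.

Lemma ct2_add A f g : ct2 A f -> ct2 A g -> ct2 A (fun s t => f s t + g s t).
Proof. by move=> cf cg s t As; apply: cvgD; [exact: cf|exact: cg]. Qed.

Lemma ct2_mul A f g : ct2 A f -> ct2 A g -> ct2 A (fun s t => f s t * g s t).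
Proof. by move=> cf cg s t As; apply: cvgM; [exact: cf|exact: cg]. Qed.

Lemma ct2_opp A f : ct2 A f -> ct2 A (fun s t => - f s t).
Proof. by move=> cf s t As; apply: cvgN; exact: cf. Qed.

Lemma ct2_sub A f g : ct2 A f -> ct2 A g -> ct2 A (fun s t => f s t - g s t).
Proof. by move=> cf cg; apply: ct2_add => //; exact: ct2_opp. Qed.

Lemma ct2_scale A (c : R) f : ct2 A f -> ct2 A (fun s t => c * f s t).
Proof. by move=> cf; apply: ct2_mul => //; exact: ct2_const. Qed.

Lemma ct2_sqr A f : ct2 A f -> ct2 A (fun s t => f s t ^+ 2).
Proof.
by move=> cf s t As; have := @ct2_mul A f f cf cf s t As.
Qed.

Lemma ct2_of_s A (f : R -> R) : (forall s : R, A s -> {for s, continuous f}) ->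
  ct2 A (fun s _ => f s).
Proof.
move=> cf s t As.
by apply: (@continuous_cvg _ _ _ _ _ (fun p : R * R => p.1) f s); [exact: cf|exact: cvg_fst].
Qed.

Lemma ct2_comp_t A (f : R -> R -> R) (c d : R) : ct2 A f ->
  ct2 A (fun s t => f s (c + d * t)).
Proof.
move=> cf s t As.
apply: (continuous2_cvg _ (cf s (c + d * t) As)); first exact: cvg_fst.
by apply: cvgD; [exact: cvg_cst|apply: cvgM; [exact: cvg_cst|exact: cvg_snd]].
Qed.

Lemma ct2_subset A B f : B `<=` A -> ct2 A f -> ct2 B f.
Proof. by move=> BA cf s t /BA; exact: cf. Qed.

Lemma near_open (A : set R) (s : R) : open A -> A s -> \forall x \near s, A x.
Proof. by move=> oA As; exact: open_nbhs_nbhs. Qed.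

Lemma I01_continuous A f s : open A -> ct2 A f -> A s ->
  {for s, continuous (fun s => I01 (f s))}.
Proof.
move=> oA cf As; apply: I01_cvg => [tau _|]; first exact: cf.
by near=> q; apply: (ct2_slice cf); near: q; exact: near_open.
Unshelve. all: by end_near. Qed.

(** The mean of [f s] over the interval from t to t + d, written over [0, 1] so that the parameters
    enter the integrand only. Its t-derivative is a difference quotient: averaging trades a
    derivative for a factor 1 / d. *)
Definition steklov (d : R) (f : R -> R -> R) (s t : R) :=
  I01 (fun tau => f s (t + d * tau)).

Lemma ct2_steklov A d f : open A -> ct2 A f -> ct2 A (steklov d f).
Proof.
move=> oA cf s t As.
apply: (@I01_cvg _ (fun (p : R * R) tau => f p.1 (p.2 + d * tau))) => [tau _|].
  have c1 : (fun q : (R * R) * R => q.1) @ (s, t, tau) --> (s, t) by exact: cvg_fst.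
  apply: (continuous2_cvg _ (cf s (t + d * tau) As)).
    by apply: (cvg_comp _ _ c1); exact: cvg_fst.
  apply: cvgD; first by apply: (cvg_comp _ _ c1); exact: cvg_snd.
  by apply: cvgM; [exact: cvg_cst|exact: cvg_snd].
have : \forall q \near (s, t), A q.1.
  have : (fun q : R * R => q.1) @ (s, t) --> s by exact: cvg_fst.
  by apply; exact: near_open.
apply: filterS => q Aq x.
apply: (continuous2_cvg _ (cf q.1 (q.2 + d * x) Aq)); first exact: cvg_cst.
by apply: cvgD; [exact: cvg_cst|apply: cvgM; [exact: cvg_cst|exact: cvg_id]].
Qed.

(** By the mean value theorem a difference quotient is a value of [f'] at a nearby slice, and
    [tube_cvg] makes its distance to [f' s] uniform in t, hence integrable. *)
Lemma I01_derive A (f f' : R -> R -> R) (s : R) : open A -> A s ->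
  ct2 A f -> ct2 A f' ->
  (forall s t : R, A s -> is_derive s 1 (f^~ t) (f' s t)) ->
  is_derive s 1 (fun s => I01 (f s)) (I01 (f' s)).
Proof.
move=> oA As cf cf' df; apply: is_derive_lin => e e0.
have tb : \forall q \near s, forall tau : R, 0 <= tau <= 1 -> `|f' q tau - f' s tau| <= e.
  by apply: tube_cvg => // tau _; exact: cf'.
have [r /= r0 hr] := (nbhs_ballP _ _).1 (filterI tb (near_open oA As)).
apply/nbhs_ballP; exists r => //= h.
rewrite /ball/= sub0r normrN => hr'.
have inb (x : R) : Num.min s (s + h) <= x <= Num.max s (s + h) -> ball s r x.
  rewrite /ball/= => /between_dist; rewrite [s + h]addrC addrK distrC => xs.
  exact: le_lt_trans hr'.
have Ash : A (s + h).
  by apply: (hr _ _).2; apply: inb; rewrite ge_min le_max !lexx !orbT.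
have cs q : A q -> continuous (f q) by move=> Aq; apply: (ct2_slice cf).
have cs' := ct2_slice cf' As.
have cB : continuous (fun t => f (s + h) t - f s t).
  by move=> x; apply: cvgB; [exact: cs|exact: cs].
have cZ : continuous (fun t => h * f' s t).
  by move=> x; apply: cvgM; [exact: cvg_cst|exact: cs'].
rewrite -I01B; [|exact: cs|exact: cs].
rewrite -I01Z// -I01B//.
apply: I01_norm_le; first by move=> x; apply: cvgB; [exact: cB|exact: cZ].
move=> t t01.
have [|c csh ->] := @mvt_sym _ (f^~ t) (f'^~ t) s (s + h).
  by move=> x /inb xb; apply: df; exact: (hr _ xb).2.
rewrite [s + h]addrC addrK [h * _]mulrC -mulrBl normrM ler_wpM2r//.
by have := (hr _ (inb _ csh)).1 t t01.
Qed.

End ParameterIntegral.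

(** * Averages of periodic functions and the Poincare inequality *)

Section Averages.
Context {R : realType}.
Implicit Types (f g : R -> R).

Lemma is_derive1_eq (f : R -> R) (x d e : R) :
  is_derive x 1 f d -> d = e -> is_derive x 1 f e.
Proof. by move=> ? <-. Qed.

Lemma is_derive_comp_affine f (d c k x : R) : is_derive (c + k * x) 1 f d ->
  is_derive x 1 (fun x => f (c + k * x)) (k * d).
Proof.
move=> df; rewrite mulrC; apply: is_derive1_comp.
apply: is_derive_lin => e e0; near=> h.
rewrite (_ : _ - _ = 0) ?normr0; last by ring.
by rewrite mulr_ge0// ltW.
Unshelve. all: by end_near. Qed.

Lemma is_deriveD1 f g (x a b : R) : is_derive x 1 f a -> is_derive x 1 g b ->
  is_derive x 1 (fun y => f y + g y) (a + b).
Proof. by move=> df dg; exact: is_deriveD. Qed.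

Lemma is_deriveB1 f g (x a b : R) : is_derive x 1 f a -> is_derive x 1 g b ->
  is_derive x 1 (fun y => f y - g y) (a - b).
Proof. by move=> df dg; exact: is_deriveB. Qed.

Lemma is_deriveM1 f g (x a b : R) : is_derive x 1 f a -> is_derive x 1 g b ->
  is_derive x 1 (fun y => f y * g y) (f x * b + g x * a).
Proof. by move=> df dg; exact: is_deriveM. Qed.

Lemma is_deriveZ1 f (c x a : R) : is_derive x 1 f a ->
  is_derive x 1 (fun y => c * f y) (c * a).
Proof. by move=> df; exact: is_deriveZ. Qed.

Lemma is_derive_sqr1 f (x a : R) : is_derive x 1 f a ->
  is_derive x 1 (fun y => f y ^+ 2) (2 * (f x * a)).
Proof.
by move=> df; apply: is_derive1_eq (is_deriveM1 df df) _; rewrite mulr_natl mulr2n.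
Qed.

Lemma is_derive_sum1 n (f : 'I_n -> R -> R) (a : 'I_n -> R) (x : R) :
  (forall i, is_derive x 1 (f i) (a i)) ->
  is_derive x 1 (fun y => \sum_i f i y) (\sum_i a i).
Proof.
move=> df; have -> : (fun y => \sum_i f i y) = \sum_i f i.
  by apply/funext => y; rewrite fct_sumE.
exact: is_derive_sum.
Qed.

Lemma is_derive_cst1 (c x : R) : is_derive x 1 (fun=> c) 0.
Proof. exact: is_derive_cst. Qed.

Lemma is_derive_id1 (x : R) : is_derive x 1 (fun y => y) 1.
Proof. exact: is_derive_id. Qed.

Lemma continuous_affine f (c k : R) : continuous f ->
  continuous (fun x => f (c + k * x)).
Proof.
move=> cf x.
apply: (@continuous_cvg _ _ _ _ _ (fun x : R => c + k * x) f (c + k * x)).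
  exact: cf.
by apply: cvgD; [exact: cvg_cst|apply: cvgM; [exact: cvg_cst|exact: cvg_id]].
Qed.

Lemma continuousM1 f g : continuous f -> continuous g ->
  continuous (fun x => f x * g x).
Proof. by move=> cf cg x; apply: cvgM; [exact: cf|exact: cg]. Qed.

Lemma continuousD1 f g : continuous f -> continuous g ->
  continuous (fun x => f x + g x).
Proof. by move=> cf cg x; apply: cvgD; [exact: cf|exact: cg]. Qed.

Lemma continuousB1 f g : continuous f -> continuous g ->
  continuous (fun x => f x - g x).
Proof. by move=> cf cg x; apply: cvgB; [exact: cf|exact: cg]. Qed.

Lemma continuous_sqr1 f : continuous f -> continuous (fun x => f x ^+ 2).
Proof. by move=> cf; exact: (continuousM1 cf cf). Qed.

Lemma continuous_cst1 (c : R) : continuous (fun _ : R => c).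
Proof. by move=> x; exact: cvg_cst. Qed.

Lemma continuous_id1 : continuous (fun x : R => x).
Proof. by move=> x; exact: cvg_id. Qed.

(** The primitive is an integral from [a], hence differentiable only to the right of [a]; its users
    take [a] to the left of all the points at stake. *)
Lemma ex_primitive f (a : R) : continuous f ->
  exists F, forall x : R, a < x -> is_derive x 1 F (f x).
Proof.
move=> cf; exists (fun x => \int[lebesgue_measure]_(t in `[a, x]) f t) => x ax.
have xx : x < x + 1 by rewrite ltrDl.
have fi : lebesgue_measure.-integrable `[a, x + 1] (EFin \o f).
  apply: continuous_compact_integrable; first exact: segment_compact.
  exact: continuous_subspaceT.
have [dF F'] := continuous_FTC1_closed xx fi ax (cf x).
by split; [exact: dF|rewrite -derive1E; exact: F'].
Qed.

Definition avg (d : R) f (t : R) := I01 (fun tau : R => f (t + d * tau)).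

Lemma avg_primitive d f F (t : R) : continuous f ->
  (forall tau : R, 0 <= tau <= 1 -> is_derive (t + d * tau) 1 F (f (t + d * tau))) ->
  d * avg d f t = F (t + d) - F t.
Proof.
move=> cf dF; rewrite -I01Z; last exact: continuous_affine.
have cdf : continuous (fun tau : R => d * f (t + d * tau)).
  by apply: continuousM1; [exact: continuous_cst1|exact: continuous_affine].
have dFF (tau : R) : 0 <= tau <= 1 ->
    is_derive tau 1 (fun tau : R => F (t + d * tau)) (d * f (t + d * tau)).
  by move=> tau01; apply: is_derive_comp_affine; exact: dF.
by rewrite (I01_ftc cdf dFF) mulr1 mulr0 addr0.
Qed.

Lemma avg_derive d f (t : R) : d != 0 -> continuous f ->
  is_derive t 1 (avg d f) (d^-1 * (f (t + d) - f t)).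
Proof.
(* The base point leaves room for [d] of either sign and for all y within distance 1 of t. *)
move=> d0 cf; have [F dF] := ex_primitive (t - `|d| - 1) cf.
have big (y tau : R) : `|y - t| < 1 -> 0 <= tau <= 1 ->
    t - `|d| - 1 < y + d * tau.
  move=> yt /andP[t0 t1]; have : `|d * tau| <= `|d|.
    by rewrite normrM ler_piMr// ger0_norm.
  rewrite ler_norml => /andP[h _]; move: yt; rewrite ltr_norml => /andP[h2 _]; lra.
apply: (@near_eq_is_derive _ _ _ (fun y => d^-1 * (F (y + d) - F y))).
  near=> y.
  have yt : `|y - t| < 1.
    have : ball t 1 y by near: y; exact: (nbhsx_ballx t (1 : R) ltr01).
    by rewrite distrC.
  by rewrite -(avg_primitive cf (fun tau h => dF _ (big _ _ yt h))) mulKf.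
have d1 : is_derive t 1 (fun y => F (y + d)) (f (t + d)).
  have := @is_derive_comp_affine F (f (t + d)) d 1 t.
  rewrite mul1r addrC mul1r.
  have -> : (fun x => F (d + 1 * x)) = (fun y => F (y + d)).
    by apply/funext => y; rewrite mul1r addrC.
  by apply; apply: dF; have := big t 1; rewrite mulr1 subrr normr0 ler01 lexx; apply.
have d2 : is_derive t 1 F (f t).
  by apply: dF; have := big t 0; rewrite mulr0 addr0 subrr normr0 ler01 lexx; apply.
exact: is_deriveZ.
Unshelve. all: by end_near. Qed.

(** [d * avg d f t] is the integral of [f] from t to t + d, part of the integral from t to t + 1 of
    a nonnegative function. *)
Lemma avg_le d f (t : R) : 0 <= d <= 1 -> continuous f -> (forall x, 0 <= f x) ->
  d * avg d f t <= avg 1 f t.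
Proof.
move=> /andP[d0 d1] cf f0; have [F dF] := ex_primitive (t - 1) cf.
have big k tau : 0 <= k -> 0 <= tau <= 1 -> t - 1 < t + k * tau.
  by move=> k0 /andP[t0 _]; have := mulr_ge0 k0 t0; lra.
rewrite (avg_primitive cf (fun tau h => dF _ (big _ _ d0 h))).
rewrite -[avg 1 f t]mul1r (avg_primitive cf (fun tau h => dF _ (big _ _ ler01 h))).
rewrite lerD2r; apply: (@ndecr_of_is_derive _ F f); rewrite ?lerD2l// => x.
by move=> /andP[x0 x1]; apply: dF; lra.
Qed.

(** [avg 1 f] has derivative f(t + 1) - f(t) = 0, so it keeps its value at 0. *)
Lemma I01_periodic f (t : R) : continuous f -> (forall x, f (x + 1) = f x) ->
  avg 1 f t = I01 f.
Proof.
move=> cf pf; have dA (x : R) : is_derive x 1 (avg 1 f) 0.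
  by apply: is_derive1_eq (avg_derive _ (oner_neq0 _) cf) _; rewrite pf subrr mulr0.
have [c _] := @mvt_sym _ (avg 1 f) (fun=> 0) 0 t (fun x _ => dA x).
rewrite mul0r => /eqP; rewrite subr_eq0 => /eqP ->.
by apply: I01_eq => x; rewrite add0r mul1r.
Qed.

(** Jensen: the square of [f - c], with [c] the mean of [f], has nonnegative integral. *)
Lemma I01_sqr_le f : continuous f -> I01 f ^+ 2 <= I01 (fun t => f t ^+ 2).
Proof.
move=> cf; set c := I01 f.
have : 0 <= I01 (fun t => (f t ^+ 2 - (2 * c) * f t) + c ^+ 2).
  by apply: I01_ge0 => t; have := sqr_ge0 (f t - c); lra.
rewrite I01D; [|apply: continuousB1|exact: continuous_cst1]; last 2 first.
- exact: continuous_sqr1.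
- by apply: continuousM1 => //; exact: continuous_cst1.
rewrite I01B; [|exact: continuous_sqr1|by apply: continuousM1 => //; exact: continuous_cst1].
by rewrite I01Z// I01_cst -/c; lra.
Qed.

Lemma periodic_is_derive f g : (forall t : R, is_derive t 1 f (g t)) ->
  (forall x, f (x + 1) = f x) -> forall x, g (x + 1) = g x.
Proof.
move=> df pf x; have [_ <-] := df x.
have := @is_derive_comp_affine f (g (x + 1)) 1 1 x; rewrite mul1r addrC mul1r.
move=> /(_ (df _)) [_ <-]; congr ('D_1 _ x); apply/funext => y.
by rewrite mul1r addrC pf.
Qed.

(** Integration by parts against [tau - 1 / 2] over the period starting at t: periodicity turns the
    boundary terms into [f t], so [f t - I01 f] is the integral of [(tau - 1 / 2) f'(t + tau)]. The
    weight is crudely bounded by 1; the constant is not sharp, but the pointwise form serves both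
    for slice energies and for sup bounds. *)
Lemma poincare f f' (t : R) : (forall t : R, is_derive t 1 f (f' t)) ->
  continuous f' -> (forall x, f (x + 1) = f x) ->
  (f t - I01 f) ^+ 2 <= I01 (fun x => f' x ^+ 2).
Proof.
move=> df cf' pf; have cf := continuous_of_is_derive df.
have pf' := periodic_is_derive df pf.
have cw : continuous (fun x : R => x - 1 / 2).
  by apply: continuousB1; [exact: continuous_id1|exact: continuous_cst1].
have cw' := @continuous_affine f' t 1 cf'.
have cwf := continuousM1 cw cw'.
have e : f t - I01 f = I01 (fun tau : R => (tau - 1 / 2) * f' (t + 1 * tau)).
  apply/eqP; rewrite subr_eq -[X in _ == _ + X](I01_periodic t)// /avg -I01D//; last exact: continuous_affine.
  have cg : continuous (fun tau : R => (tau - 1 / 2) * f' (t + 1 * tau) + f (t + 1 * tau)).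
    by apply: continuousD1 => //; exact: continuous_affine.
  have dFF (tau : R) : 0 <= tau <= 1 ->
     is_derive tau 1 (fun tau : R => (tau - 1 / 2) * f (t + 1 * tau))
      ((tau - 1 / 2) * f' (t + 1 * tau) + f (t + 1 * tau)).
    move=> _; have := @is_derive_comp_affine f _ t 1 tau (df _); rewrite mul1r => d1.
    have d2 := is_deriveB1 (is_derive_id1 tau) (is_derive_cst1 (1 / 2) tau).
    by apply: is_derive1_eq (is_deriveM1 d2 d1) _; ring.
  by rewrite (I01_ftc cg dFF) mulr1 mulr0 addr0 pf; apply/eqP; field.
rewrite e (le_trans (I01_sqr_le cwf))// -[leRHS](I01_periodic t); last 2 first.
- exact: continuous_sqr1.
- by move=> x; rewrite pf'.
apply: (@le_trans _ _ (I01 (fun tau : R => 1 * f' (t + 1 * tau) ^+ 2))).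
  rewrite /I01 le_Rintegral//; [exact: I01_integrable (continuous_sqr1 cwf)|..].
    apply: I01_integrable; apply: continuousM1; first exact: continuous_cst1.
    exact: continuous_sqr1.
  move=> x /=; rewrite in_itv/= => /andP[x0 x1].
  rewrite exprMn ler_wpM2r ?sqr_ge0//; nra.
by rewrite (I01_eq (fun=> mul1r _)).
Qed.

(** The same integration by parts with weight [(tau - 1) d], whose boundary terms leave [f t]. The
    factor [d] on the right makes the average close to [f] when only the integral of the square of
    [f'] is bounded. *)
Lemma avg_error d f f' (t : R) : 0 <= d <= 1 ->
  (forall t : R, is_derive t 1 f (f' t)) ->
  continuous f' -> (forall x, f (x + 1) = f x) ->
  (f t - avg d f t) ^+ 2 <= d * I01 (fun x => f' x ^+ 2).
Proof.
move=> d01 df cf' pf; have cf := continuous_of_is_derive df.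
have /andP[d0 d1] := d01.
have pf' := periodic_is_derive df pf.
have cw : continuous (fun x : R => (x - 1) * d).
  apply: continuousM1; last exact: continuous_cst1.
  by apply: continuousB1; [exact: continuous_id1|exact: continuous_cst1].
have cw' := @continuous_affine f' t d cf'.
have cwf := continuousM1 cw cw'.
have e : f t - avg d f t = I01 (fun tau : R => ((tau - 1) * d) * f' (t + d * tau)).
  apply/eqP; rewrite subr_eq /avg -I01D//; last exact: continuous_affine.
  have cg : continuous (fun tau : R => (tau - 1) * d * f' (t + d * tau) + f (t + d * tau)).
    by apply: continuousD1 => //; exact: continuous_affine.
  have dFF (tau : R) : 0 <= tau <= 1 ->
     is_derive tau 1 (fun tau : R => (tau - 1) * f (t + d * tau))
      ((tau - 1) * d * f' (t + d * tau) + f (t + d * tau)).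
    move=> _; have d2 := @is_derive_comp_affine f _ t d tau (df _).
    have d1' := is_deriveB1 (is_derive_id1 tau) (is_derive_cst1 1 tau).
    by apply: is_derive1_eq (is_deriveM1 d1' d2) _; ring.
  by rewrite (I01_ftc cg dFF) mulr1 mulr0 addr0; apply/eqP; ring.
have csq := continuous_sqr1 cf'.
rewrite e (le_trans (I01_sqr_le cwf))// -(I01_periodic t csq); last first.
  by move=> x; rewrite pf'.
apply: le_trans (ler_wpM2l d0 (avg_le t d01 csq (fun x => sqr_ge0 _))).
rewrite -!I01Z; last 2 first.
- by apply: continuousM1; [exact: continuous_cst1|exact: (@continuous_affine _ t d csq)].
- exact: (@continuous_affine _ t d csq).
rewrite /I01 le_Rintegral//; [exact: I01_integrable (continuous_sqr1 cwf)|..].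
  apply: I01_integrable; apply: continuousM1; first exact: continuous_cst1.
  apply: continuousM1; first exact: continuous_cst1.
  exact: (@continuous_affine _ t d csq).
move=> x /=; rewrite in_itv/= => /andP[x0 x1].
have := sqr_ge0 (d * f' (t + d * x)) => h.
have -> : ((x - 1) * d * f' (t + d * x)) ^+ 2 =
   (x - 1) ^+ 2 * (d * f' (t + d * x)) ^+ 2 by ring.
have -> : d * (d * f' (t + d * x) ^+ 2) = 1 * (d * f' (t + d * x)) ^+ 2 by ring.
by rewrite ler_wpM2r ?sqr_ge0//; nra.
Qed.

End Averages.

(** * Mixed derivatives, limits of derivatives and directional derivatives *)

Section TwoVariables.
Context {R : realType}.

Lemma is_derive1_unique (f : R -> R) (x a b : R) :
  is_derive x 1 f a -> is_derive x 1 f b -> a = b.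
Proof. by move=> [_ <-] [_ <-]. Qed.

(** The increment of [f] in t is an integral of [f2]; differentiating it in s under the integral
    sign shows that [f1 s] is, up to a constant, a primitive [G] of [f21 s]. *)
Lemma schwarz (A : set R) (f f1 f2 f12 f21 : R -> R -> R) : open A ->
  ct2 A f2 -> ct2 A f21 ->
  (forall s t : R, A s -> is_derive s 1 (f^~ t) (f1 s t)) ->
  (forall s t : R, A s -> is_derive t 1 (f s) (f2 s t)) ->
  (forall s t : R, A s -> is_derive t 1 (f1 s) (f12 s t)) ->
  (forall s t : R, A s -> is_derive s 1 (f2^~ t) (f21 s t)) ->
  forall s t, A s -> f12 s t = f21 s t.
Proof.
move=> oA c2 c21 d1 d2 d12 d21 s t As.
have [G dG] := ex_primitive (t - 1) (ct2_slice c21 As).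
have key x : t - 1 < x -> f1 s x = f1 s t + (G x - G t).
  move=> xt; pose k := x - t.
  have e1 : \forall s' \near s,
      k * I01 (fun tau => f2 s' (t + k * tau)) = f s' x - f s' t.
    near=> s'; have As' : A s' by near: s'; exact: near_open.
    rewrite -[in RHS](subrK t x) [x - t + t]addrC.
    by apply: (avg_primitive (ct2_slice c2 As')) => tau _; exact: d2.
  have c2k := ct2_comp_t (c := t) (d := k) c2.
  have c21k := ct2_comp_t (c := t) (d := k) c21.
  have := I01_derive oA As c2k c21k (fun s t As => d21 s _ As).
  move=> /(is_deriveZ1 k) /(near_eq_is_derive e1) E1.
  have E2 := is_deriveB1 (d1 s x As) (d1 s t As).
  have E3 := is_derive1_unique E1 E2.
  have dk (tau : R) : 0 <= tau <= 1 -> is_derive (t + k * tau) 1 G (f21 s (t + k * tau)).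
    move=> /andP[t0 t1]; apply: dG; rewrite /k.
    have : 0 <= (x - t + 1) * tau by rewrite mulr_ge0//; lra.
    nra.
  have := avg_primitive (ct2_slice c21 As) dk.
  by rewrite /avg E3 [t + k]addrC subrK => <-; ring.
have dt : is_derive t 1 (fun x => f1 s t + (G x - G t)) (f21 s t).
  apply: is_derive1_eq (is_deriveD1 (is_derive_cst1 _ _)
    (is_deriveB1 (dG t _) (is_derive_cst1 _ _))) _; last by rewrite add0r subr0.
  lra.
apply: (is_derive1_unique (d12 s t As)); apply: near_eq_is_derive dt.
near=> x; apply/esym/key.
have : ball t 1 x by near: x; exact: (nbhsx_ballx t (1 : R) ltr01).
by rewrite /ball/= distrC ltr_norml => /andP[h _]; lra.
Unshelve. all: by end_near. Qed.

(** The approximants change with [e] while the radius [r] does not; the mean value theorem for an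
    approximant compares the increment of [f] with [g] at an intermediate point. *)
Lemma is_derive_limit (f g : R -> R) (x r : R) : 0 < r ->
  {for x, continuous g} ->
  (forall e, 0 < e -> exists fe ge : R -> R, forall y : R, `|y - x| < r ->
     [/\ is_derive y 1 fe (ge y), `|fe y - f y| <= e & `|ge y - g y| <= e]) ->
  is_derive x 1 f (g x).
Proof.
move=> r0 cg H; apply: is_derive_lin => e e0.
have [d /= d0 hd] : nbhs_ball x [set y | `|g x - g y| <= e].
  by apply/nbhs_ballP; move/cvgrPdist_le : cg; apply.
have dr0 : 0 < Num.min d r by rewrite lt_min d0 r0.
apply/nbhs_ballP; exists (Num.min d r) => //= h.
rewrite /ball/= sub0r normrN lt_min => /andP[hdd hr].
(* [h] is fixed before the approximant is chosen: replacing [f] and [g] costs [2 + |h|] times the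
   accuracy, hence the accuracy [e' / (2 + |h|)]. *)
apply/ler_addgt0Pr => e' e'0.
have e2 : 0 < e' / (2 + `|h|) by rewrite divr_gt0// ltr_wpDr.
have [fe [ge Hy]] := H _ e2.
have inb (y : R) : Num.min x (x + h) <= y <= Num.max x (x + h) -> `|y - x| <= `|h|.
  by move=> /between_dist; rewrite [x + h]addrC addrK.
have [|c ch E] := @mvt_sym _ fe ge x (x + h).
  by move=> y /inb yh; have [] := Hy y (le_lt_trans yh hr).
have [_ _ gc] := Hy c (le_lt_trans (inb _ ch) hr).
have [_ fx _] : [/\ is_derive x 1 fe (ge x), `|fe x - f x| <= e' / (2 + `|h|)
    & `|ge x - g x| <= e' / (2 + `|h|)] by apply: Hy; rewrite subrr normr0.
have [_ fxh _] : [/\ is_derive (x + h) 1 fe (ge (x + h)),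
    `|fe (x + h) - f (x + h)| <= e' / (2 + `|h|)
    & `|ge (x + h) - g (x + h)| <= e' / (2 + `|h|)].
  by apply: Hy; rewrite addrC addrA subrr add0r || rewrite addrAC subrr add0r.
have gcx : `|g c - g x| <= e.
  by rewrite distrC; apply: hd; rewrite /ball/= distrC (le_lt_trans (inb _ ch)).
have -> : f (x + h) - f x - h * g x = - (fe (x + h) - f (x + h)) + (fe x - f x)
    + h * (ge c - g c) + h * (g c - g x).
  have {}E : fe (x + h) - fe x = ge c * h by rewrite E; congr (_ * _); ring.
  have -> : fe (x + h) = fe x + ge c * h by rewrite -E; ring.
  ring.
set q := e' / (2 + `|h|) in fx fxh gc e2 *.
have qE : e' = 2 * q + `|h| * q.
  by rewrite -mulrDl mulrC /q divfK// gt_eqF// ltr_wpDr.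
have b4 : `|h * (g c - g x)| <= e * `|h| by rewrite normrM mulrC ler_wpM2r.
have b3 : `|h * (ge c - g c)| <= `|h| * q by rewrite normrM ler_wpM2l.
set X := - _; set Y := _ - f x; set Z := h * (ge c - g c); set W := h * _.
have b1 : `|X| <= q by rewrite normrN.
have := ler_normD (X + Y + Z) W; have := ler_normD (X + Y) Z; have := ler_normD X Y.
by rewrite qE; lra.
Qed.

Lemma is_derive_curve (F : R * R -> R) (p v : R * R) (d : R) :
  is_derive (0 : R) 1 (fun h => F (h *: v + p)) d -> is_derive p v F d.
Proof.
move=> [dF dFd].
have E : (fun h : R => h^-1 *: ((F \o shift p) (h *: v) - F p)) =
    (fun h : R => h^-1 *: (((fun h => F (h *: v + p)) \o shift 0) (h *: (1 : R))
       - F (0 *: v + p))).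
  by apply/funext => h /=; rewrite scale0r add0r /shift/= addr0 [_ *: 1]mulr1.
by split; [move: dF; rewrite /derivable E|rewrite -dFd /derive E].
Qed.

(** The increment is taken along two sides of a rectangle, in s at height [t + h * b] and in t at
    abscissa [s], each by the mean value theorem. All directions [v] are treated because [smooth]
    quantifies over them. *)
Lemma is_derive_C1 (A : set R) (f fs ft : R -> R -> R) (s t : R) (v : R * R) :
  open A -> A s -> ct2 A fs -> ct2 A ft ->
  (forall s t : R, A s -> is_derive s 1 (f^~ t) (fs s t)) ->
  (forall s t : R, A s -> is_derive t 1 (f s) (ft s t)) ->
  is_derive (s, t) v (fun p : R * R => f p.1 p.2) (v.1 * fs s t + v.2 * ft s t).
Proof.
case: v => a b oA As cs ct ds dt; apply: is_derive_curve; apply: is_derive_lin.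
move=> e e0.
(* The summand 1 covers the direction [v = 0]. *)
have k0 : 0 < `|a| + `|b| + 1 by rewrite ltr_wpDl// addr_ge0.
pose e1 := e / (`|a| + `|b| + 1).
have e10 : 0 < e1 by rewrite divr_gt0.
have ce := (cs s t As); have cte := (ct s t As).
move/cvgrPdist_le : ce => /(_ e1 e10) [[U1 W1] /= [U1s W1t] H1].
move/cvgrPdist_le : cte => /(_ e1 e10) [[U2 W2] /= [U2s W2t] H2].
have [d /= d0 hd] := (nbhs_ballP _ _).1
  (filterI (near_open oA As) (filterI U1s U2s)).
have [d' /= d'0 hd'] := (nbhs_ballP _ _).1 (filterI W1t W2t).
near=> h.
have small (k : R) : `|k| <= `|a| + `|b| + 1 -> `|h * k| < Num.min d d'.
  move=> hk; rewrite normrM; apply: (@le_lt_trans _ _ (`|h| * (`|a| + `|b| + 1))).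
    by rewrite ler_wpM2l.
  rewrite -ltr_pdivlMr//; near: h; apply/nbhs_ballP.
  exists (Num.min d d' / (`|a| + `|b| + 1)) => /=.
    by rewrite divr_gt0// lt_min d0 d'0.
  by move=> h; rewrite /ball/= sub0r normrN.
have inb (x k y : R) : Num.min x (x + h * k) <= y <= Num.max x (x + h * k) ->
    `|y - x| <= `|h * k|.
  by move=> /between_dist; rewrite [x + h * k]addrC addrK.
have na : `|a| <= `|a| + `|b| + 1 by have := normr_ge0 b; lra.
have nb : `|b| <= `|a| + `|b| + 1 by have := normr_ge0 a; lra.
have inS y : Num.min s (s + h * a) <= y <= Num.max s (s + h * a) -> ball s d y.
  move=> /inb H; rewrite /ball/= distrC (le_lt_trans H)//.
  by have := small _ na; rewrite lt_min => /andP[].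
have inT y : Num.min t (t + h * b) <= y <= Num.max t (t + h * b) -> ball t d' y.
  move=> /inb H; rewrite /ball/= distrC (le_lt_trans H)//.
  by have := small _ nb; rewrite lt_min => /andP[].
have Ts : ball s d s by exact: ballxx.
have Tt : ball t d' t by exact: ballxx.
have Th : ball t d' (t + h * b) by apply: inT; rewrite ge_min le_max !lexx !orbT.
have [|c1 c1h E1] := @mvt_sym _ (f^~ (t + h * b)) (fs^~ (t + h * b)) s (s + h * a).
  by move=> y /inS/hd [Ay _]; exact: ds.
have [|c2 c2h E2] := @mvt_sym _ (f s) (ft s) t (t + h * b).
  by move=> y _; exact: dt.
have B1 : `|fs s t - fs c1 (t + h * b)| <= e1.
  have [_ [u1 _]] := hd _ (inS _ c1h); have [w1 _] := hd' _ Th.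
  exact: (H1 (c1, t + h * b) (conj u1 w1)).
have B2 : `|ft s t - ft s c2| <= e1.
  have [_ [_ u2]] := hd _ Ts; have [_ w2] := hd' _ (inT _ c2h).
  exact: (H2 (s, c2) (conj u2 w2)).
rewrite add0r scale0r add0r /= [h *: a + s]addrC [h *: b + t]addrC.
rewrite scale0r add0r.
have -> : h *: a = h * a by []. have -> : h *: b = h * b by [].
have -> : f (s + h * a) (t + h * b) - f s t - h * (a * fs s t + b * ft s t) =
   h * (a * (fs c1 (t + h * b) - fs s t) + b * (ft s c2 - ft s t)).
  have -> : f (s + h * a) (t + h * b) - f s t =
    (f (s + h * a) (t + h * b) - f s (t + h * b)) + (f s (t + h * b) - f s t) by ring.
  by rewrite E1 E2; ring.
rewrite normrM mulrC ler_wpM2r//.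
rewrite (le_trans (ler_normD _ _))// !normrM.
have -> : e = (`|a| + `|b| + 1) * e1 by rewrite mulrC divfK ?gt_eqF.
rewrite distrC in B1; rewrite distrC in B2.
have := ler_wpM2l (normr_ge0 a) B1; have := ler_wpM2l (normr_ge0 b) B2.
by rewrite !mulrDl mul1r; lra.
Unshelve. all: by end_near. Qed.

End TwoVariables.

(** * Energy estimates on cylinders *)

Section EnergyInequalities.
Context {R : realType}.
Implicit Types (k h x M : R) (A : set R) (F Q G : R -> R).

Lemma is_deriveN1 (f : R -> R) (x a : R) : is_derive x 1 f a ->
  is_derive x 1 (fun y => - f y) (- a).
Proof. by move=> df; exact: is_deriveN. Qed.

(* For a solution of f_s = L f_t + g with L = - J0, take F, Q and G to be the
   integrals over the circle of |f|^2, <f, L f_t> and |f_t|^2: then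
   F' = 2 Q + 2 <f, g> and Q' = 2 G + 2 <g, L f_t>, where the perturbation g is
   absorbed. *)
Definition level k A F Q G := exists F' Q' : R -> R, forall s : R, A s ->
  [/\ is_derive s 1 F (F' s), is_derive s 1 Q (Q' s),
      `|F' s - 2 * Q s| <= 2 * k * F s, 0 <= G s <= Q' s & 0 <= F s].

Lemma level_ndecr k A F Q G (x y : R) : x <= y ->
  (forall s, x <= s <= y -> A s) -> level k A F Q G -> Q x <= Q y.
Proof.
move=> xy sA [F' [Q' H]]; apply: (@ndecr_of_is_derive _ Q Q') => // s /sA/H.
  by case.
by case=> _ _ _ /andP[h1 h2] _; exact: le_trans h2.
Qed.

(** [Q] is nondecreasing and nearly half the slope of [F]. So [Q x] lies below the mean slope on the
    right of x and above that on the left, both of size [M / h]; the error [2 k F] accounts for the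
    summand 1. *)
Lemma level_Q_le k A F Q G x h M : 0 <= k <= 1 / 4 -> 0 < h ->
  (forall s, x - h <= s <= x + h -> A s) -> level k A F Q G ->
  (forall s, x - h <= s <= x + h -> F s <= M) ->
  `|Q x| <= M * (h^-1 + 1).
Proof.
move=> /andP[k0 k1] h0 sA lv FM; have [F' [Q' H]] := lv.
have hh : h * h^-1 = 1 by rewrite divff// gt_eqF.
have hi : 0 < h^-1 by rewrite invr_gt0.
have Fp (s : R) : x - h <= s <= x + h -> is_derive s 1 F (F' s).
  by move=> /sA/H[].
have M0 : 0 <= M.
  have xx : x - h <= x <= x + h by lra.
  by have [_ _ _ _ F0] := H _ (sA _ xx); exact: le_trans F0 (FM _ xx).
have Mh : 0 <= M * h^-1 by rewrite mulr_ge0// ltW.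
have kM (s : R) : x - h <= s <= x + h -> 0 <= F s /\ 2 * k * F s <= 1 / 2 * M.
  move=> sx; have [_ _ _ _ F0] := H _ (sA _ sx); have FMs := FM _ sx; split => //.
  by have := ler_wpM2l k0 FMs; nra.
rewrite ler_norml; apply/andP; split.
- have [||c /andP[c1 c2] E] := @mvt_between _ F F' (x - h) x; first by lra.
    by move=> s /andP[s1 s2]; apply: Fp; lra.
  have cx : x - h <= c <= x + h by lra.
  have Qc : Q c <= Q x.
    by apply: level_ndecr lv => // s /andP[s1 s2]; apply: sA; lra.
  have [_ _ + _ _] := H _ (sA _ cx); rewrite ler_norml => /andP[e1 e2].
  have [F0x Fx] := kM _ cx.
  have [F1 _] := kM x ltac:(lra); have FM1 := FM (x - h) ltac:(lra).
  have : - M <= F' c * h by rewrite (_ : F' c * h = F x - F (x - h)); [lra|rewrite E; ring].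
  move=> /(ler_wpM2r (ltW hi)); rewrite -mulrA hh mulr1 => E'.
  by rewrite mulrDr mulr1; lra.
- have [||c /andP[c1 c2] E] := @mvt_between _ F F' x (x + h); first by lra.
    by move=> s /andP[s1 s2]; apply: Fp; lra.
  have cx : x - h <= c <= x + h by lra.
  have Qc : Q x <= Q c.
    by apply: level_ndecr lv => // s /andP[s1 s2]; apply: sA; lra.
  have [_ _ + _ _] := H _ (sA _ cx); rewrite ler_norml => /andP[e1 e2].
  have [F0x Fx] := kM _ cx.
  have [F1 _] := kM x ltac:(lra); have FM1 := FM (x + h) ltac:(lra).
  have : F' c * h <= M by rewrite (_ : F' c * h = F (x + h) - F x); [lra|rewrite E; ring].
  move=> /(ler_wpM2r (ltW hi)); rewrite -mulrA hh mulr1 => E'.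
  by rewrite mulrDr mulr1; lra.
Qed.

(** [G] is at most [Q'], whose mean over an interval of length [h] is small because [Q] is bounded
    at both ends. *)
Lemma level_G_small k A F Q G x h M : 0 <= k <= 1 / 4 -> 0 < h ->
  (forall s, x - h <= s <= x + 2 * h -> A s) -> level k A F Q G ->
  (forall s, x - h <= s <= x + 2 * h -> F s <= M) ->
  exists2 xi, x <= xi <= x + h & G xi <= 2 * M * (h^-1 + 1) * h^-1.
Proof.
move=> k01 h0 sA lv FM; have [F' [Q' H]] := lv.
have hh : h * h^-1 = 1 by rewrite divff// gt_eqF.
have hi : 0 < h^-1 by rewrite invr_gt0.
have Q1 : `|Q x| <= M * (h^-1 + 1).
  by apply: (level_Q_le k01 h0 _ lv) => s /andP[s1 s2]; [apply: sA|apply: FM]; lra.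
have Q2 : `|Q (x + h)| <= M * (h^-1 + 1).
  by apply: (level_Q_le k01 h0 _ lv) => s /andP[s1 s2]; [apply: sA|apply: FM]; lra.
have [||c /andP[c1 c2] E] := @mvt_between _ Q Q' x (x + h); first by lra.
  by move=> s /andP[s1 s2]; have [] := H s; [apply: sA; lra|].
exists c; first by rewrite c1.
have [_ _ _ /andP[_ GQ] _] := H c (sA c ltac:(lra)).
apply: le_trans GQ _.
have E' : Q' c = (Q (x + h) - Q x) * h^-1.
  by rewrite E (_ : x + h - x = h) -?mulrA ?hh ?mulr1//; ring.
rewrite E' ler_wpM2r ?(ltW hi)//.
move: Q1 Q2; rewrite !ler_norml => /andP[a1 a2] /andP[b1 b2]; lra.
Qed.

(* G is small somewhere on either side of x, and nearly convex. *)
Lemma level_G_le k A F Q G Q1 G1 x h M : 0 <= k <= 1 / 4 -> 0 < h -> h <= 1 ->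
  (forall s, x - 2 * h <= s <= x + 2 * h -> A s) ->
  level k A F Q G -> level k A G Q1 G1 ->
  (forall s, x - 2 * h <= s <= x + 2 * h -> F s <= M) ->
  G x <= 4 * M * (h^-1 + 1) * h^-1.
Proof.
move=> k01 h0 h1 sA lv lv1 FM; have [G' [Q1' H]] := lv1; have /andP[k0 k1] := k01.
have [xi1 /andP[x1 x2] G1M] :
    exists2 xi, x - h <= xi <= x - h + h & G xi <= 2 * M * (h^-1 + 1) * h^-1.
  by apply: (level_G_small k01 h0 _ lv) => s /andP[s1 s2]; [apply: sA|apply: FM]; lra.
have [xi2 /andP[x3 x4] G2M] :
    exists2 xi, x <= xi <= x + h & G xi <= 2 * M * (h^-1 + 1) * h^-1.
  by apply: (level_G_small k01 h0 _ lv) => s /andP[s1 s2]; [apply: sA|apply: FM]; lra.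
have -> : 4 * M * (h^-1 + 1) * h^-1 = 2 * (2 * M * (h^-1 + 1) * h^-1) by ring.
have [Q0|Q0] := leP 0 (Q1 x).
- have : (1 + (x - x)) * G x <= (1 + (xi2 - x)) * G xi2.
    apply: (@ndecr_of_is_derive _ (fun s => (1 + (s - x)) * G s)
      (fun s => (1 + (s - x)) * G' s + G s)) => // s /andP[s1 s2].
      have As : A s by apply: sA; lra.
      have [dG _ _ _ _] := H s As.
      have d1 := is_deriveD1 (is_derive_cst1 (1 : R) s)
        (is_deriveB1 (is_derive_id1 s) (is_derive_cst1 x s)).
      by apply: is_derive1_eq (is_deriveM1 d1 dG) _; ring.
    have As : A s by apply: sA; lra.
    have [_ _ + _ G0] := H s As; rewrite ler_norml => /andP[e1 _].
    have Qs : Q1 x <= Q1 s.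
      by apply: level_ndecr lv1 => // s' /andP[s'1 s'2]; apply: sA; lra.
    have e2 : - (1 / 2) * G s <= G' s by nra.
    have := ler_wpM2l (_ : 0 <= 1 + (s - x)) e2 => /(_ ltac:(lra)).
    by nra.
  have [_ _ _ _ G0] := H xi2 (sA xi2 ltac:(lra)).
  have : (xi2 - x) * G xi2 <= 1 * G xi2 by rewrite ler_wpM2r//; lra.
  by rewrite subrr addr0 mul1r [(1 + _) * _]mulrDl; lra.
- have : - ((1 + (x - xi1)) * G xi1) <= - ((1 + (x - x)) * G x).
    apply: (@ndecr_of_is_derive _ (fun s => - ((1 + (x - s)) * G s))
      (fun s => - ((1 + (x - s)) * G' s - G s))) => [|s /andP[s1 s2]|s /andP[s1 s2]].
    + lra.
    + have As : A s by apply: sA; lra.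
      have [dG _ _ _ _] := H s As.
      have d1 := is_deriveD1 (is_derive_cst1 (1 : R) s)
        (is_deriveB1 (is_derive_cst1 x s) (is_derive_id1 s)).
      apply: is_derive1_eq (is_deriveN1 (is_deriveM1 d1 dG)) _.
      by ring.
    have As : A s by apply: sA; lra.
    have [_ _ + _ G0] := H s As; rewrite ler_norml => /andP[_ e1].
    have Qs : Q1 s <= Q1 x.
      by apply: level_ndecr lv1 => // s' /andP[s'1 s'2]; apply: sA; lra.
    have e2 : G' s <= (1 / 2) * G s by nra.
    have := ler_wpM2l (_ : 0 <= 1 + (x - s)) e2 => /(_ ltac:(lra)).
    by nra.
  have [_ _ _ _ G0] := H xi1 (sA xi1 ltac:(lra)).
  have : (x - xi1) * G xi1 <= 1 * G xi1 by rewrite ler_wpM2r//; lra.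
  by rewrite subrr addr0 mul1r [(1 + _) * _]mulrDl; lra.
Qed.

(* Since F <= G <= Q', the function Q + F / 2 grows at least like exp s and
   - Q + F / 2 decays at least like exp (- s). *)
Lemma level_decay k A F Q G (a b s h M : R) : 0 <= k <= 1 / 4 -> 0 < h ->
  a <= s <= b -> (forall s, a - h <= s <= b + h -> A s) ->
  level k A F Q G -> (forall s, a - h <= s <= b + h -> F s <= G s) ->
  (forall s, a - h <= s <= b + h -> F s <= M) ->
  F s <= M * (h^-1 + 2) * (expR (s - b) + expR (a - s)).
Proof.
move=> k01 h0 /andP[as_ sb] sA lv FG FM; have [F' [Q' H]] := lv.
have /andP[k0 k1] := k01.
have Qb : `|Q b| <= M * (h^-1 + 1).
  by apply: (level_Q_le k01 h0 _ lv) => y /andP[s1 s2]; [apply: sA|apply: FM]; lra.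
have Qa : `|Q a| <= M * (h^-1 + 1).
  by apply: (level_Q_le k01 h0 _ lv) => y /andP[s1 s2]; [apply: sA|apply: FM]; lra.
have de c (y : R) : is_derive y 1 (fun y => expR (c - y)) (- expR (c - y)).
  have := @is_derive1_comp _ expR (fun y => c - y) y _ _ (is_derive_expR (c - y))
    (is_deriveB1 (is_derive_cst1 c y) (is_derive_id1 y)).
  by rewrite sub0r mulrN1.
have de' c (y : R) : is_derive y 1 (fun y => expR (y - c)) (expR (y - c)).
  have := @is_derive1_comp _ expR (fun y => y - c) y _ _ (is_derive_expR (y - c))
    (is_deriveB1 (is_derive_id1 y) (is_derive_cst1 c y)).
  by rewrite subr0 mulr1.
(* [F' / 2] is at least [Q - k F] and [Q'] at least [G >= F], so the bracket in the derivative is at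
   least [(1 / 2 - k) F]. *)
have P : expR (b - s) * (Q s + 1 / 2 * F s) <= expR (b - b) * (Q b + 1 / 2 * F b).
  apply: (@ndecr_of_is_derive _ (fun y => expR (b - y) * (Q y + 1 / 2 * F y))
    (fun y => expR (b - y) * ((Q' y + 1 / 2 * F' y) - (Q y + 1 / 2 * F y)))) => [|y /andP[y1 y2]|y /andP[y1 y2]].
  - by [].
  - have [dF dQ _ _ _] := H y (sA y ltac:(lra)).
    apply: is_derive1_eq (is_deriveM1 (de b y)
      (is_deriveD1 dQ (is_deriveZ1 (1 / 2) dF))) _.
    by ring.
  rewrite mulr_ge0 ?expR_ge0//.
  have [_ _ + /andP[_ e2] F0] := H y (sA y ltac:(lra)).
  rewrite ler_norml => /andP[e1 _]; have := FG y ltac:(lra).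
  by have := ler_wpM2r F0 k1; nra.
have N : 0 - expR (a - a) * (- Q a + 1 / 2 * F a) <=
   0 - expR (s - a) * (- Q s + 1 / 2 * F s).
  apply: (@ndecr_of_is_derive _ (fun y => 0 - expR (y - a) * (- Q y + 1 / 2 * F y))
    (fun y => - (expR (y - a) * ((- Q' y + 1 / 2 * F' y) + (- Q y + 1 / 2 * F y))))) => [|y /andP[y1 y2]|y /andP[y1 y2]].
  - by [].
  - have [dF dQ _ _ _] := H y (sA y ltac:(lra)).
    have dN : is_derive y 1 (fun y => - Q y + 1 / 2 * F y) (- Q' y + 1 / 2 * F' y).
      exact: is_deriveD1 (is_deriveN1 dQ) (is_deriveZ1 (1 / 2) dF).
    apply: is_derive1_eq (is_deriveB1 (is_derive_cst1 0 y)
      (is_deriveM1 (de' a y) dN)) _.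
    by ring.
  rewrite oppr_ge0 mulr_ge0_le0 ?expR_ge0//.
  have [_ _ + /andP[_ e2] F0] := H y (sA y ltac:(lra)).
  rewrite ler_norml => /andP[_ e1]; have := FG y ltac:(lra).
  by have := ler_wpM2r F0 k1; nra.
have M0 : 0 <= M.
  have [_ _ _ _ F0] := H s (sA s ltac:(lra)).
  by apply: le_trans F0 (FM s ltac:(lra)).
rewrite !subrr expR0 in P N.
have Pb : Q s + 1 / 2 * F s <= expR (s - b) * (M * (h^-1 + 2)).
  rewrite -(opprB b s) expRN [leRHS]mulrC ler_pdivlMr ?expR_gt0// [leLHS]mulrC (le_trans P)//.
  move: Qb; rewrite ler_norml => /andP[_ q]; have := FM b ltac:(lra); rewrite !mulrDr in q *; lra.
have Nb : - Q s + 1 / 2 * F s <= expR (a - s) * (M * (h^-1 + 2)).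
  rewrite -(opprB s a) expRN [leRHS]mulrC ler_pdivlMr ?expR_gt0// [leLHS]mulrC.
  move: Qa; rewrite ler_norml => /andP[q _]; have := FM a ltac:(lra); rewrite !mulrDr in q N *; lra.
have -> : F s = (Q s + 1 / 2 * F s) + (- Q s + 1 / 2 * F s) by field.
by rewrite [leRHS]mulrC mulrDl lerD.
Qed.

End EnergyInequalities.

(** * Energy identities for the perturbed Cauchy-Riemann equation *)

Section CylinderEnergy.
Context {R : realType} {n : nat}.
Variables (tau : 'I_n -> 'I_n) (sg : 'I_n -> R).
Hypothesis tauK : involutive tau.
Hypothesis sg2 : forall i, sg i ^+ 2 = 1.
Hypothesis sgN : forall i, sg (tau i) = - sg i.

(* A family f is the tuple of coordinates of a map, and J0 maps it to the family
   with coordinates sg i * f (tau i). *)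
Local Notation fam := ('I_n -> R -> R -> R).
Implicit Types (f g : fam) (A : set R).

(** A single family [fts] plays the part of both mixed derivatives: their equality belongs to the
    data. It comes from [schwarz] for smooth maps and from the equation for holomorphic ones. *)
Record cyl A f ft fs fts g : Prop := Cyl {
  cyl_f : forall i, ct2 A (f i);
  cyl_ft : forall i, ct2 A (ft i);
  cyl_fs : forall i, ct2 A (fs i);
  cyl_fts : forall i, ct2 A (fts i);
  cyl_g : forall i, ct2 A (g i);
  cyl_dt : forall i (s t : R), A s -> is_derive t 1 (f i s) (ft i s t);
  cyl_ds : forall i (s t : R), A s -> is_derive s 1 ((f i)^~ t) (fs i s t);
  cyl_dts : forall i (s t : R), A s -> is_derive s 1 ((ft i)^~ t) (fts i s t);
  cyl_dst : forall i (s t : R), A s -> is_derive t 1 (fs i s) (fts i s t);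
  cyl_per : forall i (s t : R), A s -> f i s (t + 1) = f i s t;
  cyl_eq : forall i (s t : R), A s -> fs i s t = - sg i * ft (tau i) s t + g i s t }.

#[global] Arguments cyl_f {A f ft fs fts g} _ i.
#[global] Arguments cyl_ft {A f ft fs fts g} _ i.
#[global] Arguments cyl_fs {A f ft fs fts g} _ i.
#[global] Arguments cyl_fts {A f ft fs fts g} _ i.
#[global] Arguments cyl_g {A f ft fs fts g} _ i.
#[global] Arguments cyl_dt {A f ft fs fts g} _ i s t _.
#[global] Arguments cyl_ds {A f ft fs fts g} _ i s t _.
#[global] Arguments cyl_dts {A f ft fs fts g} _ i s t _.
#[global] Arguments cyl_dst {A f ft fs fts g} _ i s t _.
#[global] Arguments cyl_per {A f ft fs fts g} _ i s t _.
#[global] Arguments cyl_eq {A f ft fs fts g} _ i s t _.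

Definition en f s := \sum_i I01 (fun t => f i s t ^+ 2).
Definition ip f g s := \sum_i I01 (fun t => f i s t * g i s t).
(** This is -J0, isometric and antisymmetric by the hypotheses on [tau] and [sg]. *)
Definition twist f : fam := fun i s t => - sg i * f (tau i) s t.

Lemma en_ge0 f s : 0 <= en f s.
Proof. by apply: sumr_ge0 => i _; apply: I01_ge0 => t; exact: sqr_ge0. Qed.

Lemma tau_bij : bijective tau.
Proof. by exists tau. Qed.

Lemma en_twist A f s : (forall i, ct2 A (f i)) -> A s ->
  en (twist f) s = en f s.
Proof.
move=> cf As; rewrite /en (reindex tau); last exact: onW_bij tau_bij.
apply: eq_bigr => i _; apply: I01_eq => t.
by rewrite /twist exprMn sqrrN sg2 mul1r tauK.
Qed.

Lemma ct2_twist A f : (forall i, ct2 A (f i)) -> forall i, ct2 A (twist f i).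
Proof. by move=> cf i; apply: ct2_scale; exact: cf. Qed.

(** Young's inequality, pointwise in t and then integrated. The weight is free: if
    [en g <= k ^+ 2 * en f], the choice [c = k] makes both terms at most [k * en f]. *)
Lemma ip_le A f g s c : 0 < c -> (forall i, ct2 A (f i)) -> (forall i, ct2 A (g i)) ->
  A s -> `|2 * ip f g s| <= c * en f s + c^-1 * en g s.
Proof.
move=> c0 cf cg As.
have ci : c * c^-1 = 1 by rewrite divff// gt_eqF.
have ci0 : 0 < c^-1 by rewrite invr_gt0.
have cfi i := ct2_slice (cf i) As; have cgi i := ct2_slice (cg i) As.
have cM i := continuousM1 (cfi i) (cgi i).
have cS i := continuousM1 (@continuous_cst1 _ c) (continuous_sqr1 (cfi i)).
have cS' i := continuousM1 (@continuous_cst1 _ c^-1) (continuous_sqr1 (cgi i)).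
rewrite /ip mulr_sumr /en !mulr_sumr -big_split/= (le_trans (ler_norm_sum _ _ _))//.
apply: ler_sum => i _.
rewrite -I01Z// -I01Z; last exact: continuous_sqr1.
rewrite -I01Z; last exact: continuous_sqr1.
rewrite -I01D// ler_norml -[X in X <= _ <= _]mulN1r -I01Z; last exact: continuousD1.
have key (x y : R) : - (c * x ^+ 2 + c^-1 * y ^+ 2) <= 2 * (x * y) <= c * x ^+ 2 + c^-1 * y ^+ 2.
  have h1 : 0 <= c^-1 * (c * x - y) ^+ 2 by rewrite mulr_ge0// ?sqr_ge0// ltW.
  have h2 : 0 <= c^-1 * (c * x + y) ^+ 2 by rewrite mulr_ge0// ?sqr_ge0// ltW.
  have E1 : c^-1 * (c * x - y) ^+ 2 = (c * c^-1) * (c * x ^+ 2 - 2 * (x * y)) + c^-1 * y ^+ 2 by ring.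
  have E2 : c^-1 * (c * x + y) ^+ 2 = (c * c^-1) * (c * x ^+ 2 + 2 * (x * y)) + c^-1 * y ^+ 2 by ring.
  by rewrite E1 ci in h1; rewrite E2 ci in h2; apply/andP; split; lra.
apply/andP; split; apply: I01_le.
- by apply: continuousM1; [exact: continuous_cst1|exact: continuousD1].
- by apply: continuousM1; [exact: continuous_cst1|exact: cM].
- by move=> t; rewrite mulN1r; have /andP[] := key (f i s t) (g i s t).
- by apply: continuousM1; [exact: continuous_cst1|exact: cM].
- exact: continuousD1.
- by move=> t; have /andP[] := key (f i s t) (g i s t).
Qed.

Lemma ipDr A f g h s : (forall i, ct2 A (f i)) -> (forall i, ct2 A (g i)) ->
  (forall i, ct2 A (h i)) -> A s ->
  ip f (fun i s t => g i s t + h i s t) s = ip f g s + ip f h s.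
Proof.
move=> cf cg ch As; rewrite /ip -big_split/=; apply: eq_bigr => i _.
have c1 := ct2_slice (cf i) As; have c2 := ct2_slice (cg i) As.
have c3 := ct2_slice (ch i) As.
rewrite -I01D; [|exact: continuousM1..].
by apply: I01_eq => t; rewrite mulrDr.
Qed.

Lemma ipC f g s : ip f g s = ip g f s.
Proof. by apply: eq_bigr => i _; apply: I01_eq => t; rewrite mulrC. Qed.

Lemma ip_en f s : ip f f s = en f s.
Proof. by apply: eq_bigr => i _; apply: I01_eq => t; rewrite expr2. Qed.

Lemma en_derive A f fs s : open A -> A s -> (forall i, ct2 A (f i)) ->
  (forall i, ct2 A (fs i)) ->
  (forall i (s t : R), A s -> is_derive s 1 ((f i)^~ t) (fs i s t)) ->
  is_derive s 1 (en f) (2 * ip f fs s).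
Proof.
move=> oA As cf cfs df.
have dd i : is_derive s 1 (fun s => I01 (fun t => f i s t ^+ 2))
    (I01 (fun t => 2 * (f i s t * fs i s t))).
  apply: (@I01_derive _ A (fun s t => f i s t ^+ 2)
    (fun s t => 2 * (f i s t * fs i s t)) s oA As).
  - exact: ct2_sqr.
  - exact: ct2_scale (ct2_mul (cf i) (cfs i)).
  - by move=> s' t As'; exact: is_derive_sqr1 (df i s' t As').
apply: is_derive1_eq (is_derive_sum1 dd) _.
rewrite /ip mulr_sumr; apply: eq_bigr => i _; rewrite I01Z//.
by apply: continuousM1; [exact: ct2_slice (cf i) As|exact: ct2_slice (cfs i) As].
Qed.

Section level.
Variables (A : set R) (f ft fs fts g : fam).
Hypothesis oA : open A.
Hypothesis C : cyl A f ft fs fts g.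

Lemma cyl_fs_per i (s t : R) : A s -> fs i s (t + 1) = fs i s t.
Proof.
move=> As; apply: (is_derive1_unique (cyl_ds C i s (t + 1) As)).
apply: near_eq_is_derive (cyl_ds C i s t As).
near=> x; rewrite (cyl_per C)//; near: x; exact: near_open.
Unshelve. all: by end_near. Qed.

Lemma cyl_ft_per i (s t : R) : A s -> ft i s (t + 1) = ft i s t.
Proof.
by move=> As; apply: periodic_is_derive (fun t => cyl_dt C i s t As) _ _ => x; rewrite (cyl_per C).
Qed.

Lemma I01_parts i j (s : R) : A s ->
  I01 (fun t => f i s t * fts j s t) = - I01 (fun t => ft i s t * fs j s t).
Proof.
move=> As.
have c1 := continuousM1 (ct2_slice (cyl_f C i) As) (ct2_slice (cyl_fts C j) As).
have c2 := continuousM1 (ct2_slice (cyl_ft C i) As) (ct2_slice (cyl_fs C j) As).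
have cc := continuousD1 c1 c2.
apply/eqP; rewrite -subr_eq0 opprK -I01D//.
have dd (t : R) : 0 <= t <= 1 -> is_derive t 1 (fun t => f i s t * fs j s t)
    (f i s t * fts j s t + ft i s t * fs j s t).
  move=> _; apply: is_derive1_eq (is_deriveM1 (cyl_dt C i s t As) (cyl_dst C j s t As)) _.
  by rewrite [ft _ _ _ * _]mulrC.
have p1 : f i s 1 = f i s 0 by rewrite -(cyl_per C i s 0 As) add0r.
have p2 : fs j s 1 = fs j s 0 by rewrite -(cyl_fs_per j 0 As) add0r.
by rewrite (I01_ftc cc dd) p1 p2 subrr.
Qed.

Lemma cyl_fsE i (s t : R) : A s -> fs i s t = twist ft i s t + g i s t.
Proof. exact: cyl_eq C i s t. Qed.

Lemma ip_fs h s : (forall i, ct2 A (h i)) -> A s ->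
  ip h fs s = ip h (twist ft) s + ip h g s.
Proof.
move=> ch As; rewrite -(ipDr ch (ct2_twist (cyl_ft C)) (cyl_g C) As).
by apply: eq_bigr => i _; apply: I01_eq => t; rewrite cyl_fsE.
Qed.

Lemma cyl_en_derive s : A s ->
  is_derive s 1 (en f) (2 * ip f (twist ft) s + 2 * ip f g s).
Proof.
move=> As; apply: is_derive1_eq (en_derive oA As (cyl_f C) (cyl_fs C) (cyl_ds C)) _.
by rewrite ip_fs ?mulrDr//; exact: cyl_f C.
Qed.

(** J0 is antisymmetric and so is d/dt on the circle, by parts; hence -J0 d/dt is symmetric. Both
    halves of the product rule are therefore equal, and Q' is twice the inner product of [twist ft]
    and [fs]. *)
Lemma cyl_Q_derive s : A s ->
  is_derive s 1 (ip f (twist ft)) (2 * en ft s + 2 * ip g (twist ft) s).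
Proof.
move=> As; have ctw := ct2_twist (cyl_ft C); have ctws := ct2_twist (cyl_fts C).
have -> : 2 * en ft s + 2 * ip g (twist ft) s =
    \sum_i I01 (fun t => f i s t * twist fts i s t + twist ft i s t * fs i s t).
  have -> : en ft s = ip (twist ft) (twist ft) s.
    by rewrite ip_en (en_twist (cyl_ft C) As).
  rewrite [ip g _ _]ipC -mulrDr -(ip_fs ctw As).
  have spl i : I01 (fun t => f i s t * twist fts i s t + twist ft i s t * fs i s t) =
     I01 (fun t => f i s t * twist fts i s t) + I01 (fun t => twist ft i s t * fs i s t).
    exact: I01D (continuousM1 (ct2_slice (cyl_f C i) As) (ct2_slice (ctws i) As))
      (continuousM1 (ct2_slice (ctw i) As) (ct2_slice (cyl_fs C i) As)).
  rewrite (eq_bigr _ (fun i _ => spl i)).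
  rewrite big_split/= mulr_natl mulr2n; congr (_ + _).
  rewrite /ip [RHS](reindex tau); last exact: onW_bij tau_bij.
  apply: eq_bigr => i _; rewrite /twist sgN opprK tauK.
  have c1 := continuousM1 (ct2_slice (cyl_f C (tau i)) As) (ct2_slice (cyl_fts C i) As).
  have c2 := continuousM1 (ct2_slice (cyl_ft C (tau i)) As) (ct2_slice (cyl_fs C i) As).
  have -> : I01 (fun t => f (tau i) s t * (sg i * fts i s t)) =
      sg i * I01 (fun t => f (tau i) s t * fts i s t).
    by rewrite -I01Z//; apply: I01_eq => t; rewrite mulrCA.
  rewrite I01_parts// mulrN -mulNr -I01Z//.
  by apply: I01_eq => t; rewrite mulrA.
apply: is_derive_sum1 => i.
apply: (I01_derive (f := fun s t => f i s t * twist ft i s t)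
  (f' := fun s t => f i s t * twist fts i s t + twist ft i s t * fs i s t) oA As).
- exact: ct2_mul (cyl_f C i) (ctw i).
- exact: ct2_add (ct2_mul (cyl_f C i) (ctws i)) (ct2_mul (ctw i) (cyl_fs C i)).
- move=> s' t As'; apply: is_deriveM1; first exact: cyl_ds C i _ _ As'.
  by apply: is_deriveZ1; exact: cyl_dts C _ _ _ As'.
Qed.

(** Young's inequality with weight [k] bounds the perturbation of F' by [2 k F], and that of Q' by
    [k (F + G) <= G], which leaves [G] out of the main term [2 G]. *)
Lemma cyl_level k : 0 < k <= 1 / 4 ->
  (forall s, A s -> en g s <= k ^+ 2 * en f s) ->
  (forall s, A s -> en f s <= en ft s) ->
  level k A (en f) (ip f (twist ft)) (en ft).
Proof.
move=> /andP[k0 k1] gk fft.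
exists (fun s => 2 * ip f (twist ft) s + 2 * ip f g s),
  (fun s => 2 * en ft s + 2 * ip g (twist ft) s) => s As.
have kk : k^-1 * k ^+ 2 = k by rewrite expr2 mulrA mulVf ?mul1r// gt_eqF.
have ki : 0 < k^-1 by rewrite invr_gt0.
have := ler_wpM2l (ltW ki) (gk s As); rewrite mulrA kk => gk'.
split.
- exact: cyl_en_derive.
- exact: cyl_Q_derive.
- rewrite addrAC subrr add0r.
  by have := ip_le k0 (cyl_f C) (cyl_g C) As; lra.
- rewrite en_ge0/= ipC.
  have := ip_le k0 (ct2_twist (cyl_ft C)) (cyl_g C) As.
  rewrite (en_twist (cyl_ft C) As) ler_norml => /andP[h _].
  have e0 := en_ge0 ft s; have := fft s As; have := ler_wpM2r e0 k1.
  have := ler_wpM2l (ltW k0) (fft s As); lra.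
- exact: en_ge0.
Qed.

Lemma cyl_level0 : (forall i s t, A s -> g i s t = 0) ->
  level 0 A (en f) (ip f (twist ft)) (en ft).
Proof.
move=> g0.
have ig h s : A s -> ip h g s = 0.
  move=> As; rewrite /ip big1// => i _.
  by rewrite -[RHS](I01_cst (0 : R)); apply: I01_eq => t; rewrite g0// mulr0.
exists (fun s => 2 * ip f (twist ft) s + 2 * ip f g s),
  (fun s => 2 * en ft s + 2 * ip g (twist ft) s) => s As; split.
- exact: cyl_en_derive.
- exact: cyl_Q_derive.
- by rewrite addrAC subrr add0r ig// !mulr0 mul0r normr0.
- by rewrite ipC ig// mulr0 addr0; have := en_ge0 ft s; lra.
- exact: en_ge0.
Qed.

End level.

End CylinderEnergy.

(** * Exponential decay of the oscillation around the circle mean *)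

Section Decay.
Context {R : realType} {n : nat}.
Variables (tau : 'I_n -> 'I_n) (sg : 'I_n -> R).
Hypothesis tauK : involutive tau.
Hypothesis sg2 : forall i, sg i ^+ 2 = 1.
Hypothesis sgN : forall i, sg (tau i) = - sg i.

Local Notation fam := ('I_n -> R -> R -> R).
Implicit Types (f g : fam) (A : set R).

Lemma continuous_sum1 (f : 'I_n -> R -> R) : (forall i, continuous (f i)) ->
  continuous (fun x => \sum_i f i x).
Proof.
by move=> cf x; apply: cvg_big => [|i _]; [exact: add_continuous|exact: cf].
Qed.

Definition mean f i s := I01 (f i s).
Definition osc f : fam := fun i s t => f i s t - mean f i s.

Lemma ct2_osc A f : open A -> (forall i, ct2 A (f i)) -> forall i, ct2 A (osc f i).
Proof.
move=> oA cf i; apply: ct2_sub; first exact: cf.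
by apply: ct2_of_s => s As; exact: I01_continuous (cf i) As.
Qed.

#[local] Arguments ct2_osc A f _ _ i : clear implicits.
#[local] Arguments ct2_osc {A f} _ _ i.

Lemma en_osc_le A f ft s : A s -> (forall i, ct2 A (f i)) -> (forall i, ct2 A (ft i)) ->
  open A ->
  (forall i (s t : R), A s -> is_derive t 1 (f i s) (ft i s t)) ->
  (forall i s t, A s -> f i s (t + 1) = f i s t) -> en (osc f) s <= en ft s.
Proof.
move=> As cf cft oA df pf; apply: ler_sum => i _.
rewrite -[leRHS]I01_cst; apply: I01_le => [||t].
- by apply: continuous_sqr1; exact: ct2_slice (ct2_osc oA cf i) As.
- exact: continuous_cst1.
- exact: (poincare t (fun t => df i s t As) (ct2_slice (cft i) As) (fun x => pf i s x As)).
Qed.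

Lemma osc_sqr_le A f ft i s t : A s -> (forall i, ct2 A (ft i)) ->
  (forall i (s t : R), A s -> is_derive t 1 (f i s) (ft i s t)) ->
  (forall i s t, A s -> f i s (t + 1) = f i s t) ->
  osc f i s t ^+ 2 <= en ft s.
Proof.
move=> As cft df pf; rewrite /en (bigD1 i)//= ler_wpDr//.
  by apply: sumr_ge0 => j _; apply: I01_ge0 => x; exact: sqr_ge0.
exact: (poincare t (fun t => df i s t As) (ct2_slice (cft i) As) (fun x => pf i s x As)).
Qed.

(** [osc g] at t is the mean over x of g(t) - g(x), to which Jensen and the Lipschitz bound apply;
    differences of [f] are differences of [osc f], and expanding the square gives the factor 4. This
    makes the perturbation small relative to the oscillation, although it need not be small relative
    to [f]. *)
Lemma en_osc_lip A f g k s : open A -> A s -> (forall i, ct2 A (f i)) ->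
  (forall i, ct2 A (g i)) ->
  (forall t t', \sum_i (g i s t - g i s t') ^+ 2 <=
     k ^+ 2 * \sum_i (f i s t - f i s t') ^+ 2) ->
  en (osc g) s <= (2 * k) ^+ 2 * en (osc f) s.
Proof.
move=> oA As cf cg lip.
have cgi i := ct2_slice (cg i) As; have cfi i := ct2_slice (ct2_osc oA cf i) As.
have cogi i := ct2_slice (ct2_osc oA cg i) As.
have cgt i t : continuous (fun x => g i s t - g i s x).
  by apply: continuousB1 => //; exact: continuous_cst1.
have csq i := continuous_sqr1 (cfi i).
have csum : continuous (fun x => \sum_i osc f i s x ^+ 2).
  exact: continuous_sum1.
have kk : 0 <= k ^+ 2 := sqr_ge0 k.
have pt t : \sum_i osc g i s t ^+ 2 <=
    2 * k ^+ 2 * (\sum_i osc f i s t ^+ 2 + en (osc f) s).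
  have h1 : \sum_i osc g i s t ^+ 2 <=
      I01 (fun x => \sum_i (g i s t - g i s x) ^+ 2).
    rewrite I01_sum => [|i]; last exact: continuous_sqr1.
    apply: ler_sum => i _; apply: le_trans (I01_sqr_le (cgt i t)).
    rewrite I01B//; last exact: continuous_cst1.
    by rewrite I01_cst.
  apply: (le_trans h1).
  have -> : en (osc f) s = I01 (fun x => \sum_i osc f i s x ^+ 2) by rewrite I01_sum.
  rewrite -[X in _ * (X + _)]I01_cst -I01D//; last exact: continuous_cst1.
  rewrite -I01Z; last by apply: continuousD1 => //; exact: continuous_cst1.
  apply: I01_le => [||x].
  - by apply: continuous_sum1 => i; exact: continuous_sqr1.
  - apply: continuousM1; first exact: continuous_cst1.
    by apply: continuousD1 => //; exact: continuous_cst1.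
  - apply: (le_trans (lip t x)); rewrite (mulrC 2 (k ^+ 2)) -(mulrA (k ^+ 2) 2) ler_wpM2l//.
    rewrite -big_split/= mulr_sumr; apply: ler_sum => i _.
    have -> : f i s t - f i s x = osc f i s t - osc f i s x by rewrite /osc; ring.
    by have := sqr_ge0 (osc f i s t + osc f i s x); lra.
rewrite /en -I01_sum => [|i]; last exact: continuous_sqr1.
have e : (2 * k) ^+ 2 * (\sum_i I01 (fun t => osc f i s t ^+ 2)) =
    I01 (fun t => 2 * k ^+ 2 * (\sum_i osc f i s t ^+ 2 + en (osc f) s)).
  rewrite I01Z; last by apply: continuousD1 => //; exact: continuous_cst1.
  rewrite I01D//; last exact: continuous_cst1.
  by rewrite I01_cst I01_sum// /en; ring.
rewrite e; apply: I01_le => //.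
- by apply: continuous_sum1 => i; exact: continuous_sqr1.
- apply: continuousM1; first exact: continuous_cst1.
  by apply: continuousD1 => //; exact: continuous_cst1.
Qed.

(** The Lipschitz bound applies to difference quotients and passes to the limit. It bounds the
    t-derivative of eps V(u) by that of u with no chain rule for V. *)
Lemma derive_lip (f g f' g' : 'I_n -> R -> R) k (t : R) :
  (forall i, is_derive t 1 (f i) (f' i t)) ->
  (forall i, is_derive t 1 (g i) (g' i t)) ->
  (forall x, \sum_i (g i x - g i t) ^+ 2 <= k ^+ 2 * \sum_i (f i x - f i t) ^+ 2) ->
  \sum_i g' i t ^+ 2 <= k ^+ 2 * \sum_i f' i t ^+ 2.
Proof.
move=> df dg lip.
have C (h h' : 'I_n -> R -> R) : (forall i, is_derive t 1 (h i) (h' i t)) ->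
    \sum_i (x^-1 * (h i (t + x) - h i t)) ^+ 2 @[x --> 0^'] --> \sum_i h' i t ^+ 2.
  move=> dh; apply: cvg_big => [|i _]; first exact: add_continuous.
  have : x^-1 *: ((h i \o shift t) (x *: (1 : R)) - h i t) @[x --> 0^'] --> h' i t.
    by have [c <-] := dh i; exact: c.
  move=> c; rewrite expr2; apply: cvg_trans (cvgM c c).
  apply: near_eq_cvg; near=> x.
  by rewrite /= expr2 /shift/= [x *: 1]mulr1 [x + t]addrC.
have Cf : k ^+ 2 * (\sum_i (x^-1 * (f i (t + x) - f i t)) ^+ 2) @[x --> (0 : R)^'] -->
    k ^+ 2 * (\sum_i f' i t ^+ 2).
  by apply: cvgM; [exact: cvg_cst|exact: C].
apply: (@ler_cvg_to R (0 : R)^' _ R _ _ _ _ (C g g' dg) Cf); near=> x.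
rewrite /=; under eq_bigr do rewrite exprMn; rewrite -mulr_sumr.
under [X in _ <= _ * X]eq_bigr do rewrite exprMn.
by rewrite -mulr_sumr mulrCA ler_wpM2l// sqr_ge0.
Unshelve. all: by end_near. Qed.

(** Bounding the energy of f_t takes two consecutive levels, so f_t is recorded as a perturbed
    solution too, the derivative of the perturbation being its own perturbation. *)
Record smooth_cyl A f ft fs ftt fts ftts g gt : Prop := SmoothCyl {
  sc0 : cyl tau sg A f ft fs fts g;
  sc1 : cyl tau sg A ft ftt fts ftts gt;
  sc_gt : forall i (s t : R), A s -> is_derive t 1 (g i s) (gt i s t) }.

Section means.
Variables (A : set R) (f ft fs fts g : fam).
Hypothesis oA : open A.
Hypothesis C : cyl tau sg A f ft fs fts g.

Lemma mean_ft i s : A s -> mean ft i s = 0.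
Proof.
move=> As; rewrite /mean (I01_ftc (ct2_slice (cyl_ft C i) As)
  (fun t _ => cyl_dt C i s t As)).
by rewrite -(cyl_per C i s 0 As) add0r subrr.
Qed.

Lemma mean_fs i s : A s -> mean fs i s = mean g i s.
Proof.
move=> As.
have c1 := ct2_slice (cyl_ft C (tau i)) As.
rewrite /mean (I01_eq (fun t => cyl_eq C i s t As)) I01D; last 2 first.
- by apply: continuousM1 => //; exact: continuous_cst1.
- exact: ct2_slice (cyl_g C i) As.
by rewrite I01Z// -/(mean ft (tau i) s) mean_ft// mulr0 add0r.
Qed.

(** The J0 term is a t-derivative and integrates to zero over the circle. What remains, the mean of
    the perturbation, is the source of the flow line. *)
Lemma mean_derive i s : A s -> is_derive s 1 (mean f i) (mean g i s).
Proof.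
move=> As; rewrite -mean_fs//.
exact: (I01_derive oA As (cyl_f C i) (cyl_fs C i) (fun s t As => cyl_ds C i s t As)).
Qed.

Lemma cyl_osc : cyl tau sg A (osc f) ft (osc fs) fts (osc g).
Proof.
split.
- exact: ct2_osc (cyl_f C).
- exact: cyl_ft C.
- exact: ct2_osc (cyl_fs C).
- exact: cyl_fts C.
- exact: ct2_osc (cyl_g C).
- move=> i s t As.
  by apply: is_derive1_eq (is_deriveB1 (cyl_dt C i s t As) (is_derive_cst1 _ _)) _; rewrite subr0.
- move=> i s t As; apply: is_derive1_eq (is_deriveB1 (cyl_ds C i s t As) (mean_derive i As)) _.
  by rewrite /osc mean_fs.
- exact: cyl_dts C.
- move=> i s t As.
  by apply: is_derive1_eq (is_deriveB1 (cyl_dst C i s t As) (is_derive_cst1 _ _)) _; rewrite subr0.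
- by move=> i s t As; rewrite /osc (cyl_per C).
- by move=> i s t As; rewrite /osc (cyl_eq C)// mean_fs// addrA.
Qed.

End means.

(** [4 * n] bounds the energy of the oscillation, each coordinate of which is at most 2; 16 is the
    inverse of the step 1/16 at which [level_decay] and [level_G_le] are applied; [expR 1] absorbs
    the variation of the exponentials within a window. *)
Definition decay_const : R :=
  4 * ((4 * n%:R * (16 + 2)) * expR 1) * (16 + 1) * 16.

Lemma decay_const_ge0 : 0 <= decay_const.
Proof. by rewrite /decay_const !mulr_ge0 ?expR_ge0//; lra. Qed.

(** [level_decay] gives decay of the oscillation up to 7/8 beyond -r and r; [level_G_le], on windows
    of half-width 1/8, converts it into decay of the energy of f_t. Subtracting means doubles the
    Lipschitz constant, hence 1/8 where the level inequalities ask for 1/4. *)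
Lemma en_ft_decay (r k : R) f ft fs ftt fts ftts g gt (x : R) :
  0 < r -> 0 < k <= 1 / 8 ->
  let A := [set s | - r - 1 < s < r + 1] in
  smooth_cyl A f ft fs ftt fts ftts g gt ->
  (forall s, A s -> forall t t', \sum_i (g i s t - g i s t') ^+ 2 <=
     k ^+ 2 * \sum_i (f i s t - f i s t') ^+ 2) ->
  (forall i s t, A s -> `|f i s t| <= 1) ->
  - r - 1 / 2 <= x <= r + 1 / 2 ->
  en ft x <= decay_const * (expR (x - r) + expR (- r - x)).
Proof.
move=> r0 /andP[k0 k1] A [C0 C1 dgt] lip f1 /andP[x1 x2].
have oA : open A.
  have -> : A = `](- r - 1), (r + 1)[%classic.
    by apply/seteqP; split => s /=; rewrite in_itv.
  exact: interval_open.
have k2 : 0 < 2 * k <= 1 / 4 by lra.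
have k2' : 0 <= 2 * k <= 1 / 4 by lra.
have Cw := cyl_osc oA C0.
have FG s : A s -> en (osc f) s <= en ft s.
  move=> As; exact: en_osc_le As (cyl_f C0) (cyl_ft C0) oA (cyl_dt C0) (cyl_per C0).
have L0 := @cyl_level _ _ _ _ tauK sg2 sgN A _ _ _ _ _ oA Cw (2 * k) k2
  (fun s As => en_osc_lip oA As (cyl_f C0) (cyl_g C0) (lip s As)) FG.
(* f_t has mean zero: it is its own oscillation, and Poincare bounds its energy by that of [ftt]. *)
have en_osc_ft s : A s -> en (osc ft) s = en ft s.
  move=> As; apply: eq_bigr => i _; apply: I01_eq => t.
  by rewrite /osc (mean_ft C0)// subr0.
have L1 : level (2 * k) A (en ft) (ip ft (twist tau sg ftt)) (en ftt).
  apply: (cyl_level tauK sg2 sgN oA C1 k2) => s As; last first.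
    rewrite -en_osc_ft//.
    exact: en_osc_le As (cyl_f C1) (cyl_ft C1) oA (cyl_dt C1) (cyl_per C1).
  apply: (@le_trans _ _ (k ^+ 2 * en ft s)); last first.
    by rewrite ler_wpM2r ?en_ge0//; nra.
  have c2 i := continuous_sqr1 (ct2_slice (cyl_f C1 i) As).
  rewrite /en -I01_sum => [|i]; last exact: continuous_sqr1 (ct2_slice (cyl_g C1 i) As).
  rewrite -I01_sum// -I01Z; last first.
    exact: continuous_sum1.
  apply: I01_le => [||t].
  - apply: continuous_sum1 => i.
    exact: continuous_sqr1 (ct2_slice (cyl_g C1 i) As).
  - apply: continuousM1; first exact: continuous_cst1.
    exact: continuous_sum1.
  - apply: (derive_lip (f := fun i => f i s) (g := fun i => g i s)
      (f' := fun i => ft i s) (g' := fun i => gt i s)) => [i|i|y].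
    + exact: cyl_dt C0 i s t As.
    + exact: dgt.
    + exact: lip.
have FM s : A s -> en (osc f) s <= 4 * n%:R.
  move=> As; rewrite /en.
  have -> : 4 * n%:R = \sum_(i < n) 4 :> R.
    by rewrite sumr_const card_ord mulr_natr.
  apply: ler_sum => i _; rewrite -[leRHS](I01_cst (4 : R)).
  have co := ct2_slice (ct2_osc oA (cyl_f C0) i) As.
  apply: I01_le => [||t]; [exact: continuous_sqr1|exact: continuous_cst1|].
  have h1 := f1 i s t As.
  have h2 : `|mean f i s| <= 1.
    apply: I01_norm_le => [|y _]; [exact: ct2_slice (cyl_f C0 i) As|exact: f1].
  move: h1 h2; rewrite !ler_norml /osc => /andP[? ?] /andP[? ?]; nra.
have i16 : (1 / 16 : R)^-1 = 16 by rewrite div1r invrK.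
have D s : - r - 7 / 8 <= s <= r + 7 / 8 ->
    en (osc f) s <= 4 * n%:R * (16 + 2) * (expR (s - r) + expR (- r - s)).
  move=> s78; have := @level_decay _ (2 * k) A _ _ _ (- r - 7 / 8) (r + 7 / 8) s
    (1 / 16) (4 * n%:R) k2' ltac:(lra) s78 _ L0.
  rewrite i16; move=> /(_ _ _ _)/le_trans; apply.
  - by move=> y y1; rewrite /A/=; lra.
  - by move=> y y1; apply: FG; rewrite /A/=; lra.
  - by move=> y y1; apply: FM; rewrite /A/=; lra.
  - rewrite ler_wpM2l//.
    by rewrite lerD// ler_expR; lra.
have := @level_G_le _ (2 * k) A _ _ _ _ _ x (1 / 16)
  ((4 * n%:R * (16 + 2)) * expR 1 * (expR (x - r) + expR (- r - x)))
  k2' ltac:(lra) ltac:(lra) _ L0 L1.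
rewrite i16; move=> /(_ _ _)/le_trans; apply.
- by move=> y y1; rewrite /A/=; lra.
- move=> y y1; apply: le_trans (D y _) _; first by lra.
  rewrite -[leRHS]mulrA ler_wpM2l//.
  by rewrite mulrDr -!expRD lerD// ler_expR; lra.
- by rewrite /decay_const le_eqVlt; apply/orP; left; apply/eqP; ring.
Qed.

End Decay.

(** * Weakly holomorphic cylinders *)

Section WeaklyHolomorphic.
Context {R : realType} {n : nat}.
Variables (tau : 'I_n -> 'I_n) (sg : 'I_n -> R).
Hypothesis tauK : involutive tau.
Hypothesis sg2 : forall i, sg i ^+ 2 = 1.
Hypothesis sgN : forall i, sg (tau i) = - sg i.

Local Notation fam := ('I_n -> R -> R -> R).
Local Notation twist := (twist tau sg).
Implicit Types (f g : fam) (A : set R).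

Definition dquot (d : R) f : fam := fun i s t => d^-1 * (f i s (t + d) - f i s t).
Definition stek (d : R) f : fam := fun i => steklov d (f i).
Definition dsub f g : fam := fun i s t => f i s t - g i s t.

(* The equation f_s = - J0 f_t integrated over [t, t + d]: it involves no
   t-derivative, so that it passes to locally uniform limits. *)
Record weakhol A f : Prop := WeakHol {
  wh_c : forall i, ct2 A (f i);
  wh_per : forall i s t, A s -> f i s (t + 1) = f i s t;
  wh_ds : forall d i (s t : R), 0 < d -> A s ->
    is_derive s 1 ((stek d f i)^~ t) (twist (dquot d f) i s t) }.

Definition dhol A f f1 := forall i (s t : R), A s ->
  is_derive t 1 (f i s) (f1 i s t) /\ is_derive s 1 ((f i)^~ t) (twist f1 i s t).

Lemma ct2_dquot A f d : (forall i, ct2 A (f i)) -> forall i, ct2 A (dquot d f i).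
Proof.
move=> cf i; apply: ct2_scale; apply: ct2_sub; last exact: cf.
have := ct2_comp_t (c := d) (d := 1) (cf i).
have -> : (fun s t => f i s (d + 1 * t)) = (fun s t => f i s (t + d)).
  by apply/funext => s; apply/funext => t; rewrite mul1r addrC.
by [].
Qed.

Lemma stek_per A f d : (forall i s t, A s -> f i s (t + 1) = f i s t) ->
  forall i s t, A s -> stek d f i s (t + 1) = stek d f i s t.
Proof.
by move=> pf i s t As; apply: I01_eq => x; rewrite addrAC pf.
Qed.

Lemma dquot_per A f d : (forall i s t, A s -> f i s (t + 1) = f i s t) ->
  forall i s t, A s -> dquot d f i s (t + 1) = dquot d f i s t.
Proof. by move=> pf i s t As; rewrite /dquot addrAC !pf. Qed.

Lemma stek_dt A f d i (s t : R) : (forall i, ct2 A (f i)) -> 0 < d -> A s ->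
  is_derive t 1 (stek d f i s) (dquot d f i s t).
Proof.
move=> cf d0 As; apply: avg_derive; first by rewrite gt_eqF.
exact: ct2_slice (cf i) As.
Qed.

Lemma weakhol_C1 A f f1 : open A -> (forall i, ct2 A (f i)) ->
  (forall i, ct2 A (f1 i)) -> (forall i s t, A s -> f i s (t + 1) = f i s t) ->
  dhol A f f1 -> weakhol A f.
Proof.
move=> oA cf cf1 pf df; split => // d i s t d0 As.
have c1 := ct2_comp_t (c := t) (d := d) (cf i).
have c2 : ct2 A (fun s x => twist f1 i s (t + d * x)).
  by apply: ct2_comp_t; apply: ct2_twist.
apply: is_derive1_eq (I01_derive oA As c1 c2 (fun s x As => (df i s _ As).2)) _.
rewrite /twist/= I01Z; last first.
  by apply: continuous_affine; exact: ct2_slice (cf1 _) As.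
congr (_ * _); rewrite /dquot.
have := avg_primitive (t := t) (d := d) (ct2_slice (cf1 (tau i)) As)
   (fun x _ => (df (tau i) s _ As).1).
by move=> <-; rewrite mulKf// gt_eqF.
Qed.

(** Averaging gains one derivative: the integrated equation satisfied by [f] is the pointwise
    equation of its average, whose t-derivative is [dquot d f]. *)
Lemma dhol_stek A f d : 0 < d -> weakhol A f -> dhol A (stek d f) (dquot d f).
Proof.
by move=> d0 [cf pf wf] i s t As; split; [exact: stek_dt As|exact: wf].
Qed.

Lemma weakhol_stek A f d : open A -> 0 < d -> weakhol A f -> weakhol A (stek d f).
Proof.
move=> oA d0 wf; have [cf pf _] := wf; apply: weakhol_C1 (dhol_stek d0 wf) => //.
- by move=> i; exact: ct2_steklov.
- exact: ct2_dquot.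
- exact: stek_per.
Qed.

Lemma stek_dsub A f g d i s t : (forall i, ct2 A (f i)) -> (forall i, ct2 A (g i)) ->
  A s -> stek d (dsub f g) i s t = stek d f i s t - stek d g i s t.
Proof.
move=> cf cg As; apply: I01B; apply: continuous_affine.
  exact: ct2_slice (cf i) As.
exact: ct2_slice (cg i) As.
Qed.

Lemma stek_dquot A f d e i s t : (forall i, ct2 A (f i)) ->
  A s -> stek d (dquot e f) i s t = e^-1 * (stek d f i s (t + e) - stek d f i s t).
Proof.
move=> cf As; have cfi := ct2_slice (cf i) As.
have c1 := continuous_affine (c := t + e) (k := d) cfi.
have c2 := continuous_affine (c := t) (k := d) cfi.
rewrite /stek /steklov -I01B// -I01Z; last exact: continuousB1.
by apply: I01_eq => x; rewrite /dquot [t + e + _]addrAC.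
Qed.

Lemma weakhol_dsub A f g : open A -> weakhol A f -> weakhol A g -> weakhol A (dsub f g).
Proof.
move=> oA [cf pf wf] [cg pg wg]; split.
- by move=> i; apply: ct2_sub; [exact: cf|exact: cg].
- by move=> i s t As; rewrite /dsub pf// pg.
- move=> d i s t d0 As.
  have e : \forall x \near s, stek d f i x t - stek d g i x t = stek d (dsub f g) i x t.
    by near=> x; rewrite (stek_dsub _ _ _ cf cg)//; near: x; exact: near_open.
  apply: is_derive1_eq (near_eq_is_derive e
    (is_deriveB1 (wf d i s t d0 As) (wg d i s t d0 As))) _.
  by rewrite /twist /dquot /dsub; ring.
Unshelve. all: by end_near. Qed.

Lemma weakhol_dquot A f e : open A -> weakhol A f -> weakhol A (dquot e f).
Proof.
move=> oA [cf pf wf]; split.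
- exact: ct2_dquot.
- exact: dquot_per.
- move=> d i s t d0 As.
  have h : \forall x \near s, e^-1 * (stek d f i x (t + e) - stek d f i x t) =
      stek d (dquot e f) i x t.
    by near=> x; rewrite (stek_dquot _ _ _ _ cf)//; near: x; exact: near_open.
  apply: is_derive1_eq (near_eq_is_derive h (is_deriveZ1 e^-1
    (is_deriveB1 (wf d i s (t + e) d0 As) (wf d i s t d0 As)))) _.
  by rewrite /twist /dquot [t + d + e]addrAC; ring.
Unshelve. all: by end_near. Qed.

(** Counts the available t-derivatives; those in s are expressed through them by [dhol]. *)
Fixpoint hol k A f := if k is k'.+1
  then weakhol A f /\ exists2 f1, dhol A f f1 & hol k' A f1 else weakhol A f.

Lemma hol_weak k A f : hol k A f -> weakhol A f.
Proof. by case: k => [|k] // []. Qed.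

Lemma hol_dquot k A f e : open A -> hol k A f -> hol k A (dquot e f).
Proof.
move=> oA; elim: k f => [|k IH] f /=; first exact: weakhol_dquot.
move=> [wf [f1 df hf1]]; split; first exact: weakhol_dquot.
exists (dquot e f1); last exact: IH.
move=> i s t As; split.
- have d1 : is_derive t 1 (fun t => f i s (t + e)) (f1 i s (t + e)).
    have := @is_derive_comp_affine _ (f i s) (f1 i s (t + e)) e 1 t.
    rewrite !mul1r addrC.
    have -> : (fun x => f i s (e + 1 * x)) = (fun y => f i s (y + e)).
      by apply/funext => y; rewrite mul1r addrC.
    by apply; exact: (df i s _ As).1.
  exact: is_deriveZ1 (is_deriveB1 d1 (df i s t As).1).
- apply: is_derive1_eq (is_deriveZ1 e^-1
    (is_deriveB1 (df i s (t + e) As).2 (df i s t As).2)) _.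
  by rewrite /twist /dquot; ring.
Qed.

Lemma dhol_dsub A f g f1 g1 : dhol A f f1 -> dhol A g g1 ->
  dhol A (dsub f g) (dsub f1 g1).
Proof.
move=> df dg i s t As; split.
  exact: is_deriveB1 (df i s t As).1 (dg i s t As).1.
apply: is_derive1_eq (is_deriveB1 (df i s t As).2 (dg i s t As).2) _.
by rewrite /twist /dsub; ring.
Qed.

Lemma hol_stek k A f d : open A -> 0 < d -> hol k A f -> hol k.+1 A (stek d f).
Proof.
move=> oA d0 hf /=; split; first exact: weakhol_stek (hol_weak hf).
exists (dquot d f); last exact: hol_dquot.
exact: dhol_stek (hol_weak hf).
Qed.

Lemma hol_cyl k A f f1 f2 : open A -> hol k A f2 -> weakhol A f -> weakhol A f1 ->
  dhol A f f1 -> dhol A f1 f2 ->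
  cyl tau sg A f f1 (twist f1) (twist f2) (fun _ _ _ => 0).
Proof.
move=> oA /hol_weak [c2 _ _] [c0 p0 _] [c1 _ _] d0 d1; split => //.
- by move=> i; apply: ct2_twist.
- by move=> i; apply: ct2_twist.
- by move=> i; exact: ct2_const.
- by move=> i s t As; exact: (d0 i s t As).1.
- by move=> i s t As; exact: (d0 i s t As).2.
- by move=> i s t As; exact: (d1 i s t As).2.
- by move=> i s t As; apply: is_deriveZ1; exact: (d1 _ s t As).1.
- by move=> i s t As; rewrite addr0.
Qed.

Lemma weakhol_subset A B f : B `<=` A -> weakhol A f -> weakhol B f.
Proof.
move=> BA [cf pf wf]; split.
- by move=> i; exact: ct2_subset BA (cf i).
- by move=> i s t /BA; exact: pf.
- by move=> d i s t d0 /BA; exact: wf.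
Qed.

(** A sup bound of [f] bounds its energy; [level_G_le] passes the bound to [f1] on a smaller window
    and then to [f2] at x. As [f1] has mean zero, the pointwise Poincare inequality bounds it by the
    energy of [f2]. The further derivatives provide the near-convexity of the energy of [f2]. *)
Lemma hol_deriv_bound A f f1 f2 f3 f4 x h M i t : open A -> 0 < h -> h <= 1 ->
  (forall s, x - 4 * h <= s <= x + 4 * h -> A s) ->
  weakhol A f -> weakhol A f1 -> weakhol A f2 -> weakhol A f3 -> weakhol A f4 ->
  dhol A f f1 -> dhol A f1 f2 -> dhol A f2 f3 -> dhol A f3 f4 ->
  (forall j s t, x - 4 * h <= s <= x + 4 * h -> f j s t ^+ 2 <= M) ->
  f1 i x t ^+ 2 <= (4 * (h^-1 + 1) * h^-1) ^+ 2 * (n%:R * M).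
Proof.
move=> oA h0 h1 sA w0 w1 w2 w3 w4 d0 d1 d2 d3 fM.
have C0 := @hol_cyl 0 A f f1 f2 oA w2 w0 w1 d0 d1.
have C1 := @hol_cyl 0 A f1 f2 f3 oA w3 w1 w2 d1 d2.
have C2 := @hol_cyl 0 A f2 f3 f4 oA w4 w2 w3 d2 d3.
have L0 := cyl_level0 tauK sg2 sgN oA C0 (fun _ _ _ _ => erefl).
have L1 := cyl_level0 tauK sg2 sgN oA C1 (fun _ _ _ _ => erefl).
have L2 := cyl_level0 tauK sg2 sgN oA C2 (fun _ _ _ _ => erefl).
have k0 : 0 <= (0 : R) <= 1 / 4 by lra.
have F0 s : x - 4 * h <= s <= x + 4 * h -> en f s <= n%:R * M.
  move=> sx; have As := sA s sx; rewrite /en.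
  have -> : n%:R * M = \sum_(i < n) M by rewrite sumr_const card_ord mulr_natl.
  apply: ler_sum => j _; rewrite -[leRHS](I01_cst M).
  apply: I01_le => [||t']; [|exact: continuous_cst1|exact: fM].
  have cj : ct2 A (f j) by case: w0 => cf _ _; exact: cf.
  exact: continuous_sqr1 (ct2_slice cj As).
have F1 s : x - 2 * h <= s <= x + 2 * h ->
    en f1 s <= 4 * (n%:R * M) * (h^-1 + 1) * h^-1.
  move=> sx; apply: (level_G_le k0 h0 h1 _ L0 L1) => y y1; first by apply: sA; lra.
  by apply: F0; lra.
have F2 : en f2 x <= 4 * (4 * (n%:R * M) * (h^-1 + 1) * h^-1) * (h^-1 + 1) * h^-1.
  by apply: (level_G_le k0 h0 h1 _ L1 L2) => y y1; [apply: sA; lra|exact: F1].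
have Ax : A x by apply: sA; lra.
have -> : f1 i x t = osc f1 i x t by rewrite /osc (mean_ft C0)// subr0.
apply: (@le_trans _ _ (en f2 x)).
  exact: osc_sqr_le Ax (cyl_ft C1) (cyl_dt C1) (cyl_per C1).
by apply: le_trans F2 _; rewrite le_eqVlt; apply/orP; left; apply/eqP; ring.
Qed.

End WeaklyHolomorphic.

(** * Locally uniform limits of approximate weak solutions *)

Section Regularity.
Context {R : realType} {n : nat}.
Variables (tau : 'I_n -> 'I_n) (sg : 'I_n -> R).
Hypothesis tauK : involutive tau.
Hypothesis sg2 : forall i, sg i ^+ 2 = 1.
Hypothesis sgN : forall i, sg (tau i) = - sg i.

Local Notation fam := ('I_n -> R -> R -> R).
Local Notation twist := (twist tau sg).
Local Notation weakhol := (weakhol tau sg).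
Local Notation dhol := (dhol tau sg).
Local Notation hol := (hol tau sg).
Implicit Types (f g : fam) (A : set R).

Lemma periodic_int (phi : R -> R) : (forall t, phi (t + 1) = phi t) ->
  forall (k : int) t, phi (t + k%:~R) = phi t.
Proof.
move=> pphi; have pn (j : nat) t : phi (t + j%:R) = phi t.
  elim: j => [|j IH]; first by rewrite addr0.
  by rewrite -natr1 addrA pphi.
case=> j t; first exact: pn.
by rewrite NegzE mulrNz -[in RHS](subrK j.+1%:R t) pn.
Qed.

Lemma periodic_frac (phi : R -> R) t : (forall t, phi (t + 1) = phi t) ->
  forall x, phi (t + x) = phi (t - (Num.floor t)%:~R + x).
Proof.
move=> pphi x; rewrite -[RHS](periodic_int pphi (Num.floor t)).
by congr phi; ring.
Qed.

Lemma frac_itv (t : R) : 0 <= t - (Num.floor t)%:~R <= 1.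
Proof.
have /andP[h1 h2] := floor_itv t; rewrite subr_ge0 h1/=.
by rewrite intrD in h2; lra.
Qed.

(** Compactness of [a, b] x [0, 1]; reducing t modulo 1 extends the modulus to all real t. *)
Lemma ct2_unif_t A (f : R -> R -> R) (a b e : R) : ct2 A f ->
  (forall s, A s -> forall t, f s (t + 1) = f s t) ->
  (forall s, a <= s <= b -> A s) -> 0 < e ->
  exists2 d, 0 < d & forall s t x, a <= s <= b -> `|x| <= d ->
    `|f s (t + x) - f s t| <= e.
Proof.
move=> cf pf abA e0.
have cpt : compact (`[a, b]%classic `*` `[(0 : R), 1]%classic).
  exact: compact_setX (@segment_compact _ _ _) (@segment_compact _ _ _).
have nc := (compact_near_coveringP _).1 cpt.
have : \forall x \near (0 : R), `[a, b]%classic `*` `[(0 : R), 1]%classic `<=`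
    (fun p : R * R => `|f p.1 (p.2 + x) - f p.1 p.2| <= e).
  refine (nc R (nbhs (0 : R)) (fun x p => `|f p.1 (p.2 + x) - f p.1 p.2| <= e) _ _).
  move=> -[s t] [/=]; rewrite !in_itv/= => sab t01.
  have As := abA s sab; have := cf s t As.
  move=> /cvgrPdist_le /(_ (e / 2)); rewrite divr_gt0// => /(_ isT)[[U W] /= [Us Wt] UW].
  have [r /= r0 rW] := (nbhs_ballP _ _).1 Wt.
  exists (U `*` ball t (r / 2), ball (0 : R) (r / 2)) => /=.
    split; last by apply: nbhsx_ballx; rewrite divr_gt0.
    exists (U, ball t (r / 2)) => //=; split => //.
    by apply: nbhsx_ballx; rewrite divr_gt0.
  move=> [[s' t'] x] /= [[Us' Bt'] Bx].
  have W1 : W t'.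
    apply: rW; rewrite /ball/=; apply: lt_le_trans Bt' _.
    by rewrite ler_pdivrMr// ler_peMr ?ltW//; lra.
  have W2 : W (t' + x).
    apply: rW; rewrite /ball/=.
    have -> : t - (t' + x) = (t - t') + (0 - x) by ring.
    by rewrite (splitr r) (le_lt_trans (ler_normD _ _))// ltrD.
  have h1 := UW (s', t') (conj Us' W1).
  have h2 := UW (s', t' + x) (conj Us' W2).
  rewrite /= in h1 h2.
  rewrite -(subrKA (f s t)) (splitr e) (le_trans (ler_normD _ _))// lerD//.
  by rewrite distrC.
move=> /nbhs_ballP[r /= r0 hr]; exists (r / 2); first by rewrite divr_gt0.
move=> s t x sab xr; have As := abA s sab.
rewrite (periodic_frac t (pf s As)) -[t in X in _ - X]addr0 (periodic_frac t (pf s As)) addr0.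
apply: (hr x _ (s, t - (Num.floor t)%:~R)); last first.
  by split; rewrite /= in_itv//=; exact: frac_itv.
by rewrite /ball/= sub0r normrN (le_lt_trans xr)// ltr_pdivrMr// ltr_pMr//; lra.
Qed.

(* Weak solutions up to an error e, such as the maps u_n with e = eps_n C. *)
Definition whe (e : R) A f := [/\ forall i, ct2 A (f i),
  forall i s t, A s -> f i s (t + 1) = f i s t &
  forall d i t, 0 < d -> exists D : R -> R, forall s : R, A s ->
    is_derive s 1 ((stek d f i)^~ t) (D s) /\
    `|D s - twist (dquot d f) i s t| <= e].

Lemma weakhol_whe e A f : 0 <= e -> weakhol A f -> whe e A f.
Proof.
move=> e0 [cf pf wf]; split => // d i t d0.
exists (fun s => twist (dquot d f) i s t) => s As; split; first exact: wf.
by rewrite subrr normr0.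
Qed.

Lemma stek_close A f g e d i s t : (forall i, ct2 A (f i)) -> (forall i, ct2 A (g i)) ->
  A s -> (forall i t, `|g i s t - f i s t| <= e) ->
  `|stek d g i s t - stek d f i s t| <= e.
Proof.
move=> cf cg As h; rewrite -(stek_dsub _ _ _ cg cf)//.
apply: I01_norm_le => [|x _]; last exact: h.
apply: (@continuous_affine _ (dsub g f i s)); apply: continuousB1.
  exact: ct2_slice (cg i) As.
exact: ct2_slice (cf i) As.
Qed.

Lemma sg_norm i : `|sg i| = 1.
Proof.
by apply/eqP; rewrite -sqrp_eq1// real_normK ?num_real// sg2.
Qed.

(** Both sides of the integrated equation involve values of [f] only, so they converge uniformly
    near each point and [is_derive_limit] applies. The approximants need only exist near the point
    and solve the equation up to a vanishing error. *)
Lemma weakhol_lim A f : open A ->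
  (forall s0, A s0 -> exists r, [/\ 0 < r, forall s, `|s - s0| < r -> A s &
    forall e, 0 < e -> exists g, whe e [set s | `|s - s0| < r] g /\
      forall i s t, `|s - s0| < r -> `|g i s t - f i s t| <= e]) ->
  weakhol A f.
Proof.
move=> oA H.
have cf i : ct2 A (f i).
  move=> s0 t0 As0; have [r [r0 rA Hr]] := H s0 As0.
  apply/cvgrPdist_le => e e0; have e3 : 0 < e / 3 by rewrite divr_gt0.
  have [g [[cg _ _] gf]] := Hr _ e3.
  have B0 : [set s | `|s - s0| < r] s0 by rewrite /= subrr normr0.
  have := cg i s0 t0 B0; move=> /cvgrPdist_le/(_ _ e3) hg.
  have hb : \forall p \near (s0, t0), `|p.1 - s0| < r.
    have c : (fun q : R * R => q.1) @ (s0, t0) --> s0 by exact: cvg_fst.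
    by move/cvgrPdist_lt : c => /(_ r r0); apply: filterS => p; rewrite distrC.
  near=> p.
  have pr : `|p.1 - s0| < r by near: p.
  have h1 := gf i p.1 p.2 pr; have h2 := gf i s0 t0 B0.
  have h3 : `|g i s0 t0 - g i p.1 p.2| <= e / 3 by near: p.
  move: h1 h2 h3; rewrite !ler_norml => /andP[? ?] /andP[? ?] /andP[? ?].
  by apply/andP; split; lra.
split => //.
- move=> i s t As; have [r [r0 rA Hr]] := H s As.
  have B0 : [set x | `|x - s| < r] s by rewrite /= subrr normr0.
  apply/eqP; rewrite -subr_eq0 -normr_le0; apply/ler_addgt0Pr => e e0; rewrite add0r.
  have e2 : 0 < e / 2 by rewrite divr_gt0.
  have [g [[_ pg _] gf]] := Hr _ e2.
  have := gf i s (t + 1) B0; have := gf i s t B0; rewrite pg//.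
  rewrite !ler_norml => /andP[? ?] /andP[? ?]; apply/andP; split; lra.
- move=> d i s0 t d0 As0; have [r [r0 rA Hr]] := H s0 As0.
  have rA' : [set s | `|s - s0| < r] `<=` A by [].
  apply: (@is_derive_limit _ ((stek d f i)^~ t) (fun s => twist (dquot d f) i s t) s0 r) => //.
    have c : ct2 A (twist (dquot d f) i) by apply: ct2_twist; exact: ct2_dquot.
    exact: ct2_slice1 c As0.
  (* [dquot d] amplifies a uniform error [e'] to at most [2 e' / d]; one more [e'] is the defect
     allowed by [whe]. *)
  move=> e e0; pose e' := e / (2 + 2 * d^-1).
  have di : 0 < d^-1 by rewrite invr_gt0.
  have k0 : 0 < 2 + 2 * d^-1 by lra.
  have e'0 : 0 < e' by rewrite divr_gt0.
  have ee : e = (2 + 2 * d^-1) * e' by rewrite mulrC divfK// gt_eqF.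
  have de : 0 <= d^-1 * e' by rewrite mulr_ge0// ltW.
  have [g [[cg pg dg] gf]] := Hr _ e'0.
  have [D HD] := dg d i t d0.
  exists ((stek d g i)^~ t), D => s sr; have [h1 h2] := HD s sr; split => //.
    apply: (@le_trans _ _ e'); last by rewrite ee; lra.
    have cfr j : ct2 [set s | `|s - s0| < r] (f j) by exact: ct2_subset rA' (cf j).
    exact: (@stek_close [set s | `|s - s0| < r] f g e' d i s t cfr cg sr (fun j t' => gf j s t' sr)).
  rewrite -(subrKA (twist (dquot d g) i s t)) (le_trans (ler_normD _ _))//.
  have -> : e = e' + d^-1 * (e' + e') + (e - e' - 2 * (d^-1 * e')) by ring.
  rewrite ler_wpDr//; first by rewrite ee; lra.
  rewrite lerD// /twist /dquot -mulrBr normrM normrN sg_norm mul1r -mulrBr normrM.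
  rewrite (gtr0_norm di) ler_wpM2l ?(ltW di)//.
  have := gf (tau i) s (t + d) sr; have := gf (tau i) s t sr.
  rewrite !ler_norml => /andP[? ?] /andP[? ?]; apply/andP; split; lra.
Unshelve. all: by end_near. Qed.

Lemma real_cauchy (a : nat -> R) :
  (forall e, 0 < e -> exists N, forall j, (N <= j)%N -> `|a j - a N| <= e) ->
  cvg (a @ \oo).
Proof.
move=> H; apply/cauchy_cvgP; apply: cauchy_exP => e e0.
have e2 : 0 < e / 2 by rewrite divr_gt0.
have [N HN] := H (e / 2) e2; exists (a N).
exists N => // j /= /HN h; rewrite /ball/= distrC (le_lt_trans h)//.
by rewrite ltr_pdivrMr// ltr_pMr//; lra.
Qed.

Lemma lim_close (a : nat -> R) (c e : R) N : cvg (a @ \oo) ->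
  (forall j, (N <= j)%N -> `|c - a j| <= e) -> `|c - lim (a @ \oo)| <= e.
Proof.
move=> ca H.
have C : `|c - a j| @[j --> \oo] --> `|c - lim (a @ \oo)|.
  by apply: cvg_norm; apply: cvgB; [exact: cvg_cst|exact: ca].
apply: (cvgr_to_le C); exists N => // j /=; exact: H.
Qed.

End Regularity.

(** * Differentiability of weakly holomorphic cylinders *)

Section RegularityTheorem.
Context {R : realType} {n : nat}.
Variables (tau : 'I_n -> 'I_n) (sg : 'I_n -> R).
Hypothesis tauK : involutive tau.
Hypothesis sg2 : forall i, sg i ^+ 2 = 1.
Hypothesis sgN : forall i, sg (tau i) = - sg i.

Local Notation fam := ('I_n -> R -> R -> R).
Local Notation twist := (twist tau sg).
Local Notation weakhol := (weakhol tau sg).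
Local Notation dhol := (dhol tau sg).
Local Notation hol := (hol tau sg).
Implicit Types (f g : fam) (A : set R).

Definition umod (d0 e : R) (f : fam) (s : R) := forall i t x, 0 <= x <= d0 ->
  `|f i s (t + x) - f i s t| <= e.

(** An average of translates keeps the modulus [umod] of [f], so the estimate can be iterated. *)
Lemma stek_small A f d d0 e s : open A -> A s -> (forall i, ct2 A (f i)) -> 0 < d <= d0 ->
  umod d0 e f s ->
  (forall i t, `|stek d f i s t - f i s t| <= e) /\ umod d0 e (stek d f) s.
Proof.
move=> oA As cf /andP[d1 d2] um; have cfi i := ct2_slice (cf i) As; split.
- move=> i t; have -> : f i s t = I01 (fun=> f i s t) by rewrite I01_cst.
  rewrite /stek /steklov -I01B; [|exact: continuous_affine|exact: continuous_cst1].
  apply: I01_norm_le => [|x /andP[x0 x1]].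
    by apply: continuousB1; [exact: continuous_affine|exact: continuous_cst1].
  apply: um; rewrite mulr_ge0//= ?(ltW d1)//; last by apply: le_trans d2; rewrite ger_pMr.
- move=> i t x xd; rewrite /stek /steklov -I01B; [|exact: continuous_affine..].
  apply: I01_norm_le => [|y y01].
    by apply: continuousB1; exact: continuous_affine.
  by rewrite addrAC; exact: um.
Qed.

(* Four Steklov averages provide the four t-derivatives which the interior
   estimate hol_deriv_bound requires of an approximation. *)
Definition stek4 d f := stek d (stek d (stek d (stek d f))).

Lemma hol_stek4 A f d : open A -> 0 < d -> weakhol A f -> hol 4 A (stek4 d f).
Proof.
move=> oA d0 wf; have h1 := @hol_stek _ _ tau sg 0 A f d oA d0 wf.
have h2 := hol_stek oA d0 h1; have h3 := hol_stek oA d0 h2.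
exact: hol_stek oA d0 h3.
Qed.

Lemma stek4_small A f d d0 e s : open A -> A s -> (forall i, ct2 A (f i)) -> 0 < d <= d0 ->
  umod d0 e f s -> forall i t, `|stek4 d f i s t - f i s t| <= 4 * e.
Proof.
move=> oA As cf dd u0 i t.
have c1 j : ct2 A (stek d f j) by exact: ct2_steklov.
have c2 j : ct2 A (stek d (stek d f) j) by exact: ct2_steklov.
have c3 j : ct2 A (stek d (stek d (stek d f)) j) by exact: ct2_steklov.
have [h1 u1] := stek_small oA As cf dd u0.
have [h2 u2] := stek_small oA As c1 dd u1.
have [h3 u3] := stek_small oA As c2 dd u2.
have [h4 _] := stek_small oA As c3 dd u3.
move: (h1 i t) (h2 i t) (h3 i t) (h4 i t); rewrite /stek4.
move: (stek d (stek d (stek d (stek d f))) i s t) (stek d (stek d (stek d f)) i s t)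
  (stek d (stek d f) i s t) (stek d f i s t) (f i s t) => x4 x3 x2 x1 x0.
clear; rewrite !ler_norml => /andP[? ?] /andP[? ?] /andP[? ?] /andP[? ?].
by apply/andP; split; lra.
Qed.

Lemma umod_ex A f a b e : (forall i, ct2 A (f i)) ->
  (forall i s t, A s -> f i s (t + 1) = f i s t) ->
  (forall s, a <= s <= b -> A s) -> 0 < e ->
  exists2 d, 0 < d & forall s, a <= s <= b -> umod d e f s.
Proof.
move=> cf pf abA e0.
have /choice[d dP] i : exists d, 0 < d /\ forall s t x, a <= s <= b -> `|x| <= d ->
    `|f i s (t + x) - f i s t| <= e.
  by have [d d0 H] := ct2_unif_t (cf i) (fun s As t => pf i s t As) abA e0; exists d.
exists (\big[Num.min/1]_i d i).
  by elim/big_ind: _ => // [x y x0 y0|i _]; [rewrite lt_min x0|have [] := dP i].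
move=> s sab i t x /andP[x0 x1]; have [_ ->] // := dP i.
by rewrite ger0_norm// (le_trans x1)//; apply: bigmin_le_cond.
Qed.

(** The derivative is again weakly holomorphic, being a locally uniform limit of the exact solutions
    [H j]; hence the statement can be iterated. *)
Lemma weakhol_regular A f : open A -> weakhol A f ->
  exists2 h, weakhol A h & dhol A f h.
Proof.
move=> oA wf; have [cf pf _] := wf.
pose dl (j : nat) : R := j.+1%:R^-1.
have dl0 j : 0 < dl j by rewrite invr_gt0.
pose F j := stek4 (dl j) f.
have /choice[H HH] j : exists h, [/\ weakhol A (F j), dhol A (F j) h & hol 3 A h].
  by have [w [h dh hh]] := hol_stek4 oA (dl0 j) wf; exists h.
have key s0 : A s0 -> exists r, [/\ 0 < r, forall s, `|s - s0| < r -> A s &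
    forall e, 0 < e -> exists N, forall j, (N <= j)%N -> forall i s t, `|s - s0| < r ->
     `|F j i s t - f i s t| <= e /\
     forall k, (N <= k)%N -> `|H j i s t - H k i s t| <= e].
  move=> As0; have [r /= r0 rA] := (nbhs_ballP _ _).1 (near_open oA As0).
  pose rho := Num.min (r / 2) 1.
  have rho0 : 0 < rho by rewrite lt_min ltr01 divr_gt0.
  have rho1 : rho <= 1 by rewrite ge_min lexx orbT.
  have rhor : rho < r.
    by rewrite gt_min ltr_pdivrMr// ltr_pMr// ltr1n.
  have IA s : s0 - rho <= s <= s0 + rho -> A s.
    move=> /andP[s1 s2]; apply: rA; rewrite /ball/= distrC ltr_norml.
    by apply/andP; split; lra.
  exists (rho / 2); split; first by rewrite divr_gt0.
    by move=> s; rewrite ltr_norml => /andP[s1 s2]; apply: IA; lra.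
  (* [4 * hh = rho / 4] keeps the windows about points within [rho / 2] of [s0] inside the
     controlled interval. The modulus [q / 8] becomes [q / 2] after four averages, hence [q] for a
     difference; the interior estimate then gives a square at most [K q^2 <= e^2]. *)
  move=> e e0; pose hh := rho / 16.
  pose K := (4 * (hh^-1 + 1) * hh^-1) ^+ 2 * n%:R.
  have K0 : 0 <= K by rewrite mulr_ge0// sqr_ge0.
  pose q := e / (K + 1).
  have K1 : 0 < K + 1 by lra.
  have q0 : 0 < q by rewrite divr_gt0.
  have qe : q <= e by rewrite /q ler_pdivrMr// mulrDr mulr1 lerDr mulr_ge0// ltW.
  have q8 : 0 < q / 8 by rewrite divr_gt0.
  have [d d0 um] := umod_ex cf pf IA q8.
  have [N _ HN] := near_infty_natSinv_lt (PosNum d0).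
  exists N => j Nj.
  have FfN k i s t : (N <= k)%N -> s0 - rho <= s <= s0 + rho ->
      `|F k i s t - f i s t| <= q / 2.
    move=> Nk sr; have -> : q / 2 = 4 * (q / 8) by field.
    apply: (stek4_small oA (IA s sr) cf _ (um s sr)).
    by rewrite dl0/= ltW//; exact: HN.
  move=> i s t; rewrite ltr_norml => /andP[s1 s2]; split.
    by apply: le_trans (FfN _ _ _ _ Nj _) _; lra.
  move=> k Nk.
  have [wj dj [wj1 [g2 dg2 [wg2 [g3 dg3 [wg3 [g4 dg4 wg4]]]]]]] := HH j.
  have [wk dk [wk1 [k2 dk2 [wk2 [k3 dk3 [wk3 [k4 dk4 wk4]]]]]]] := HH k.
  have hh0 : 0 < hh by rewrite divr_gt0.
  have : dsub (H j) (H k) i s t ^+ 2 <= (4 * (hh^-1 + 1) * hh^-1) ^+ 2 * (n%:R * q ^+ 2).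
    apply: (hol_deriv_bound tauK sg2 sgN i t oA hh0 _ _
      (weakhol_dsub oA wj wk) (weakhol_dsub oA wj1 wk1) (weakhol_dsub oA wg2 wk2)
      (weakhol_dsub oA wg3 wk3) (weakhol_dsub oA wg4 wk4)
      (dhol_dsub dj dk) (dhol_dsub dg2 dk2) (dhol_dsub dg3 dk3) (dhol_dsub dg4 dk4)).
    - by rewrite /hh; lra.
    - by move=> y; rewrite /hh => y1; apply: IA; lra.
    - move=> i' y t'; rewrite /hh => y1.
      have yy : s0 - rho <= y <= s0 + rho by lra.
      move: (FfN j i' y t' Nj yy) (FfN k i' y t' Nk yy); rewrite /dsub.
      move: (F j i' y t') (F k i' y t') (f i' y t') => x1 x2 x0.
      rewrite !ler_norml => /andP[a1 a2] /andP[b1 b2].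
      rewrite -real_normK ?num_real// ler_sqr ?nnegrE ?(ltW q0)//.
      rewrite ler_norml; move: a1 a2 b1 b2; clear => *; apply/andP; split; lra.
  rewrite mulrA -/K => Kq.
  rewrite -(@ler_sqr _ _ e) ?nnegrE ?(ltW e0)// real_normK ?num_real//.
  apply: le_trans Kq _; have -> : e = q * (K + 1) by rewrite divfK// gt_eqF.
  have := sqr_ge0 q; have := sqr_ge0 (q * K); nra.
pose h : fam := fun i s t => lim (H j i s t @[j --> \oo]).
have hcv i s t : A s -> cvg (H j i s t @[j --> \oo]).
  move=> As; have [r [r0 _ Hr]] := key s As; apply: real_cauchy => e e0.
  have [N HN] := Hr e e0; exists N => j Nj.
  have ss : `|s - s| < r by rewrite subrr normr0.
  exact: (HN j Nj i s t ss).2 N (leqnn N).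
have lims s0 : A s0 -> exists r, [/\ 0 < r, forall s, `|s - s0| < r -> A s &
    forall e, 0 < e -> exists j, forall i s t, `|s - s0| < r ->
     `|F j i s t - f i s t| <= e /\ `|H j i s t - h i s t| <= e].
  move=> /key [r [r0 rA Hr]]; exists r; split => // e /Hr[N HN].
  exists N => i s t sr; have [h1 h2] := HN N (leqnn N) i s t sr; split => //.
  by apply: (@lim_close _ _ _ _ N); [exact: hcv (rA s sr)|exact: h2].
have wh : weakhol A h.
  apply: (weakhol_lim sg2 oA) => s0 /lims[r [r0 rA Hr]]; exists r; split => // e e0.
  have [j Hj] := Hr e e0; have [_ _ hh] := HH j; exists (H j); split; last first.
    by move=> i s t sr; exact: (Hj i s t sr).2.
  apply: weakhol_whe (ltW e0) _; apply: weakhol_subset (hol_weak hh).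
  by move=> s; exact: rA.
exists h => // i s0 t0 As0; have [r [r0 rA Hr]] := lims s0 As0.
have [ch _ _] := wh; split.
- apply: (@is_derive_limit _ (f i s0) (h i s0) t0 1 ltr01).
    exact: ct2_slice (ch i) As0 t0.
  move=> e e0; have [j Hj] := Hr e e0; exists (F j i s0), (H j i s0) => y _.
  have ss : `|s0 - s0| < r by rewrite subrr normr0.
  have [h1 h2] := Hj i s0 y ss; split => //.
  by have [_ dj _] := HH j; exact: (dj i s0 y As0).1.
- apply: (@is_derive_limit _ ((f i)^~ t0) (fun s => twist h i s t0) s0 r r0).
    have ct : ct2 A (twist h i) by apply: ct2_twist.
    exact: ct2_slice1 ct As0.
  move=> e e0; have [j Hj] := Hr e e0.
  exists ((F j i)^~ t0), (fun s => twist (H j) i s t0) => s sr.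
  have [h1 _] := Hj i s t0 sr; split => //.
    by have [_ dj _] := HH j; exact: (dj i s t0 (rA s sr)).2.
  rewrite /twist -mulrBr normrM normrN (sg_norm sg2) mul1r.
  exact: (Hj _ s t0 sr).2.
Qed.

End RegularityTheorem.

(** * Holomorphic and perturbed holomorphic cylinders *)

Section ComplexStructure.
Context {R : realType} {m : nat}.

(** J0 is a signed permutation of the coordinates, the form in which the energy identities take
    it. *)
Definition conj_idx (i : 'I_(m + m)) : 'I_(m + m) :=
  match fintype.split i with inl j => rshift m j | inr j => lshift m j end.

Definition conj_sg (i : 'I_(m + m)) : R :=
  match fintype.split i with inl _ => -1 | inr _ => 1 end.

Lemma conj_idx_l (j : 'I_m) : conj_idx (lshift m j) = rshift m j.
Proof. by rewrite /conj_idx (unsplitK (inl j)). Qed.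

Lemma conj_idx_r (j : 'I_m) : conj_idx (rshift m j) = lshift m j.
Proof. by rewrite /conj_idx (unsplitK (inr j)). Qed.

Lemma conj_sg_l (j : 'I_m) : conj_sg (lshift m j) = -1.
Proof. by rewrite /conj_sg (unsplitK (inl j)). Qed.

Lemma conj_sg_r (j : 'I_m) : conj_sg (rshift m j) = 1.
Proof. by rewrite /conj_sg (unsplitK (inr j)). Qed.

Lemma conj_idxK : involutive conj_idx.
Proof.
by move=> i; case: (split_ordP i) => j ->; rewrite ?conj_idx_l ?conj_idx_r ?conj_idx_l.
Qed.

Lemma conj_sg2 i : conj_sg i ^+ 2 = 1.
Proof. by rewrite /conj_sg; case: fintype.split => _; rewrite ?sqrrN expr1n. Qed.

Lemma conj_sgN i : conj_sg (conj_idx i) = - conj_sg i.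
Proof.
case: (split_ordP i) => j ->.
  by rewrite conj_idx_l conj_sg_l conj_sg_r opprK.
by rewrite conj_idx_r conj_sg_l conj_sg_r.
Qed.

Lemma J0E (z : 'rV[R]_(m + m)) i : J0 z ord0 i = conj_sg i * z ord0 (conj_idx i).
Proof.
rewrite /J0; case: (split_ordP i) => j ->.
  by rewrite row_mxEl conj_idx_l conj_sg_l !mxE mulN1r.
by rewrite row_mxEr conj_idx_r conj_sg_r !mxE mul1r.
Qed.

End ComplexStructure.

Section RowVectors.
Context {R : realType}.

Lemma cvg_row (T : Type) (F : set_system T) (FF : Filter F) k
  (f : T -> 'rV[R]_k) (l : 'rV[R]_k) :
  (forall i, f x ord0 i @[x --> F] --> l ord0 i) -> f x @[x --> F] --> l.
Proof.
move=> H; apply/cvgrPdist_le => e e0.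
near=> x; rewrite /Num.Def.normr/= mx_normrE (bigmax_le _ (ltW e0))//= => -[a i] _.
rewrite !mxE/= (ord1 a).
move: i; near: x; apply: filter_forall => i.
by have /cvgrPdist_le := H i; apply.
Unshelve. all: by end_near. Qed.

Lemma cvg_row_coord (T : Type) (F : set_system T) (FF : Filter F) k
  (f : T -> 'rV[R]_k) (l : 'rV[R]_k) i :
  f x @[x --> F] --> l -> f x ord0 i @[x --> F] --> l ord0 i.
Proof.
move=> H; have c : {for l, continuous (fun M : 'rV[R]_k => M ord0 i)}.
  exact: coord_continuous.
exact: (cvg_comp _ _ H c).
Qed.

Lemma is_derive_row (V : normedModType R) k (f : V -> 'rV[R]_k) (x v : V)
  (d : 'rV[R]_k) :
  (forall i, is_derive x v (fun y => f y ord0 i) (d ord0 i)) -> is_derive x v f d.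
Proof.
move=> H; have D : derivable f x v.
  by apply/derivable_mxP => a i; rewrite (ord1 a); case: (H i).
split => //; rewrite derive_mx//; apply/rowP => i; rewrite mxE.
by case: (H i).
Qed.

Lemma is_derive_coord (V : normedModType R) k (f : V -> 'rV[R]_k) (x v : V)
  (i : 'I_k) : derivable f x v ->
  is_derive x v (fun y => f y ord0 i) ('D_v f x ord0 i).
Proof.
move=> D; split; first by have /derivable_mxP := D; apply.
by rewrite derive_mx// mxE.
Qed.

Lemma is_derive_slice_s (F : R * R -> R) (s t d : R) :
  is_derive (s, t) ((1, 0) : R * R) F d -> is_derive s 1 (fun s => F (s, t)) d.
Proof.
move=> [D E]; have eq : (fun h : R => h^-1 *: ((F \o shift (s, t)) (h *: ((1, 0) : R * R)) - F (s, t))) =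
    (fun h : R => h^-1 *: (((fun s => F (s, t)) \o shift s) (h *: (1 : R)) - F (s, t))).
  apply/funext => h; rewrite /shift/=; congr (_ *: (F _ - _)).
  by congr (_, _); rewrite /= ?scaler0 add0r.
by split; [move: D; rewrite /derivable eq|rewrite -E /derive eq].
Qed.

Lemma is_derive_slice_t (F : R * R -> R) (s t d : R) :
  is_derive (s, t) ((0, 1) : R * R) F d -> is_derive t 1 (fun t => F (s, t)) d.
Proof.
move=> [D E]; have eq : (fun h : R => h^-1 *: ((F \o shift (s, t)) (h *: ((0, 1) : R * R)) - F (s, t))) =
    (fun h : R => h^-1 *: (((fun t => F (s, t)) \o shift t) (h *: (1 : R)) - F (s, t))).
  apply/funext => h; rewrite /shift/=; congr (_ *: (F _ - _)).
  by congr (_, _); rewrite /= ?scaler0 add0r.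
by split; [move: D; rewrite /derivable eq|rewrite -E /derive eq].
Qed.

End RowVectors.

(** * Smoothness of weakly holomorphic cylinders *)

Section WeakholSmooth.
Context {R : realType} {m : nat}.
Local Notation tau := (@conj_idx m).
Local Notation sg := (@conj_sg R m).
Local Notation fam := ('I_(m + m) -> R -> R -> R).
Local Notation weakhol := (weakhol tau sg).
Local Notation dhol := (dhol tau sg).
Local Notation twist := (twist tau sg).
Implicit Types (f g : fam) (A : set R).

Definition row_of f (p : R * R) : 'rV[R]_(m + m) := \row_i f i p.1 p.2.

Lemma open_strip A : open A -> open (strip A).
Proof.
move=> oA; have -> : strip A = (fun p : R * R => p.1) @^-1` A.
  by apply/seteqP; split => [p []|p Ap].
apply: open_comp => // p _; exact: cvg_fst.
Qed.

Lemma weakhol_comb A f g (a b : R) : open A -> weakhol A f -> weakhol A g ->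
  weakhol A (fun i s t => a * f i s t + b * g i s t).
Proof.
move=> oA [cf pf wf] [cg pg wg]; split.
- by move=> i; apply: ct2_add; apply: ct2_scale; [exact: cf|exact: cg].
- by move=> i s t As; rewrite pf// pg.
- move=> d i s t d0 As.
  have e : \forall x \near s, a * stek d f i x t + b * stek d g i x t =
      stek d (fun i s t => a * f i s t + b * g i s t) i x t.
    near=> x; have Ax : A x by near: x; exact: near_open.
    have c1 := continuous_affine (c := t) (k := d) (ct2_slice (cf i) Ax).
    have c2 := continuous_affine (c := t) (k := d) (ct2_slice (cg i) Ax).
    rewrite /stek /steklov I01D; last 2 first.
    - by apply: continuousM1; [exact: continuous_cst1|].
    - by apply: continuousM1; [exact: continuous_cst1|].
    by rewrite !I01Z.
  apply: is_derive1_eq (near_eq_is_derive e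
    (is_deriveD1 (is_deriveZ1 a (wf d i s t d0 As)) (is_deriveZ1 b (wg d i s t d0 As)))) _.
  by rewrite /twist /dquot; ring.
Unshelve. all: by end_near. Qed.

Lemma weakhol_twist A f : open A -> weakhol A f -> weakhol A (twist f).
Proof.
move=> oA [cf pf wf]; split.
- by move=> i; apply: ct2_twist.
- by move=> i s t As; rewrite /twist pf.
- move=> d i s t d0 As.
  have e : \forall x \near s, - sg i * stek d f (tau i) x t = stek d (twist f) i x t.
    near=> x; have Ax : A x by near: x; exact: near_open.
    have c1 := continuous_affine (c := t) (k := d) (ct2_slice (cf (tau i)) Ax).
    by rewrite /stek /steklov -I01Z.
  apply: is_derive1_eq (near_eq_is_derive e
    (is_deriveZ1 (- sg i) (wf d (tau i) s t d0 As))) _.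
  by rewrite /twist /dquot; ring.
Unshelve. all: by end_near. Qed.

Lemma dhol_is_derive A f h s t v : open A -> A s -> weakhol A h -> dhol A f h ->
  is_derive (s, t) v (row_of f) (row_of (fun i s t => v.1 * twist h i s t + v.2 * h i s t) (s, t)).
Proof.
move=> oA As [ch ph wh] df; apply: is_derive_row => i; rewrite [X in is_derive _ _ _ X]mxE.
have -> : (fun y => row_of f y ord0 i) = (fun p => f i p.1 p.2).
  by apply/funext => p; rewrite mxE.
apply: (is_derive_C1 (A := A) _ v oA As).
- by apply: ct2_twist.
- exact: ch.
- by move=> x y Ax; exact: (df i x y Ax).2.
- by move=> x y Ax; exact: (df i x y Ax).1.
Qed.

(** A directional derivative is a combination of [h] and -J0 [h], with [h] the t-derivative, and
    such combinations are weakly holomorphic: the induction stays in one class. *)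
Lemma weakhol_iter_derive A f vs : open A -> weakhol A f ->
  exists2 g, weakhol A g & forall p, strip A p -> iter_derive vs (row_of f) p = row_of g p.
Proof.
move=> oA wf; elim: vs => [|v vs [g wg Hg]]; first by exists f.
have [h wh dh] := weakhol_regular conj_idxK conj_sg2 conj_sgN oA wg.
exists (fun i s t => v.1 * twist h i s t + v.2 * h i s t).
  by apply: weakhol_comb => //; exact: weakhol_twist.
move=> [s t] [/= As _]; rewrite (@near_eq_derive _ _ _ _ (row_of g)).
  by case: (dhol_is_derive t v oA As wh dh).
near=> p; apply: Hg; near: p; apply: open_nbhs_nbhs; split => //; exact: open_strip.
Unshelve. all: by end_near. Qed.

Lemma weakhol_smooth A f : open A -> weakhol A f -> smooth (strip A) (row_of f).
Proof.
move=> oA wf vs [s t] [/= As _].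
have [g wg Hg] := weakhol_iter_derive vs oA wf.
have [h wh dh] := weakhol_regular conj_idxK conj_sg2 conj_sgN oA wg.
have ne : \forall p \near (s, t), row_of g p = iter_derive vs (row_of f) p.
  near=> p; apply/esym/Hg; near: p; apply: open_nbhs_nbhs; split => //; exact: open_strip.
split; last first.
  move=> v; apply: (near_eq_derivable ne).
  by have [] := dhol_is_derive t v oA As wh dh.
suff : iter_derive vs (row_of f) p @[p --> (s, t)] --> iter_derive vs (row_of f) (s, t) by [].
have sA : strip A (s, t) by [].
rewrite (Hg _ sA); apply: cvg_trans (near_eq_cvg ne) _.
apply: cvg_row => i; rewrite mxE; case: wg => cg _ _.
under eq_cvg do rewrite mxE; exact: cg.
Unshelve. all: by end_near. Qed.

(** [partial_s] and [partial_t] refer to an unspecified extension. [row_of f] is itself one, over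
    the open set [A], and the derivatives of any two agree up to the boundary by
    [iter_derive_extension_unique]. *)
Lemma weakhol_holomorphic A (I : set R) f : open A -> I `<=` A ->
  strip I `<=` closure (strip I)° -> weakhol A f ->
  (forall s t, I s -> unit_cball (row_of f (s, t))) ->
  holomorphic_cylinder I (row_of f).
Proof.
move=> oA IA Icl wf fb.
have ext : smooth_extension (strip I) (row_of f) (row_of f).
  exists (strip A); split => //; first exact: open_strip.
    by move=> [s t] [/= Is _]; split => //; exact: IA.
  exact: weakhol_smooth.
have [h wh dh] := weakhol_regular conj_idxK conj_sg2 conj_sgN oA wf.
split; first split => //.
- by exists (row_of f).
- move=> s t Is; apply/rowP => i; rewrite !mxE; case: wf => _ pf _; rewrite pf//.
  exact: IA.
move=> [s t] sI; have As : A s by apply: IA; case: sI.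
have ext' : smooth_extension (strip I) (row_of f) (get [set g | smooth_extension (strip I) (row_of f) g]).
  by apply: (@getPex _ [set g | smooth_extension (strip I) (row_of f) g]); exists (row_of f).
rewrite /partial_s /partial_t /iter_derive_on.
rewrite (iter_derive_extension_unique [:: (1 : R, 0 : R)] Icl ext' ext sI).
rewrite (iter_derive_extension_unique [:: (0 : R, 1 : R)] Icl ext' ext sI) /=.
have [_ ->] := dhol_is_derive t (1 : R, 0 : R) oA As wh dh.
have [_ ->] := dhol_is_derive t (0 : R, 1 : R) oA As wh dh.
apply/rowP => i; rewrite mxE J0E !mxE /=.
by rewrite mul1r mul0r addr0 mul1r mul0r add0r /twist; ring.
Qed.

End WeakholSmooth.

(** * Coordinates of a perturbed holomorphic cylinder *)

Section PerturbedData.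
Context {R : realType} {m : nat}.
Local Notation tau := (@conj_idx m).
Local Notation sg := (@conj_sg R m).
Local Notation fam := ('I_(m + m) -> R -> R -> R).
Local Notation E := 'rV[R]_(m + m).
Implicit Types (A : set R) (G : R * R -> E).

Definition comp_derive vs G : fam := fun i s t => iter_derive vs G (s, t) ord0 i.

Let es : R * R := (1, 0).
Let et : R * R := (0, 1).

Lemma ct2_comp_derive A U vs G i : strip A `<=` U -> smooth U G ->
  ct2 A (comp_derive vs G i).
Proof.
move=> AU sG s t As; have [c _] := sG vs (s, t) (AU (s, t) (conj As I)).
have H : (fun p => iter_derive vs G p ord0 i) @ (s, t) --> iter_derive vs G (s, t) ord0 i.
  exact: cvg_row_coord c.
apply: cvg_trans H; apply: near_eq_cvg; near=> p.
by rewrite /comp_derive -surjective_pairing.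
Unshelve. all: by end_near. Qed.

Lemma comp_derive_s A U vs G i (s t : R) : strip A `<=` U -> smooth U G -> A s ->
  is_derive s 1 ((comp_derive vs G i)^~ t) (comp_derive (es :: vs) G i s t).
Proof.
move=> AU sG As; have [_ d] := sG vs (s, t) (AU (s, t) (conj As I)).
apply: (is_derive_slice_s (F := fun p => iter_derive vs G p ord0 i)).
exact: is_derive_coord.
Qed.

Lemma comp_derive_t A U vs G i (s t : R) : strip A `<=` U -> smooth U G -> A s ->
  is_derive t 1 (comp_derive vs G i s) (comp_derive (et :: vs) G i s t).
Proof.
move=> AU sG As; have [_ d] := sG vs (s, t) (AU (s, t) (conj As I)).
apply: (is_derive_slice_t (F := fun p => iter_derive vs G p ord0 i)).
exact: is_derive_coord.
Qed.

Lemma comp_derive_sym A U vs G i (s t : R) : open A -> strip A `<=` U -> smooth U G ->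
  A s -> comp_derive (et :: es :: vs) G i s t = comp_derive (es :: et :: vs) G i s t.
Proof.
move=> oA AU sG As.
apply: (@schwarz _ A (comp_derive vs G i) (comp_derive (es :: vs) G i)
  (comp_derive (et :: vs) G i) (comp_derive (et :: es :: vs) G i)
  (comp_derive (es :: et :: vs) G i)) => //.
- exact: ct2_comp_derive AU sG.
- exact: ct2_comp_derive AU sG.
- by move=> s' t' As'; exact: comp_derive_s AU sG As'.
- by move=> s' t' As'; exact: comp_derive_t AU sG As'.
- by move=> s' t' As'; exact: comp_derive_t AU sG As'.
- by move=> s' t' As'; exact: comp_derive_s AU sG As'.
Qed.

(** The perturbation is taken to be G_s + J0 G_t, so that [cyl_eq] holds by construction; it is
    identified with eps V(u) afterwards. *)
Lemma smooth_cyl_of_smooth A U G : open A -> strip A `<=` U -> smooth U G ->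
  (forall s t, A s -> G (s, t + 1) = G (s, t)) ->
  let g : fam := fun i s t => comp_derive [:: es] G i s t + sg i * comp_derive [:: et] G (tau i) s t in
  let gt : fam := fun i s t => comp_derive [:: et; es] G i s t + sg i * comp_derive [:: et; et] G (tau i) s t in
  smooth_cyl tau sg A (comp_derive [::] G) (comp_derive [:: et] G) (comp_derive [:: es] G)
    (comp_derive [:: et; et] G) (comp_derive [:: es; et] G) (comp_derive [:: es; et; et] G) g gt.
Proof.
move=> oA AU sG pG g gt.
have cc vs i : ct2 A (comp_derive vs G i) by exact: ct2_comp_derive AU sG.
have cs vs i (s t : R) (As : A s) := @comp_derive_s A U vs G i s t AU sG As.
have ctt vs i (s t : R) (As : A s) := @comp_derive_t A U vs G i s t AU sG As.
have cg i : ct2 A (g i) by apply: ct2_add; [exact: cc|apply: ct2_scale; exact: cc].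
have cgt i : ct2 A (gt i) by apply: ct2_add; [exact: cc|apply: ct2_scale; exact: cc].
have C0 : cyl tau sg A (comp_derive [::] G) (comp_derive [:: et] G) (comp_derive [:: es] G)
    (comp_derive [:: es; et] G) g.
  split; try exact: cc; first exact: cg.
  - by move=> i s t As; exact: ctt.
  - by move=> i s t As; exact: cs.
  - by move=> i s t As; exact: cs.
  - by move=> i s t As; rewrite -(comp_derive_sym _ _ _ oA AU sG As); exact: ctt.
  - by move=> i s t As; rewrite /comp_derive /= pG.
  - by move=> i s t As; rewrite /g; ring.
split; first exact: C0.
- split; try exact: cc; first exact: cgt.
  + by move=> i s t As; exact: ctt.
  + by move=> i s t As; exact: cs.
  + by move=> i s t As; exact: cs.
  + by move=> i s t As; rewrite -(comp_derive_sym _ _ _ oA AU sG As); exact: ctt.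
  + by move=> i s t As; exact: (cyl_ft_per C0).
  + by move=> i s t As; rewrite /gt (comp_derive_sym _ _ _ oA AU sG As); ring.
- move=> i s t As; apply: is_deriveD1; first exact: ctt.
  by apply: is_deriveZ1; exact: ctt.
Qed.

Lemma perturbed_data (r e : R) (V : E -> E) (u : R * R -> E) : 0 < r ->
  perturbed_cylinder `[- r - 1, r + 1] e V u ->
  let A := [set s | - r - 1 < s < r + 1] in
  exists f ft fs ftt fts ftts g gt : fam,
  [/\ smooth_cyl tau sg A f ft fs ftt fts ftts g gt,
      forall i s t, A s -> f i s t = u (s, t) ord0 i &
      forall i s t, A s -> g i s t = e * V (u (s, t)) ord0 i].
Proof.
move=> r0 [[su pu bu] eq] A; set I := `[- r - 1, r + 1]%classic in su pu bu eq.
have AI : A `<=` I by move=> s /= /andP[s1 s2]; rewrite /I /= in_itv/= !ltW.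
have oA : open A.
  have -> : A = `](- r - 1), (r + 1)[%classic.
    by apply/seteqP; split => s /=; rewrite in_itv.
  exact: interval_open.
(* This is the very extension chosen in [partial_s] and [partial_t], so the equation of the cylinder
   concerns its derivatives. *)
have ext : smooth_extension (strip I) u (get [set g | smooth_extension (strip I) u g]).
  by case: su => g0 Hg; apply: (@getPex _ [set g | smooth_extension (strip I) u g]); exists g0.
set G := get _ in ext; have [U [_ IU sG Gu]] := ext.
have AU : strip A `<=` U by move=> [s t] [/= As _]; apply: IU; split => //; exact: AI.
have Gu' s t : A s -> G (s, t) = u (s, t) by move=> As; apply: Gu; split => //; exact: AI.
have pG s t : A s -> G (s, t + 1) = G (s, t).
  by move=> As; rewrite !Gu' ?pu//; exact: AI.
have H := smooth_cyl_of_smooth oA AU sG pG.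
do 8 eexists; split; first exact: H.
- by move=> i s t As; rewrite /comp_derive /= Gu'.
- move=> i s t As; have := eq (s, t) (conj (AI _ As) Logic.I).
  move=> /(congr1 (fun M : E => M ord0 i)).
  by rewrite [X in X = _ -> _]mxE J0E [X in _ = X -> _]mxE.
Qed.

End PerturbedData.

(** * Vector fields on the ball *)

Section VectorFields.
Context {R : realType} {m : nat}.
Local Notation E := 'rV[R]_(m + m).
Local Notation N := (m + m)%N.
Implicit Types (x y z : E) (G V : E -> E).

Lemma unit_cballE x : unit_cball x <-> \sum_i x ord0 i ^+ 2 <= 1.
Proof.
rewrite /unit_cball /enorm /= -[X in _ <= X <-> _]sqrtr1 ler_sqrt//.
Qed.

Lemma unit_cball_coord x i : unit_cball x -> `|x ord0 i| <= 1.
Proof.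
move=> /unit_cballE; rewrite (bigD1 i)//= => H.
rewrite -(@ler_sqr _ _ 1) ?nnegrE// expr1n real_normK ?num_real//.
apply: le_trans H; rewrite lerDl; apply: sumr_ge0 => j _; exact: sqr_ge0.
Qed.

Lemma unit_cball_shrink x y : (forall i, `|y ord0 i| <= `|x ord0 i|) ->
  unit_cball x -> unit_cball y.
Proof.
move=> yx /unit_cballE xb; apply/unit_cballE; apply: le_trans xb.
apply: ler_sum => i _; rewrite -real_normK ?num_real//.
rewrite -[leRHS]real_normK ?num_real// ler_sqr ?nnegrE//.
Qed.

Lemma unit_cball_compact : compact (@unit_cball R m).
Proof.
apply: bounded_closed_compact.
  exists 1; split => // M M1 x xb; rewrite /= /Num.Def.normr/= mx_normrE.
  apply: bigmax_le => [|[a i] _]; first by rewrite (le_trans _ (ltW M1)).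
  by rewrite (ord1 a)/= (le_trans (unit_cball_coord i xb))// ltW.
have -> : @unit_cball R m = (fun x : E => \sum_i x ord0 i ^+ 2) @^-1` [set y | y <= 1].
  by apply/seteqP; split => x /unit_cballE.
apply: closed_comp; last exact: closed_le.
have c : continuous (fun x : E => \sum_i x ord0 i ^+ 2).
  apply: continuous_big => [|i _ x]; first exact: add_continuous.
  exact: (cvgM (@coord_continuous R 1 N ord0 i x) (@coord_continuous R 1 N ord0 i x)).
by move=> x _; exact: c.
Qed.

Lemma is_derive_line G x v i (t : R) : derivable G (x + t *: v) v ->
  is_derive t 1 (fun t : R => G (x + t *: v) ord0 i) ('D_v G (x + t *: v) ord0 i).
Proof.
move=> D; have [D' E'] := is_derive_coord i D.
have eq : (fun h : R => h^-1 *: (((fun y => G y ord0 i) \o shift (x + t *: v)) (h *: v) - G (x + t *: v) ord0 i)) =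
    (fun h : R => h^-1 *: (((fun t : R => G (x + t *: v) ord0 i) \o shift t) (h *: (1 : R)) - G (x + t *: v) ord0 i)).
  apply/funext => h; rewrite /shift/=; congr (_ *: (G _ _ _ - _)).
  by rewrite [h *: 1]mulr1 scalerDl addrCA.
by split; [move: D'; rewrite /derivable eq|rewrite -E' /derive eq].
Qed.

Let ev (j : 'I_N) : E := delta_mx ord0 j.

(** On a segment parallel to an axis the moving coordinate is, in absolute value, at most the larger
    of its end values; by [unit_cball_shrink] the segment stays in the ball and the mean value
    theorem applies. *)
Lemma coord_lip U G C x j (a : R) i : smooth U G -> @unit_cball R m `<=` U ->
  (forall j x, unit_cball x -> `|'D_(ev j) G x ord0 i| <= C) ->
  unit_cball x -> unit_cball (x + a *: ev j) ->
  `|G (x + a *: ev j) ord0 i - G x ord0 i| <= C * `|a|.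
Proof.
move=> sG BU GC xb xab.
have cb (t : R) : Num.min 0 a <= t <= Num.max 0 a -> unit_cball (x + t *: ev j).
  move=> t0a; set y := x + t *: ev j.
  have coordE (s : R) k : (x + s *: ev j) ord0 k = x ord0 k + s * (k == j)%:R.
    by rewrite !mxE eqxx.
  have [l01|l01] := leP `|x ord0 j| `|x ord0 j + a|.
  - apply: (unit_cball_shrink _ xab) => k; rewrite /y !coordE.
    have [->|_] := eqVneq k j; last by rewrite !mulr0.
    rewrite !mulr1; move: l01 t0a; case: (leP 0 a) => a0 l01 /andP[t1 t2].
      move: l01; rewrite ler_normr; case: (ger0P (x ord0 j)) => xj.
        by move=> _; rewrite ger0_norm ?ger0_norm//; lra.
      case/orP => h; last by have -> : t = a by lra.
      by rewrite ler_normr !ler_norml; apply/orP; left; apply/andP; split; lra.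
    move: l01; rewrite ler_normr; case: (ger0P (x ord0 j)) => xj.
      case/orP => h; first by lra.
      by rewrite ler_normr !ler_norml; apply/orP; right; apply/andP; split; lra.
    by move=> _; rewrite ltr0_norm ?ltr0_norm//; lra.
  - apply: (unit_cball_shrink _ xb) => k; rewrite /y !coordE.
    have [->|_] := eqVneq k j; last by rewrite !mulr0 addr0.
    rewrite mulr1; move: l01 t0a; rewrite ltr_norml; case: (ger0P (x ord0 j)) => xj.
      by case: (leP 0 a) => a0 /andP[l1 l2] /andP[t1 t2]; rewrite ler_norml; apply/andP; split; lra.
    by case: (leP 0 a) => a0 /andP[l1 l2] /andP[t1 t2]; rewrite ler_norml; apply/andP; split; lra.
have D (t : R) : Num.min 0 a <= t <= Num.max 0 a ->
    is_derive t 1 (fun t : R => G (x + t *: ev j) ord0 i) ('D_(ev j) G (x + t *: ev j) ord0 i).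
  by move=> /cb tb; apply: is_derive_line; have [_] := sG [::] _ (BU _ tb); apply.
have [c /cb cb' e] := mvt_sym D.
rewrite scale0r addr0 subr0 in e; rewrite e normrM ler_wpM2r//; exact: GC.
Qed.

(* Shrinking the coordinates of x one at a time gives a path to z made of
   coordinate segments that remain in the ball. *)
Definition hybrid x z (k : nat) : E := \row_j (if (j < k)%N then z ord0 j else x ord0 j).

Lemma shrink_lip U G C x z i : smooth U G -> @unit_cball R m `<=` U ->
  (forall j x, unit_cball x -> `|'D_(ev j) G x ord0 i| <= C) ->
  unit_cball x -> (forall j, `|z ord0 j| <= `|x ord0 j|) ->
  `|G z ord0 i - G x ord0 i| <= C * \sum_j `|z ord0 j - x ord0 j|.
Proof.
move=> sG BU GC xb zx.
have hb k : unit_cball (hybrid x z k).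
  by apply: (unit_cball_shrink _ xb) => j; rewrite mxE; case: ifP.
have step k : (k <= N)%N -> `|G (hybrid x z k) ord0 i - G x ord0 i| <=
    C * \sum_(j < N | (j < k)%N) `|z ord0 j - x ord0 j|.
  elim: k => [|k IH] kN.
    have -> : hybrid x z 0 = x by apply/rowP => j; rewrite mxE.
    by rewrite subrr normr0 big1 ?mulr0// => j.
  pose kk : 'I_N := Ordinal kN.
  have hE : hybrid x z k.+1 = hybrid x z k + (z ord0 kk - x ord0 kk) *: ev kk.
    apply/rowP => j; rewrite !mxE eqxx/= ltnS leq_eqVlt.
    have [->|jk] := eqVneq j kk; first by rewrite /= eqxx/= ltnn mulr1 addrC subrK.
    have -> : (val j == k) = false by apply/negbTE; apply: contra_neq jk => jk; exact: val_inj.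
    by rewrite mulr0 addr0.
  rewrite (bigD1 kk)/=; last by rewrite ltnS.
  have -> : \sum_(j < N | (j < k.+1)%N && (j != kk)) `|z ord0 j - x ord0 j| =
      \sum_(j < N | (j < k)%N) `|z ord0 j - x ord0 j|.
    apply: eq_bigl => j; rewrite ltnS leq_eqVlt.
    have [->|jk] := eqVneq j kk; first by rewrite /= ltnn andbF.
    have -> : (val j == k) = false by apply/negbTE; apply: contra_neq jk => jk; exact: val_inj.
    by rewrite andbT.
  rewrite mulrDr -(subrKA (G (hybrid x z k) ord0 i)) (le_trans (ler_normD _ _))// lerD//.
    rewrite hE; apply: (coord_lip sG BU GC) => //; by rewrite -hE.
  by apply: IH; exact: ltnW.
have := step N (leqnn N).
have -> : hybrid x z N = z by apply/rowP => j; rewrite mxE ltn_ord.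
by under eq_bigl do rewrite ltn_ord.
Qed.

(** Derivatives are bounded along the axes, and an axis-parallel path from x to y may leave the
    ball. Both points are therefore shrunk to [z], which takes in each coordinate the value of
    smaller modulus; the lengths of the two paths add up to the l1 distance. *)
Lemma ball_lip U G C x y i : smooth U G -> @unit_cball R m `<=` U ->
  (forall j x, unit_cball x -> `|'D_(ev j) G x ord0 i| <= C) ->
  unit_cball x -> unit_cball y ->
  `|G x ord0 i - G y ord0 i| <= C * \sum_j `|x ord0 j - y ord0 j|.
Proof.
move=> sG BU GC xb yb.
pose z : E := \row_j (if `|x ord0 j| <= `|y ord0 j| then x ord0 j else y ord0 j).
have zx j : `|z ord0 j| <= `|x ord0 j| by rewrite mxE; case: ifPn => //; rewrite -ltNge => /ltW.
have zy j : `|z ord0 j| <= `|y ord0 j| by rewrite mxE; case: ifPn.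
have h1 := shrink_lip sG BU GC xb zx.
have h2 := shrink_lip sG BU GC yb zy.
rewrite -(subrKA (G z ord0 i)) (le_trans (ler_normD _ _))//.
rewrite distrC (le_trans (lerD h1 h2))// -mulrDr -big_split/=.
rewrite le_eqVlt; apply/orP; left; apply/eqP; congr (_ * _); apply: eq_bigr => j _.
by rewrite mxE; case: ifP => _; rewrite subrr normr0 ?addr0 ?add0r// distrC.
Qed.

Lemma sum_sqr_lip (a b : 'I_N -> R) (C : R) : 0 <= C ->
  (forall i, `|b i| <= C * \sum_j `|a j|) ->
  \sum_i b i ^+ 2 <= (C * N%:R * N%:R) ^+ 2 * \sum_i a i ^+ 2.
Proof.
move=> C0 H; set S := \sum_i a i ^+ 2.
have S0 : 0 <= S by apply: sumr_ge0 => i _; exact: sqr_ge0.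
have aS j : `|a j| <= Num.sqrt S.
  rewrite -sqrtr_sqr ler_wsqrtr// /S (bigD1 j)//= lerDl.
  by apply: sumr_ge0 => i _; exact: sqr_ge0.
have aN : \sum_j `|a j| <= N%:R * Num.sqrt S.
  have -> : N%:R * Num.sqrt S = \sum_(j < N) Num.sqrt S.
    by rewrite sumr_const card_ord mulr_natl.
  by apply: ler_sum => j _.
have bi i : b i ^+ 2 <= (C * (N%:R * Num.sqrt S)) ^+ 2.
  rewrite -real_normK ?num_real// ler_sqr ?nnegrE//.
    by apply: le_trans (H i) _; exact: ler_wpM2l.
  by rewrite !mulr_ge0// sqrtr_ge0.
apply: (@le_trans _ _ (\sum_(i < N) (C * (N%:R * Num.sqrt S)) ^+ 2)).
  by apply: ler_sum => i _.
rewrite sumr_const card_ord -[X in X <= _]mulr_natl.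
have qq : Num.sqrt S ^+ 2 = S by rewrite sqr_sqrtr.
have -> : (C * (N%:R * Num.sqrt S)) ^+ 2 = C ^+ 2 * N%:R ^+ 2 * S by rewrite -[in RHS]qq; ring.
have -> : (C * N%:R * N%:R) ^+ 2 * S = N%:R ^+ 2 * (C ^+ 2 * N%:R ^+ 2 * S) by ring.
rewrite ler_wpM2r//; first by rewrite !mulr_ge0// sqr_ge0.
case: (N) => [|k]; first by rewrite expr0n.
by rewrite expr2 ler_peMr// ler1n.
Qed.

Lemma uniform_near (U W : normedModType R) (A : set U)
    (F_ : nat -> U -> W) (F : U -> W) (e : R) :
  {uniform A, F_ @ \oo --> F} -> 0 < e ->
  \forall n \near \oo, forall p, A p -> `|F_ n p - F p| <= e.
Proof.
move=> H e0.
have : nbhs (F : {uniform` A -> W}) [set h | forall p, A p -> ball (F p) e (h p)].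
  apply/uniform_nbhs; exists [set q | ball q.1 e q.2]; split.
    by rewrite -entourage_ballE; exists e.
  by move=> h.
move=> /H [K _ HK]; exists K => // n /HK Hn p /Hn.
by rewrite -ball_normE /= distrC => /ltW.
Qed.

Lemma coord_le_norm x i : `|x ord0 i| <= `|x|.
Proof.
rewrite [leRHS]/Num.Def.normr/= mx_normrE; apply/bigmax_geP; right => /=.
by exists (ord0, i).
Qed.

Lemma smooth_bounded U G vs : smooth U G -> @unit_cball R m `<=` U ->
  exists2 M, 0 <= M & forall x, unit_cball x -> `|iter_derive vs G x| <= M.
Proof.
move=> sG BU.
have cw : {within @unit_cball R m, continuous (iter_derive vs G)}.
  by apply: continuous_in_subspaceT => x /set_mem xb; have [] := sG vs x (BU x xb).
have := compact_bounded (continuous_compact cw unit_cball_compact).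
move=> [M [_ HM]]; exists (Num.max 0 (M + 1)); first by rewrite le_max lexx.
move=> x xb; rewrite le_max; apply/orP; right; apply: HM; first by rewrite ltrDl.
by exists x.
Qed.

Lemma smooth_extension_get (W : E -> E) : smooth_on unit_cball W ->
  smooth_extension unit_cball W (get [set g | smooth_extension unit_cball W g]).
Proof.
by move=> [g Hg]; apply: (@getPex _ [set g | smooth_extension unit_cball W g]); exists g.
Qed.

Lemma coord_near (V_ : nat -> E -> E) (V : E -> E) (e : R) :
  (forall n, smooth_on unit_cball (V_ n)) -> smooth_on unit_cball V ->
  Cinfty_cvg_on unit_cball V_ V -> 0 < e ->
  \forall n \near \oo, forall x i, unit_cball x -> `|V_ n x ord0 i - V x ord0 i| <= e.
Proof.
move=> sV_ sV cV e0; have [_ [_ _ _ GV]] := smooth_extension_get sV.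
near=> n => x i xb; have [_ [_ _ _ GVn]] := smooth_extension_get (sV_ n).
have : `|V_ n x - V x| <= e.
  rewrite -GV// -GVn//; move: x xb; near: n; exact: uniform_near (cV [::]) e0.
by move=> /(le_trans (coord_le_norm _ i)); rewrite !mxE.
Unshelve. all: by end_near. Qed.

Lemma vf_estimates (V_ : nat -> E -> E) (V : E -> E) :
  (forall n, smooth_on unit_cball (V_ n)) -> smooth_on unit_cball V ->
  Cinfty_cvg_on unit_cball V_ V ->
  exists C, 0 < C /\ \forall n \near \oo,
    [/\ forall x i, unit_cball x -> `|V_ n x ord0 i| <= C,
        forall x i, unit_cball x -> `|V x ord0 i| <= C &
        forall x y, unit_cball x -> unit_cball y ->
        \sum_i (V_ n x ord0 i - V_ n y ord0 i) ^+ 2 <=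
          C ^+ 2 * \sum_i (x ord0 i - y ord0 i) ^+ 2].
Proof.
move=> sV_ sV cV.
have [U [_ BU sG GV]] := smooth_extension_get sV.
have [M0 M00 HM0] := smooth_bounded [::] sG BU.
have /choice[M HM] j : exists M, 0 <= M /\ forall x, unit_cball x ->
    `|iter_derive_on unit_cball [:: ev j] V x| <= M.
  by have [M ? ?] := smooth_bounded [:: ev j] sG BU; exists M.
(* [C1] exceeds each [M j + 1], which bounds the j-th derivative of [V_ n] once it is within 1 of
   that of [V]. *)
pose C1 := \sum_j M j + 1.
have C10 : 0 <= C1.
  by rewrite addr_ge0//; apply: sumr_ge0 => j _; have [] := HM j.
have MC1 j : M j + 1 <= C1.
  rewrite lerD2r (bigD1 j)//= lerDl; apply: sumr_ge0 => k _; by have [] := HM k.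
pose L := C1 * N%:R * N%:R.
have L0 : 0 <= L by rewrite !mulr_ge0.
(* [L] is the Lipschitz constant, [M0 + 1] the sup bound; the sum serves for both. *)
exists (L + M0 + 1); split; first by lra.
have near1 : \forall n \near \oo, forall j x, unit_cball x ->
    `|iter_derive_on unit_cball [:: ev j] (V_ n) x -
      iter_derive_on unit_cball [:: ev j] V x| <= 1.
  by apply: filter_forall => j; apply: uniform_near (cV [:: ev j]) ltr01.
have near0 := uniform_near (cV [::]) ltr01.
near=> n.
have [Un [_ BUn sGn GVn]] := smooth_extension_get (sV_ n).
have VM x i : unit_cball x -> `|V x ord0 i| <= M0.
  move=> xb; apply: le_trans (coord_le_norm _ _) _; rewrite -GV//; exact: HM0.
split.
- move=> x i xb.
  have : `|V_ n x - V x| <= 1.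
    rewrite -GV// -GVn//; move: x xb; near: n; exact: near0.
  move=> /(le_trans (coord_le_norm _ i)); rewrite !mxE => h.
  have := VM x i xb; have := L0; move: h; rewrite !ler_norml => /andP[? ?] ? /andP[? ?].
  by apply/andP; split; lra.
- by move=> x i /(VM x i) h; apply: le_trans h _; lra.
- move=> x y xb yb.
  apply: (@le_trans _ _ (L ^+ 2 * \sum_i (x ord0 i - y ord0 i) ^+ 2)); last first.
    rewrite ler_wpM2r//; first by apply: sumr_ge0 => i _; exact: sqr_ge0.
    by rewrite ler_sqr ?nnegrE; lra.
  apply: sum_sqr_lip => // i; rewrite -!GVn//.
  apply: (ball_lip sGn BUn) => // j w wb.
  have [_ HMj] := HM j.
  have h1 : `|iter_derive_on unit_cball [:: ev j] (V_ n) w -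
      iter_derive_on unit_cball [:: ev j] V w| <= 1.
    by move: j w wb {HMj}; near: n; exact: near1.
  apply: le_trans (coord_le_norm _ i) _; apply: le_trans (MC1 j).
  have := HMj w wb; rewrite /iter_derive_on /= in h1 *.
  move=> h2; rewrite -(subrK ('D_(ev j) (get [set g | smooth_extension unit_cball V g]) w)
    ('D_(ev j) _ w)).
  by rewrite (le_trans (ler_normD _ _))// addrC lerD.
Unshelve. all: by end_near. Qed.

End VectorFields.

(** * Compactness *)

Section Compactness.
Context {R : realType}.

(** A cluster point in a product of intervals [-1, 1]. A neighbourhood constrains finitely many
    coordinates, so each finite set of points is served by arbitrarily late indices; the subsequence
    is extracted afterwards. *)
Lemma tychonoff_cluster (X : eqType) (Phi : nat -> X -> R) :
  (forall n x, `|Phi n x| <= 1) ->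
  exists P : X -> R, forall (xs : seq X) (e : R) N, 0 < e ->
    exists2 n, (N <= n)%N & forall x, x \in xs -> `|Phi n x - P x| <= e.
Proof.
move=> bd.
have := @tychonoff X (fun=> R) (fun=> `[(-1 : R), 1]%classic)
  (fun=> @segment_compact _ _ _).
move=> /(_ (Phi @ \oo) _) [|P [_ clP]].
  by exists 0%N => // n _ x; rewrite /= in_itv/= -ler_norml.
exists P => xs e N e0.
have nb : nbhs (P : {ptws X -> R}) [set g : {ptws X -> R} | forall x, x \in xs -> `|g x - P x| <= e].
  elim: xs => [|x xs IH]; first by apply: filterS filterT => g _ x; rewrite in_nil.
  have nbx : nbhs (P x : R) [set y : R | `|y - P x| <= e].
    apply/nbhs_ballP; exists e => // y; rewrite /ball/= distrC; exact: ltW.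
  have h : nbhs (P : {ptws X -> R}) [set g : {ptws X -> R} | `|g x - P x| <= e].
    exact: (@proj_continuous X (fun=> R) x P _ nbx).
  have FF : Filter (nbhs (P : {ptws X -> R})) by exact: nbhs_filter.
  have := @filterI _ _ FF _ _ h IH.
  apply: (@filterS _ _ FF) => g [h1 h2] y; rewrite inE => /orP[/eqP->//|].
  exact: h2.
have FN : (Phi @ \oo) [set g | exists2 n, (N <= n)%N & g = Phi n].
  by exists N => // n /= Nn; exists n.
have [g [[n Nn ->] h]] := clP _ _ FN nb.
by exists n.
Qed.

Lemma subseq_choice (Q : nat -> nat -> Prop) :
  (forall k N, exists2 n, (N <= n)%N & Q k n) ->
  exists phi : nat -> nat, {homo phi : i j / (i < j)%N} /\ forall k, Q k (phi k).
Proof.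
move=> H; have /choice[h hP] : forall p : nat * nat, exists n, (p.2 <= n)%N /\ Q p.1 n.
  by move=> [k N]; have [n ? ?] := H k N; exists n.
(* The lower bound [(phi k').+1] forces the indices to increase strictly. *)
pose phi := fix phi k := if k is k'.+1 then h (k, (phi k').+1) else h (0%N, 0%N).
exists phi; split; last first.
  by case=> [|k]; [exact: (hP (0%N, 0%N)).2|exact: (hP (k.+1, (phi k).+1)).2].
apply: homo_ltn; first exact: ltn_trans.
by move=> k /=; exact: (hP (k.+1, (phi k).+1)).1.
Qed.

(** Arzela-Ascoli, with equicontinuity asked on the k-th window and for large n, as the domains of
    the u_n exhaust the half-lines. Inequalities between two values pass to the cluster point by
    [close], so [P] inherits equicontinuity, and closeness on a finite grid spreads to the
    window. *)
Lemma subseq_loc_unif (J : finType) (Phi : nat -> J -> R -> R -> R)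
    (lo hi : nat -> J -> R) (M : nat -> nat) :
  (forall n j s t, `|Phi n j s t| <= 1) ->
  (forall n j s t, Phi n j s (t + 1) = Phi n j s t) ->
  (forall k e, 0 < e -> exists d N, 0 < d /\ forall n, (N <= n)%N ->
     forall j s s' t t', lo k j <= s <= hi k j -> lo k j <= s' <= hi k j ->
     `|s - s'| <= d -> `|t - t'| <= d -> `|Phi n j s t - Phi n j s' t'| <= e) ->
  exists (P : J -> R -> R -> R) (phi : nat -> nat),
    [/\ {homo phi : i j / (i < j)%N}, forall k, (M k <= phi k)%N &
    forall k j s t, lo k j <= s <= hi k j ->
      `|Phi (phi k) j s t - P j s t| <= k.+1%:R^-1].
Proof.
move=> bd per eqc.
have [P0 HP] := @tychonoff_cluster (J * (R * R))%type
  (fun n x => Phi n x.1 x.2.1 x.2.2) (fun n x => bd _ _ _ _).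
pose P j s t := P0 (j, (s, t)).
have close (x y : J * (R * R)) (e : R) N : (forall n, (N <= n)%N ->
    `|Phi n x.1 x.2.1 x.2.2 - Phi n y.1 y.2.1 y.2.2| <= e) -> `|P0 x - P0 y| <= e.
  move=> H; apply/ler_addgt0Pr => e' e'0.
  have e2 : 0 < e' / 2 by rewrite divr_gt0.
  have [n Nn h] := HP [:: x; y] (e' / 2) N e2.
  have := h x; have := h y; rewrite !inE !eqxx !orbT => /(_ isT) + /(_ isT).
  have := H n Nn; rewrite !ler_norml => /andP[? ?] /andP[? ?] /andP[? ?].
  by apply/andP; split; lra.
have perP j s t : P j s (t + 1) = P j s t.
  apply/eqP; rewrite -subr_eq0 -normr_le0.
  by apply: (close (j, (s, t + 1)) (j, (s, t)) 0 0%N) => n _ /=; rewrite per subrr normr0.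
suff [phi [h1 h2]] : exists phi : nat -> nat, {homo phi : i j / (i < j)%N} /\
    forall k, (M k <= phi k)%N /\ forall j s t, lo k j <= s <= hi k j ->
      `|Phi (phi k) j s t - P j s t| <= k.+1%:R^-1.
  exists P, phi; split => // [k|k j s t]; first by have [] := h2 k.
  by have [_] := h2 k; apply.
apply: (@subseq_choice (fun k n => (M k <= n)%N /\ forall j s t, lo k j <= s <= hi k j ->
      `|Phi n j s t - P j s t| <= k.+1%:R^-1)) => k N.
set e : R := k.+1%:R^-1; have e0 : 0 < e by rewrite invr_gt0.
have e3 : 0 < e / 3 by rewrite divr_gt0.
have [d [N1 [d0 Hd]]] := eqc k (e / 3) e3.
have dinv : 0 < d^-1 by rewrite invr_gt0.
pose grid (j : J) (ab : nat * nat) : J * (R * R) := (j, (lo k j + ab.1%:R * d, ab.2%:R * d)).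
have near_grid (lo' x : R) : lo' <= x -> exists a, [/\ lo' + a%:R * d <= x,
    `|x - (lo' + a%:R * d)| <= d & a = Num.truncn ((x - lo') * d^-1)].
  move=> lx; exists (Num.truncn ((x - lo') * d^-1)).
  have y0 : 0 <= (x - lo') * d^-1 by rewrite mulr_ge0 ?subr_ge0// ltW.
  have := truncn_itv y0; move: (Num.truncn _) => a /andP[].
  rewrite ler_pdivlMr// ltr_pdivrMr// -natr1 mulrDl mul1r => h1 h2.
  by split => //; [lra|rewrite ler_norml; apply/andP; split; lra].
(* Points are rounded down to the grid, which keeps them inside the window in s; in t one period is
   enough. *)
pose B := (\max_j Num.truncn ((hi k j - lo k j) * d^-1)).+1.
pose T := (Num.truncn d^-1).+1.
pose xs := [seq grid j ab | j <- enum J, ab <- [seq (a, b) | a <- iota 0 B, b <- iota 0 T]].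
have [n Nn Hn] := HP xs (e / 3) (maxn (maxn N N1) (M k)) e3.
move: Nn; rewrite !geq_max => /andP[/andP[NN NN1] NM].
exists n => //; split => // j s t sj.
have [a [a1 a2 aE]] := near_grid (lo k j) s (andP sj).1.
have /andP[t0 t1] := frac_itv t; set t' := t - (Num.floor t)%:~R in t0 t1.
have [b [b1 b2 bE]] := near_grid 0 t' t0.
rewrite add0r in b1 b2.
have HPt : Phi n j s t = Phi n j s t'.
  by have := periodic_frac t (per n j s) 0; rewrite !addr0.
have PPt : P j s t = P j s t'.
  by have := periodic_frac t (perP j s) 0; rewrite !addr0.
have ad0 : 0 <= a%:R * d by rewrite mulr_ge0// ltW.
have sg : lo k j <= lo k j + a%:R * d <= hi k j.
  by case/andP: sj => s1 s2; apply/andP; split; lra.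
have gxs : grid j (a, b) \in xs.
  apply: allpairs_f; first by rewrite mem_enum.
  apply: allpairs_f; rewrite mem_iota/= add0n ltnS.
    apply: leq_trans (leq_bigmax j); rewrite aE; apply: le_truncn.
    by rewrite ler_wpM2r ?(ltW dinv)// lerD2r; case/andP: sj.
  by rewrite bE; apply: le_truncn; rewrite subr0 ler_piMl// ltW.
have c1 := Hd n NN1 j s (lo k j + a%:R * d) t' (b%:R * d) sj sg a2 b2.
have c2 : `|P j s t' - P j (lo k j + a%:R * d) (b%:R * d)| <= e / 3.
  apply: (close (j, (s, t')) (j, (lo k j + a%:R * d, b%:R * d)) _ N1) => n' N1n /=.
  exact: Hd.
have := Hn _ gxs; rewrite /grid /= HPt PPt; rewrite -/(P _ _ _).
move: c1 c2; rewrite !ler_norml => /andP[? ?] /andP[? ?] /andP[? ?].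
by apply/andP; split; lra.
Qed.

End Compactness.

(** * Estimates uniform along the sequence *)

Section CylinderEstimates.
Context {R : realType} {m : nat}.
Local Notation tau := (@conj_idx m).
Local Notation sg := (@conj_sg R m).
Local Notation fam := ('I_(m + m) -> R -> R -> R).
Local Notation E := 'rV[R]_(m + m).
Local Notation N := (m + m)%N.
Local Notation D := (@decay_const R N).

Definition rate (r s : R) : R := D * (expR (s - r) + expR (- r - s)).

Definition rate_max : R := D * (expR 1 + expR 1).

Lemma rate_le_max r s : - r - 1 / 2 <= s <= r + 1 / 2 -> rate r s <= rate_max.
Proof.
move=> /andP[s1 s2]; rewrite ler_wpM2l ?decay_const_ge0// lerD// ler_expR; lra.
Qed.

Lemma abs_le_of_sqr (x y : R) : 0 <= y -> x ^+ 2 <= y ^+ 2 -> `|x| <= y.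
Proof. by move=> y0 h; rewrite -ler_sqr ?nnegrE// real_normK ?num_real. Qed.

(* a is the mean of f over the circle and b its derivative, the mean of e V(u). *)
Record estimates (r e C : R) (V : E -> E) (u : R * R -> E) (f : fam)
    (a b : 'I_N -> R -> R) : Prop := Estimates {
  es_f : forall i s t, - r - 1 < s < r + 1 -> f i s t = u (s, t) ord0 i;
  es_whe : whe tau sg (e * C) [set s | - r - 1 < s < r + 1] f;
  es_da : forall i (s : R), - r - 1 < s < r + 1 -> is_derive s 1 (a i) (b i s);
  es_b : forall i s, - r - 1 < s < r + 1 -> `|b i s| <= e * C;
  es_a : forall i s, - r - 1 < s < r + 1 -> `|a i s| <= 1;
  es_osc : forall i s t, - r - 1 / 2 <= s <= r + 1 / 2 -> (f i s t - a i s) ^+ 2 <= rate r s;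
  es_bV : forall i s t, - r - 1 / 2 <= s <= r + 1 / 2 ->
    `|b i s - e * V (u (s, t)) ord0 i| <= e * C * Num.sqrt (4 * N%:R * rate r s);
  es_equi : forall d i s s' t t', 0 < d <= 1 -> - r - 1 / 2 <= s <= r + 1 / 2 ->
    - r - 1 / 2 <= s' <= r + 1 / 2 ->
    `|f i s t - f i s' t'| <= 2 * Num.sqrt (d * rate_max) +
      (2 * d^-1 + 1) * (`|s - s'| + `|t - t'|) }.

(** The equicontinuity estimate compares [f] with its Steklov average, up to [sqrt (d * rate_max)]
    by [avg_error]. The t-derivative of the average is at most [2 / d], a difference quotient of a
    function bounded by 1; its s-derivative has an average of [g] in addition, whence
    [2 / d + 1]. *)
Lemma cylinder_estimates (r e C : R) (V : E -> E) (u : R * R -> E) :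
  0 < r -> 0 < e -> 0 < C -> e * C <= 1 / 8 ->
  perturbed_cylinder `[- r - 1, r + 1] e V u ->
  (forall x i, unit_cball x -> `|V x ord0 i| <= C) ->
  (forall x y, unit_cball x -> unit_cball y ->
     \sum_i (V x ord0 i - V y ord0 i) ^+ 2 <= C ^+ 2 * \sum_i (x ord0 i - y ord0 i) ^+ 2) ->
  exists f a b, estimates r e C V u f a b.
Proof.
move=> r0 e0 C0 eC pc VC VL; have [[su pu bu] _] := pc.
have [f [ft [fs [ftt [fts [ftts [g [gt [SC fu gV]]]]]]]]] := perturbed_data r0 pc.
set A := [set s | - r - 1 < s < r + 1] in SC fu gV.
have oA : open A.
  have -> : A = `](- r - 1), (r + 1)[%classic.
    by apply/seteqP; split => s /=; rewrite in_itv.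
  exact: interval_open.
have ub s t : A s -> unit_cball (u (s, t)).
  by move=> As; apply: bu; rewrite /= in_itv/=; case/andP: As => h1 h2; rewrite !ltW.
have C00 := sc0 SC.
have f1 i s t : A s -> `|f i s t| <= 1.
  by move=> As; rewrite fu//; exact: unit_cball_coord (ub s t As).
have g1 i s t : A s -> `|g i s t| <= e * C.
  by move=> As; rewrite gV// normrM gtr0_norm// ler_wpM2l ?(ltW e0)//; exact: VC (ub s t As).
have lip s t t' : A s -> \sum_i (g i s t - g i s t') ^+ 2 <=
    (e * C) ^+ 2 * \sum_i (f i s t - f i s t') ^+ 2.
  move=> As; under eq_bigr do rewrite !gV// -mulrBr exprMn.
  rewrite -mulr_sumr exprMn -[leRHS]mulrA ler_wpM2l ?sqr_ge0//.
  under [X in _ <= _ * X]eq_bigr do rewrite !fu//.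
  by apply: VL; exact: ub.
have eC0 : 0 < e * C by rewrite mulr_gt0.
have dec s : - r - 1 / 2 <= s <= r + 1 / 2 -> en ft s <= rate r s.
  have eC8 : 0 < e * C <= 1 / 8 by rewrite eC0.
  exact: (en_ft_decay conj_idxK conj_sg2 conj_sgN r0 eC8 SC
    (fun y Ay t t' => lip y t t' Ay) f1).
have IA s : - r - 1 / 2 <= s <= r + 1 / 2 -> A s.
  by move=> /andP[h1 h2]; rewrite /A /=; apply/andP; split; lra.
have osc_f i s t : - r - 1 / 2 <= s <= r + 1 / 2 -> (f i s t - mean f i s) ^+ 2 <= rate r s.
  move=> sI; apply: le_trans (dec s sI); have As := IA s sI.
  exact: (@osc_sqr_le _ _ A f ft i s t As (cyl_ft C00) (cyl_dt C00) (cyl_per C00)).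
have cg i s (As : A s) := ct2_slice (cyl_g C00 i) As.
have cf i s (As : A s) := ct2_slice (cyl_f C00 i) As.
have stek_g d i s t : A s -> `|stek d g i s t| <= e * C.
  move=> As; apply: I01_norm_le => [|x _]; last exact: g1.
  exact: continuous_affine (cg i s As).
have dstek d i (s t : R) : 0 < d -> A s ->
    is_derive s 1 ((stek d f i)^~ t) (twist tau sg (dquot d f) i s t + stek d g i s t).
  move=> d0 As.
  have c1 := ct2_comp_t (c := t) (d := d) (cyl_f C00 i).
  have c2 := ct2_comp_t (c := t) (d := d) (cyl_fs C00 i).
  apply: is_derive1_eq (I01_derive oA As c1 c2 (fun s x As => cyl_ds C00 i s _ As)) _.
  have cft := continuous_affine (c := t) (k := d) (ct2_slice (cyl_ft C00 (tau i)) As).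
  have -> : I01 (fun x => fs i s (t + d * x)) =
      I01 (fun x => - sg i * ft (tau i) s (t + d * x) + g i s (t + d * x)).
    by apply: I01_eq => x; rewrite (cyl_eq C00).
  rewrite I01D; last 2 first.
  - by apply: continuousM1; [exact: continuous_cst1|exact: cft].
  - exact: continuous_affine (cg i s As).
  rewrite I01Z//; congr (_ * _ + _).
  have := avg_primitive (t := t) (d := d) (ct2_slice (cyl_ft C00 (tau i)) As)
    (fun x _ => cyl_dt C00 (tau i) s _ As).
  by rewrite /dquot => <-; rewrite mulKf// gt_eqF.
exists f, (mean f), (mean g); split.
- exact: fu.
- split; [exact: cyl_f C00|exact: cyl_per C00|].
  move=> d i t d0; exists (fun s => twist tau sg (dquot d f) i s t + stek d g i s t).
  by move=> s As; split; [exact: dstek|rewrite addrAC subrr add0r; exact: stek_g].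
- by move=> i s As; exact: (mean_derive oA C00 i As).
- by move=> i s As; apply: I01_norm_le => [|x _]; [exact: cg|exact: g1].
- by move=> i s As; apply: I01_norm_le => [|x _]; [exact: cf|exact: f1].
- exact: osc_f.
- move=> i s t sI; have As := IA s sI; rewrite -gV//.
  have r00 : 0 <= rate r s by apply: le_trans (sqr_ge0 _) (osc_f i s t sI).
  (* A mean of differences brings in the Lipschitz bound; the square of each difference of
     coordinates is at most [4 * rate r s]. *)
  have -> : mean g i s - g i s t = I01 (fun x => g i s x - g i s t).
    rewrite I01B; [|exact: cg|exact: continuous_cst1].
    by rewrite I01_cst.
  apply: I01_norm_le => [|x _].
    by apply: continuousB1; [exact: cg|exact: continuous_cst1].
  apply: abs_le_of_sqr; first by rewrite mulr_ge0 ?sqrtr_ge0// ltW.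
  rewrite exprMn sqr_sqrtr; last by rewrite !mulr_ge0.
  apply: (@le_trans _ _ (\sum_j (g j s x - g j s t) ^+ 2)).
    by rewrite (bigD1 i)//= lerDl; apply: sumr_ge0 => j _; exact: sqr_ge0.
  apply: le_trans (lip s x t As) _; rewrite ler_wpM2l ?sqr_ge0//.
  have -> : 4 * N%:R * rate r s = \sum_(j < N) (4 * rate r s).
    by rewrite sumr_const card_ord -mulr_natl; ring.
  apply: ler_sum => j _.
  have := osc_f j s x sI; have := osc_f j s t sI.
  move: (f j s x) (f j s t) (mean f j s) => y z w h1 h2.
  have := sqr_ge0 ((y - w) + (z - w)); nra.
- move=> d i s s' t t' /andP[d0 d1] sI s'I.
  have di : 0 < d^-1 by rewrite invr_gt0.
  have close y t0 : - r - 1 / 2 <= y <= r + 1 / 2 ->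
      `|f i y t0 - stek d f i y t0| <= Num.sqrt (d * rate_max).
    move=> yI; have Ay := IA y yI.
    have rm0 : 0 <= d * rate_max.
      by rewrite mulr_ge0 ?(ltW d0)// mulr_ge0 ?decay_const_ge0// addr_ge0 ?expR_ge0.
    apply: abs_le_of_sqr; first exact: sqrtr_ge0.
    rewrite sqr_sqrtr//.
    have d01 : 0 <= d <= 1 by rewrite (ltW d0).
    apply: le_trans (avg_error t0 d01 (fun t => cyl_dt C00 i y t Ay)
      (ct2_slice (cyl_ft C00 i) Ay) (fun x => cyl_per C00 i y x Ay)) _.
    rewrite ler_wpM2l ?(ltW d0)//; apply: le_trans (rate_le_max yI).
    apply: le_trans (dec y yI); rewrite /en (bigD1 i)//= lerDl.
    by apply: sumr_ge0 => j _; apply: I01_ge0 => x; exact: sqr_ge0.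
  have dq j y t0 : A y -> `|dquot d f j y t0| <= 2 * d^-1.
    move=> Ay; rewrite /dquot normrM gtr0_norm// mulrC ler_wpM2r ?(ltW di)//.
    have := f1 j y t0 Ay; have := f1 j y (t0 + d) Ay.
    rewrite !ler_norml => /andP[? ?] /andP[? ?]; apply/andP; split; lra.
  have [c1 _ E1] := @mvt_sym _ (stek d f i s) (dquot d f i s) t t'
    (fun y _ => @stek_dt _ _ A f d i s y (cyl_f C00) d0 (IA s sI)).
  have IS y : Num.min s s' <= y <= Num.max s s' -> A y.
    by move=> H; exact: between_oo H (IA s sI) (IA s' s'I).
  have [c2 c2I E2] := @mvt_sym _ ((stek d f i)^~ t')
    (fun y => twist tau sg (dquot d f) i y t' + stek d g i y t') s s'
    (fun y yI => dstek d i y t' d0 (IS y yI)).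
  have B1 : `|stek d f i s t' - stek d f i s t| <= 2 * d^-1 * `|t - t'|.
    by rewrite E1 normrM [`|t' - t|]distrC ler_wpM2r//; exact: dq (IA s sI).
  have B2 : `|stek d f i s' t' - stek d f i s t'| <= (2 * d^-1 + 1) * `|s - s'|.
    rewrite E2 normrM [`|s' - s|]distrC ler_wpM2r//.
    have Ac := IS c2 c2I; apply: le_trans (ler_normD _ _) _; apply: lerD.
      by rewrite /twist normrM normrN (sg_norm conj_sg2) mul1r; exact: dq.
    by apply: le_trans (stek_g d i c2 t' Ac) _; lra.
  have := close s t sI; have := close s' t' s'I; move: B1 B2; rewrite mulrDr.
  have := normr_ge0 (t - t').
  move: (`|t - t'|) (`|s - s'|) (Num.sqrt _) => T S K T0.
  move: (f i s t) (f i s' t') (stek d f i s t) (stek d f i s t') (stek d f i s' t').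
  move=> x1 x2 y1 y2 y3; rewrite !ler_norml => /andP[? ?] /andP[? ?] /andP[? ?] /andP[? ?].
  by apply/andP; split; rewrite [(_ + 1) * T]mulrDl; lra.
Qed.

Lemma estimates_lip (r e C : R) (V : E -> E) (u : R * R -> E) (f : fam)
    (a b : 'I_N -> R -> R) i (s s' : R) : estimates r e C V u f a b ->
  - r - 1 < s < r + 1 -> - r - 1 < s' < r + 1 -> `|a i s - a i s'| <= e * C * `|s - s'|.
Proof.
move=> es sI s'I.
have IS y : Num.min s' s <= y <= Num.max s' s -> - r - 1 < y < r + 1.
  by move=> H; exact: between_oo H s'I sI.
have [y yI ->] := @mvt_sym _ (a i) (b i) s' s (fun y yI => es_da es i (IS y yI)).
by rewrite normrM ler_wpM2r//; exact: (es_b es i (IS y yI)).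
Qed.

End CylinderEstimates.

(** * Truncation and vanishing error terms *)

Section Auxiliary.
Context {R : realType}.

(** The central cylinder may be shorter than [[- l, l]]; clamping to [[- c, c]] makes the rescaled
    means functions on all of [[- l, l]], at the cost of [|c - l|]. *)
Definition clamp (c s : R) : R := Num.max (- c) (Num.min c s).

Lemma clamp_itv c s : 0 <= c -> - c <= clamp c s <= c.
Proof.
by move=> c0; rewrite /clamp le_max lexx ge_max ge_min lexx !andTb; apply/andP; split => //; lra.
Qed.

Lemma clamp_id c s : - c <= s <= c -> clamp c s = s.
Proof. by move=> /andP[h1 h2]; rewrite /clamp min_r// max_r. Qed.

Lemma clamp_lip c s s' : 0 <= c -> `|clamp c s - clamp c s'| <= `|s - s'|.
Proof.
move=> c0; rewrite /clamp; have := ler_norm (s - s').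
have := ler_norm (- (s - s')); rewrite normrN => h1 h2.
by case: (leP c s) => ?; case: (leP c s') => ?;
  rewrite ?[Num.max (- c) c]max_r ?lerN ?ler_norml; try lra;
  case: (leP (- c) s) => ?; case: (leP (- c) s') => ?; apply/andP; split; lra.
Qed.

Lemma clamp_close c l s : 0 <= c -> - l <= s <= l -> `|clamp c s - s| <= `|c - l|.
Proof.
move=> c0 /andP[s1 s2].
have := ler_norm (c - l); have := ler_norm (- (c - l)); rewrite normrN /clamp => h1 h2.
have := normr_ge0 (c - l) => h3.
case: (leP c s) => ?; [rewrite max_r; last by lra|case: (leP (- c) s) => ?];
  rewrite ler_norml; apply/andP; split; lra.
Qed.

Lemma q_cvg : (k.+1%:R^-1 : R) @[k --> \oo] --> (0 : R).
Proof. exact: cvg_harmonic. Qed.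

Lemma q_gt0 k : 0 < (k.+1%:R^-1 : R).
Proof. by rewrite invr_gt0. Qed.

Lemma expRN_le_q (k : nat) (x : R) : k%:R <= x -> expR (- x) <= k.+1%:R^-1.
Proof.
move=> kx; rewrite expRN lef_pV2 ?posrE ?expR_gt0//.
by apply: le_trans (expR_ge1Dx x); rewrite -natr1; lra.
Qed.

(** Bounds the oscillation at distance at least k from both ends, with the exponential weakened to 1
    / (k + 1). *)
Definition wk (B : R) (k : nat) : R := Num.sqrt (B * k.+1%:R^-1).

Lemma wk_cvg B : wk B k @[k --> \oo] --> (0 : R).
Proof.
have c : B * k.+1%:R^-1 @[k --> \oo] --> (0 : R).
  by rewrite -[X in _ --> X](mulr0 B); apply: cvgM; [exact: cvg_cst|exact: q_cvg].
have s0 : {for (0 : R), continuous (@Num.sqrt R)} by exact: sqrt_continuous.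
by have := cvg_comp _ _ c s0; rewrite sqrtr0.
Qed.

Lemma small_cvg A B1 B : A * k.+1%:R^-1 + B1 * wk B k @[k --> \oo] --> (0 : R).
Proof.
rewrite -[X in _ --> X](addr0 (0 : R)); apply: cvgD.
  by rewrite -[X in _ --> X](mulr0 A); apply: cvgM; [exact: cvg_cst|exact: q_cvg].
by rewrite -[X in _ --> X](mulr0 B1); apply: cvgM; [exact: cvg_cst|exact: wk_cvg].
Qed.

Lemma le_of_small (x y A B1 B : R) K :
  (forall k, (K <= k)%N -> x <= y + (A * k.+1%:R^-1 + B1 * wk B k)) -> x <= y.
Proof.
move=> H; have C : y + (A * k.+1%:R^-1 + B1 * wk B k) @[k --> \oo] --> y.
  rewrite -[X in _ --> X](addr0 y); apply: cvgD; [exact: cvg_cst|exact: small_cvg].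
by apply: (cvgr_to_ge C); exists K => // k /=; exact: H.
Qed.

Lemma ex_nat_ge (x : R) : exists k : nat, x <= k%:R.
Proof.
exists (Num.truncn `|x|).+1; apply: le_trans (ler_norm x) _.
by have := truncn_itv (normr_ge0 x) => /andP[_ /ltW].
Qed.

Lemma ex_q_le (e : R) : 0 < e -> exists K, forall k, (K <= k)%N -> k.+1%:R^-1 <= e.
Proof.
move=> e0; have [K Ke] := ex_nat_ge e^-1; exists K => k Kk.
rewrite -[e]invrK lef_pV2 ?posrE ?invr_gt0// (le_trans Ke)// ler_nat.
exact: leq_trans Kk _.
Qed.

End Auxiliary.

Section AuxiliaryVectors.
Context {R : realType} {m : nat}.
Local Notation tau := (@conj_idx m).
Local Notation sg := (@conj_sg R m).
Local Notation fam := ('I_(m + m) -> R -> R -> R).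
Local Notation E := 'rV[R]_(m + m).
Local Notation N := (m + m)%N.

Lemma whe_shift e e' (A B : set R) (f : fam) (c : R) : e <= e' ->
  (forall s, B s -> A (s + c)) -> whe tau sg e A f ->
  whe tau sg e' B (fun i s t => f i (s + c) t).
Proof.
move=> ee BA [cf pf df]; split.
- move=> i s t Bs.
  apply: (continuous2_cvg _ (cf i (s + c) t (BA s Bs))); last exact: cvg_snd.
  by apply: cvgD; [exact: cvg_fst|exact: cvg_cst].
- by move=> i s t /BA; exact: pf.
- move=> d i t d0; have [D HD] := df d i t d0.
  exists (fun s => D (s + c)) => s /BA/HD [h1 h2]; split; last exact: le_trans ee.
  have := @is_derive_comp_affine _ ((stek d f i)^~ t) (D (s + c)) c 1 s.
  rewrite !mul1r addrC => /(_ h1).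
  by have -> : (fun x => stek d f i (c + 1 * x) t) =
      (fun x => stek d (fun i s t => f i (s + c) t) i x t)
    by apply/funext => x; rewrite mul1r addrC.
Qed.

Lemma ball_limit (x : E) :
  (forall e, 0 < e -> exists2 y, unit_cball y & forall i, `|x ord0 i - y ord0 i| <= e) ->
  unit_cball x.
Proof.
move=> H; apply/unit_cballE; apply/ler_addgt0Pr => e e0.
(* Moving a coordinate of modulus at most 1 by [d <= 1] raises its square by at most
   [2 d + d^2 <= 3 d]; there are [N] of them. *)
pose d := Num.min 1 (e / (3 * N.+1%:R)).
have N0 : 0 < 3 * N.+1%:R :> R by rewrite mulr_gt0.
have d0 : 0 < d by rewrite lt_min ltr01 divr_gt0.
have d1 : d <= 1 by rewrite ge_min lexx.
have de : 3 * N.+1%:R * d <= e.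
  by rewrite mulrC -ler_pdivlMr// ge_min lexx orbT.
have [y yb xy] := H d d0.
have := yb => /unit_cballE yb'.
apply: (@le_trans _ _ (\sum_i (y ord0 i ^+ 2 + 3 * d))).
  apply: ler_sum => i _; have := xy i; have := unit_cball_coord i yb.
  have -> : x ord0 i ^+ 2 = (y ord0 i + (x ord0 i - y ord0 i)) ^+ 2 by ring.
  move: (y ord0 i) (x ord0 i - y ord0 i) => w z w1 zd.
  have zw : w * z <= d.
    apply: le_trans (ler_norm _) _; rewrite normrM -[leRHS]mul1r; apply: ler_pM => //.
  have zz : z ^+ 2 <= d.
    rewrite -real_normK ?num_real// expr2 -[leRHS]mul1r; apply: ler_pM => //.
    exact: le_trans d1.
  have -> : (w + z) ^+ 2 = w ^+ 2 + 2 * (w * z) + z ^+ 2 by ring.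
  lra.
rewrite big_split/= lerD// sumr_const card_ord; apply: le_trans de.
have -> : 3 * d *+ N = 3 * N%:R * d by rewrite -[LHS]mulr_natl; ring.
by rewrite ler_wpM2r ?(ltW d0)// ler_wpM2l// ler_nat.
Qed.

Lemma enorm_le (x : E) (B : R) : 0 <= B -> (forall i, `|x ord0 i| <= B) ->
  enorm x <= N%:R * B.
Proof.
move=> B0 H; rewrite /enorm -[leRHS]ger0_norm ?mulr_ge0// -sqrtr_sqr.
rewrite ler_wsqrtr//.
apply: (@le_trans _ _ (\sum_(i < N) B ^+ 2)).
  apply: ler_sum => i _; rewrite -real_normK ?num_real// ler_sqr ?nnegrE//.
rewrite sumr_const card_ord -[X in X <= _]mulr_natl exprMn ler_wpM2r ?sqr_ge0//.
by rewrite -natrX ler_nat; case: (N) => // k; rewrite expnS leq_pmulr// expn_gt0.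
Qed.

Lemma enorm_ge0 (x : E) : 0 <= enorm x.
Proof. exact: sqrtr_ge0. Qed.

Lemma sup_dist_le {T : Type} (A : set T) (f g : T -> E) (B : R) : 0 <= B ->
  (forall p i, A p -> `|f p ord0 i - g p ord0 i| <= B) ->
  (sup_dist A f g <= (N%:R * B)%:E)%E.
Proof.
move=> B0 H; apply: ge_ereal_sup => _ [p Ap <-]; rewrite lee_fin.
by apply: enorm_le => // i; rewrite !mxE; exact: H.
Qed.

Lemma sup_dist_ge0 {T : Type} (A : set T) (f g : T -> E) p : A p ->
  (0 <= sup_dist A f g)%E.
Proof.
move=> Ap; apply: (@le_trans _ _ (enorm (f p - g p))%:E).
  by rewrite lee_fin enorm_ge0.
by apply: ereal_sup_ubound; exists p.
Qed.

Lemma closure_strip (I J : set R) : open J -> J `<=` I ->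
  (forall s e, I s -> 0 < e -> exists s', J s' /\ `|s - s'| < e) ->
  strip I `<=` closure (strip I)°.
Proof.
move=> oJ JI dense [s t] [/= Is _] W [[W1 W2] /= [W1s W2t] WW].
have [e /= e0 eW] := (nbhs_ballP _ _).1 W1s.
have [s' [Js' ss']] := dense s e Is e0.
exists (s', t); split; last first.
  by apply: WW; split; [apply: eW|exact: nbhs_singleton W2t].
have oS := open_strip oJ.
apply: filterS (open_nbhs_nbhs (conj oS (conj Js' Logic.I : strip J (s', t)))).
by move=> p [/JI].
Qed.

Lemma removable_of_bound (u : R * R -> E) (F : set_system R) (x : E) :
  Filter F -> unit_cball x ->
  (forall e, 0 < e -> \forall s \near F, forall t i, `|u (s, t) ord0 i - x ord0 i| <= e) ->
  removable_singularity u F x.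
Proof.
move=> FF xb H; split => //.
move=> P /uniform_nbhs [W [entW WP]].
move: entW; rewrite -entourage_ballE => -[e /= e0 eW].
have e2 : 0 < e / 2 by rewrite divr_gt0.
apply: filterS (H _ e2) => s Hs; apply: WP => t _; apply: eW => /=.
rewrite -ball_normE /= distrC; apply: (@le_lt_trans _ _ (e / 2)); last first.
  by rewrite ltr_pdivrMr// ltr_pMr// ltr1n.
rewrite /Num.Def.normr/= mx_normrE; apply: bigmax_le => [|[a i] _]; first exact: ltW.
by rewrite (ord1 a) !mxE; exact: Hs.
Qed.

End AuxiliaryVectors.

(** * Extraction of the convergent subsequence *)

Section Limit.
Context {R : realType} {m : nat}.
Local Notation tau := (@conj_idx m).
Local Notation sg := (@conj_sg R m).
Local Notation fam := ('I_(m + m) -> R -> R -> R).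
Local Notation E := 'rV[R]_(m + m).
Local Notation N := (m + m)%N.
Local Notation D := (@decay_const R N).

Variables (V_ : nat -> E -> E) (V : E -> E) (eps r rho : nat -> R)
  (u : nat -> R * R -> E) (l C : R) (n0 : nat) (M : nat -> nat)
  (F : nat -> fam) (a b : nat -> 'I_N -> R -> R).
Hypothesis eps0 : forall n, 0 < eps n.
Hypothesis r0 : forall n, 0 < r n.
Hypothesis rho0 : forall n, 0 < rho n.
Hypothesis rhor : forall n, rho n < r n.
Hypothesis C0 : 0 < C.
Hypothesis ub : forall n s t, - r n - 1 <= s <= r n + 1 -> unit_cball (u n (s, t)).
Hypothesis Hest : forall n, (n0 <= n)%N ->
  estimates (r n) (eps n) C (V_ n) (u n) (F n) (a n) (b n).

Let c n := eps n * (r n - rho n).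
Let q (k : nat) : R := k.+1%:R^-1.

Hypothesis HM : forall k n, (M k <= n)%N ->
  [/\ (n0 <= n)%N, eps n * C <= q k,
      forall x i, unit_cball x -> `|V_ n x ord0 i - V x ord0 i| <= q k,
      k.+1%:R <= rho n & eps n * rho n * C <= q k /\ `|c n - l| <= q k].

Let c0 n : 0 < c n.
Proof. by rewrite mulr_gt0// subr_gt0. Qed.

Let J : finType := (option bool * 'I_N)%type.

(* The three families of the compactness argument: the maps u_n seen from the
   left end and from the right end, and the rescaled means of u_n on the central
   cylinder. The value 0 outside of the domains is irrelevant in the limit. *)
Definition Phi n (j : J) (s t : R) : R :=
  if (n0 <= n)%N then
    match j.1 with
    | Some true => if - 1 / 2 <= s <= 2 * r n + 1 / 2 then F n j.2 (s - r n) t else 0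
    | Some false => if - (2 * r n) - 1 / 2 <= s <= 1 / 2 then F n j.2 (s + r n) t else 0
    | None => a n j.2 ((eps n)^-1 * clamp (c n) s)
    end
  else 0.

(** The windows of the ends grow with k and reach 1/2 beyond the boundary s = 0, so that the limits
    solve the equation on open sets containing the closed half-lines. *)
Definition lo (k : nat) (j : J) : R :=
  match j.1 with Some true => - 1 / 2 | Some false => - k%:R | None => - l end.
Definition hi (k : nat) (j : J) : R :=
  match j.1 with Some true => k%:R | Some false => 1 / 2 | None => l end.

Lemma center_itv n s : - (r n - rho n) <= (eps n)^-1 * clamp (c n) s <= r n - rho n.
Proof.
have /andP[h1 h2] := clamp_itv s (ltW (c0 n)).
by rewrite mulrC ler_pdivrMr// ler_pdivlMr// mulNr ![_ * eps n]mulrC h1 h2.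
Qed.

Lemma F_bound n i s t : (n0 <= n)%N -> - r n - 1 < s < r n + 1 -> `|F n i s t| <= 1.
Proof.
move=> nn sI; rewrite (es_f (Hest nn))//; apply: unit_cball_coord; apply: ub.
by case/andP: sI => h1 h2; rewrite !ltW.
Qed.

Lemma Phi_bound n j s t : `|Phi n j s t| <= 1.
Proof.
rewrite /Phi; case: ifPn => [nn|_]; last by rewrite normr0.
have rn := r0 n; have rhn := rho0 n; case: j.1 => [[]|].
- case: ifP => [/andP[h1 h2]|_]; last by rewrite normr0.
  by apply: F_bound => //; apply/andP; split; lra.
- case: ifP => [/andP[h1 h2]|_]; last by rewrite normr0.
  by apply: F_bound => //; apply/andP; split; lra.
- have /andP[h1 h2] := center_itv n s.
  by apply: (es_a (Hest nn)); apply/andP; split; lra.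
Qed.

Lemma Phi_periodic n j s t : Phi n j s (t + 1) = Phi n j s t.
Proof.
rewrite /Phi; case: ifPn => [nn|//].
have [_ pF _] := es_whe (Hest nn); have rn := r0 n.
case: j.1 => [[]|//].
- case: ifP => [/andP[h1 h2]|//].
  by apply: pF => /=; apply/andP; split; lra.
- case: ifP => [/andP[h1 h2]|//].
  by apply: pF => /=; apply/andP; split; lra.
Qed.

Lemma rho_ge k n : (M k <= n)%N -> k%:R + 1 <= rho n.
Proof. by move=> /HM[_ _ _]; rewrite -natr1. Qed.

Lemma rate_max_ge0 : 0 <= @rate_max R m.
Proof. by rewrite mulr_ge0 ?decay_const_ge0// addr_ge0 ?expR_ge0. Qed.

Lemma Phi_equi k e : 0 < e -> exists d K, 0 < d /\ forall n, (K <= n)%N ->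
  forall j s s' t t', lo k j <= s <= hi k j -> lo k j <= s' <= hi k j ->
     `|s - s'| <= d -> `|t - t'| <= d -> `|Phi n j s t - Phi n j s' t'| <= e.
Proof.
move=> e0; have rm := rate_max_ge0.
(* [de] is the averaging length in [es_equi], making its first term at most [e / 2]; then [d] makes
   the Lipschitz term at most [e / 2]. The bound [e / C] is for the rescaled means, which are
   [C]-Lipschitz. *)
pose de := Num.min 1 ((e / 4) ^+ 2 / (@rate_max R m + 1)).
have rm1 : 0 < @rate_max R m + 1 by lra.
have e4 : 0 < e / 4 by rewrite divr_gt0.
have de0 : 0 < de by rewrite lt_min ltr01 divr_gt0// exprn_gt0.
have de1 : de <= 1 by rewrite ge_min lexx.
have sq : Num.sqrt (de * @rate_max R m) <= e / 4.
  rewrite -[leRHS]ger0_norm ?(ltW e4)// -sqrtr_sqr ler_wsqrtr//.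
  apply: (@le_trans _ _ (de * (@rate_max R m + 1))).
    by rewrite ler_wpM2l ?(ltW de0)//; lra.
  by rewrite -ler_pdivlMr// ge_min lexx orbT.
have K0 : 0 < 2 * de^-1 + 1 by rewrite addr_gt0// mulr_gt0// invr_gt0.
pose d := Num.min (e / 4 / (2 * de^-1 + 1)) (e / C).
have d0 : 0 < d by rewrite lt_min !divr_gt0.
have dK : (2 * de^-1 + 1) * d <= e / 4.
  by rewrite mulrC -ler_pdivlMr// ge_min lexx.
have dC : C * d <= e by rewrite mulrC -ler_pdivlMr// ge_min lexx orbT.
(* From [M k] on, [rho n >= k + 1], so on the k-th windows of the two ends the cut-offs of [Phi] are
   inactive. *)
exists d, (M k); split => // n Mn j s s' t t'.
have [nn _ _ _ _] := HM Mn; have rk := rho_ge Mn; have rr := rhor n.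
have k0 : 0 <= k%:R :> R by [].
have FF i s1 s2 : - r n - 1 / 2 <= s1 <= r n + 1 / 2 -> - r n - 1 / 2 <= s2 <= r n + 1 / 2 ->
    `|s1 - s2| <= d -> `|t - t'| <= d -> `|F n i s1 t - F n i s2 t'| <= e.
  move=> s1I s2I sd td.
  apply: le_trans (es_equi (Hest nn) i t t' (_ : 0 < de <= 1) s1I s2I) _.
    by rewrite de0.
  have : (2 * de^-1 + 1) * (`|s1 - s2| + `|t - t'|) <= (2 * de^-1 + 1) * (d + d).
    by rewrite ler_wpM2l ?(ltW K0)// lerD.
  by rewrite mulrDr; lra.
rewrite /Phi nn /lo /hi; case: j => -[[]|] i /= sI s'I sd td.
- have h1 : - 1 / 2 <= s <= 2 * r n + 1 / 2 by lra.
  have h2 : - 1 / 2 <= s' <= 2 * r n + 1 / 2 by lra.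
  rewrite h1 h2; apply: FF => //; try lra.
  by have -> : s - r n - (s' - r n) = s - s' by ring.
- have h1 : - (2 * r n) - 1 / 2 <= s <= 1 / 2 by lra.
  have h2 : - (2 * r n) - 1 / 2 <= s' <= 1 / 2 by lra.
  rewrite h1 h2; apply: FF => //; try lra.
  by have -> : s + r n - (s' + r n) = s - s' by ring.
- have /andP[h1 h2] := center_itv n s; have /andP[h3 h4] := center_itv n s'.
  have rh := rho0 n.
  apply: le_trans (estimates_lip i (Hest nn) _ _) _; [apply/andP; split; lra..|].
  rewrite -mulrBr normrM gtr0_norm ?invr_gt0// mulrACA mulfV ?gt_eqF// mul1r.
  apply: le_trans dC; rewrite ler_wpM2l ?(ltW C0)//.
  by apply: le_trans sd; exact: clamp_lip (ltW (c0 n)).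
Qed.

Lemma ex_limit : exists (P : J -> R -> R -> R) (phi : nat -> nat),
  [/\ {homo phi : i j / (i < j)%N}, forall k, (M k <= phi k)%N &
  forall k j s t, lo k j <= s <= hi k j -> `|Phi (phi k) j s t - P j s t| <= q k].
Proof. exact: (subseq_loc_unif M Phi_bound Phi_periodic Phi_equi). Qed.

Lemma limit_data : exists (fm fp : fam) (v : 'I_N -> R -> R) (phi : nat -> nat),
  {homo phi : i j / (i < j)%N} /\ forall k, let n := phi k in
  [/\ (M k <= n)%N,
      forall i s t, - 1 / 2 <= s <= k%:R -> `|F n i (s - r n) t - fm i s t| <= q k,
      forall i s t, - k%:R <= s <= 1 / 2 -> `|F n i (s + r n) t - fp i s t| <= q k &
      forall i s, - l <= s <= l ->
        `|a n i ((eps n)^-1 * clamp (c n) s) - v i s| <= q k].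
Proof.
have [P [phi [hphi Mphi HP]]] := ex_limit.
exists (fun i => P (Some true, i)), (fun i => P (Some false, i)), (fun i s => P (None, i) s 0), phi.
split => // k n; have Mn : (M k <= n)%N := Mphi k.
have [nn _ _ _ _] := HM Mn; have rk := rho_ge Mn; have rr := rhor n.
split => //.
- move=> i s t sI; have := HP k (Some true, i) s t sI; rewrite /Phi -/n nn/=.
  by rewrite (_ : - 1 / 2 <= s <= 2 * r n + 1 / 2)//; lra.
- move=> i s t sI; have := HP k (Some false, i) s t sI; rewrite /Phi -/n nn/=.
  by rewrite (_ : - (2 * r n) - 1 / 2 <= s <= 1 / 2)//; lra.
- by move=> i s sI; have := HP k (None, i) s 0 sI; rewrite /Phi -/n nn/=.
Qed.

End Limit.

(** * Convergence of the ends and of the central cylinder *)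

Section Convergence.
Context {R : realType} {m : nat}.
Local Notation tau := (@conj_idx m).
Local Notation sg := (@conj_sg R m).
Local Notation fam := ('I_(m + m) -> R -> R -> R).
Local Notation E := 'rV[R]_(m + m).
Local Notation N := (m + m)%N.
Local Notation D := (@decay_const R N).

Variables (V_ : nat -> E -> E) (V : E -> E) (eps r rho : nat -> R)
  (u : nat -> R * R -> E) (l C : R)
  (F : nat -> fam) (a b : nat -> 'I_N -> R -> R) (fm fp : fam) (v : 'I_N -> R -> R).
Hypothesis eps0 : forall n, 0 < eps n.
Hypothesis rho0 : forall n, 0 < rho n.
Hypothesis rhor : forall n, rho n < r n.
Hypothesis C0 : 0 < C.
Hypothesis l0 : 0 <= l.
Hypothesis ub : forall n s t, - r n - 1 <= s <= r n + 1 -> unit_cball (u n (s, t)).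
Hypothesis Hest : forall n, estimates (r n) (eps n) C (V_ n) (u n) (F n) (a n) (b n).
Hypothesis VLip : forall n x y, unit_cball x -> unit_cball y ->
  \sum_i (V_ n x ord0 i - V_ n y ord0 i) ^+ 2 <= C ^+ 2 * \sum_i (x ord0 i - y ord0 i) ^+ 2.

Let c n := eps n * (r n - rho n).
Let q (k : nat) : R := k.+1%:R^-1.

(* Here all sequences are already restricted to the subsequence. *)
Hypothesis h_eps : forall k, eps k * C <= q k.
Hypothesis h_V : forall k x i, unit_cball x -> `|V_ k x ord0 i - V x ord0 i| <= q k.
Hypothesis h_VC : forall x i, unit_cball x -> `|V x ord0 i| <= C.
Hypothesis h_rho : forall k, k.+1%:R <= rho k.
Hypothesis h_er : forall k, eps k * rho k * C <= q k.
Hypothesis h_c : forall k, `|c k - l| <= q k.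
Hypothesis Hm : forall k i s t, - 1 / 2 <= s <= k%:R ->
  `|F k i (s - r k) t - fm i s t| <= q k.
Hypothesis Hp : forall k i s t, - k%:R <= s <= 1 / 2 ->
  `|F k i (s + r k) t - fp i s t| <= q k.
Hypothesis Hv : forall k i s, - l <= s <= l ->
  `|a k i ((eps k)^-1 * clamp (c k) s) - v i s| <= q k.

Let B : R := 2 * D.

Let c0 n : 0 < c n.
Proof. by rewrite mulr_gt0// subr_gt0. Qed.

Let rk k : k%:R + 1 <= rho k.
Proof. by rewrite natr1. Qed.

Let q0 k : 0 < q k.
Proof. exact: q_gt0. Qed.

Lemma u_ball k s t : - r k - 1 < s < r k + 1 -> unit_cball (u k (s, t)).
Proof. by move=> /andP[h1 h2]; apply: ub; rewrite !ltW. Qed.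

Lemma F_u k i s t : - r k - 1 < s < r k + 1 -> F k i s t = u k (s, t) ord0 i.
Proof. exact: (es_f (Hest k)). Qed.

Lemma rate_small k s (j : nat) x : j%:R <= x ->
  s - r k <= - x -> - r k - s <= - x -> @rate R m (r k) s <= B * q j.
Proof.
move=> jx h1 h2.
have D0 : 0 <= D := decay_const_ge0.
have ex := expRN_le_q jx.
rewrite /rate /B (_ : 2 * D * _ = D * (2 * q j)); last by ring.
rewrite ler_wpM2l//.
have : expR (s - r k) <= expR (- x) by rewrite ler_expR.
have : expR (- r k - s) <= expR (- x) by rewrite ler_expR.
by rewrite -/(q j) in ex *; lra.
Qed.

Lemma osc_small k i s t (j : nat) x : j%:R <= x -> - r k - 1 / 2 <= s <= r k + 1 / 2 ->
  s - r k <= - x -> - r k - s <= - x -> `|F k i s t - a k i s| <= wk B j.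
Proof.
move=> jx sI h1 h2; apply: abs_le_of_sqr; first exact: sqrtr_ge0.
have D0 : 0 <= D := decay_const_ge0.
have BB : 0 <= B * (j.+1%:R)^-1 by rewrite mulr_ge0 ?(ltW (q0 j))// mulr_ge0.
rewrite /wk sqr_sqrtr//; apply: le_trans (es_osc (Hest k) i t sI) _.
exact: rate_small jx h1 h2.
Qed.

(** Near [s0] the shifted maps solve the equation up to [eps k * C], which vanishes; [s0 + 1 <= k]
    puts the neighbourhood into the k-th window. *)
Lemma weakhol_m : weakhol tau sg [set s | - 1 / 2 < s] fm.
Proof.
have oA : open [set s : R | - 1 / 2 < s] by exact: open_gt.
apply: (weakhol_lim conj_sg2 oA) => s0 /= s0A.
exists (Num.min 1 (s0 + 1 / 2)).
have in_A s : `|s - s0| < Num.min 1 (s0 + 1 / 2) -> - 1 / 2 < s /\ s < s0 + 1.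
  by rewrite lt_min => /andP[]; rewrite !ltr_norml => /andP[? ?] /andP[? ?]; split; lra.
split.
- by rewrite lt_min ltr01; lra.
- by move=> s /in_A [].
- move=> e e0; have [K HK] := ex_q_le e0; have [K' HK'] := ex_nat_ge (s0 + 1).
  pose k := maxn K K'.
  have qe : q k <= e by apply: HK; exact: leq_maxl.
  have sk : s0 + 1 <= k%:R by apply: le_trans HK' _; rewrite ler_nat leq_maxr.
  exists (fun i s t => F k i (s - r k) t); split.
    apply: (whe_shift (c := - r k) (le_trans (h_eps k) qe) _ (es_whe (Hest k))).
    by move=> s /in_A [h1 h2] /=; have h3 := rk k; have h4 := rhor k; apply/andP; split; lra.
  move=> i s t /in_A [h1 h2]; apply: le_trans qe; apply: Hm.
  by apply/andP; split; lra.
Qed.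

Lemma weakhol_p : weakhol tau sg [set s | s < 1 / 2] fp.
Proof.
have oA : open [set s : R | s < 1 / 2] by exact: open_lt.
apply: (weakhol_lim conj_sg2 oA) => s0 /= s0A.
exists (Num.min 1 (1 / 2 - s0)).
have in_A s : `|s - s0| < Num.min 1 (1 / 2 - s0) -> s < 1 / 2 /\ s0 - 1 < s.
  by rewrite lt_min => /andP[]; rewrite !ltr_norml => /andP[? ?] /andP[? ?]; split; lra.
split.
- by rewrite lt_min ltr01; lra.
- by move=> s /in_A [].
- move=> e e0; have [K HK] := ex_q_le e0; have [K' HK'] := ex_nat_ge (1 - s0).
  pose k := maxn K K'.
  have qe : q k <= e by apply: HK; exact: leq_maxl.
  have sk : 1 - s0 <= k%:R by apply: le_trans HK' _; rewrite ler_nat leq_maxr.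
  exists (fun i s t => F k i (s + r k) t); split.
    apply: (whe_shift (c := r k) (le_trans (h_eps k) qe) _ (es_whe (Hest k))).
    by move=> s /in_A [h1 h2] /=; have h3 := rk k; have h4 := rhor k; apply/andP; split; lra.
  move=> i s t /in_A [h1 h2]; apply: le_trans qe; apply: Hp.
  by apply/andP; split; lra.
Qed.

Lemma ball_m s t : - 1 / 2 <= s -> unit_cball (row_of fm (s, t)).
Proof.
move=> s1; apply: ball_limit => e e0.
have [K HK] := ex_q_le e0; have [K' HK'] := ex_nat_ge s.
pose k := maxn K K'.
have qe : q k <= e by apply: HK; exact: leq_maxl.
have sk : s <= k%:R by apply: le_trans HK' _; rewrite ler_nat leq_maxr.
have sI : - r k - 1 < s - r k < r k + 1.
  by have := rk k; have := rhor k; move=> ? ?; apply/andP; split; lra.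
exists (u k (s - r k, t)) => [|i]; first exact: u_ball.
rewrite mxE /= distrC -F_u//; apply: le_trans qe; apply: Hm.
by rewrite s1.
Qed.

Lemma ball_p s t : s <= 1 / 2 -> unit_cball (row_of fp (s, t)).
Proof.
move=> s1; apply: ball_limit => e e0.
have [K HK] := ex_q_le e0; have [K' HK'] := ex_nat_ge (- s).
pose k := maxn K K'.
have qe : q k <= e by apply: HK; exact: leq_maxl.
have sk : - s <= k%:R by apply: le_trans HK' _; rewrite ler_nat leq_maxr.
have sI : - r k - 1 < s + r k < r k + 1.
  by have := rk k; have := rhor k; move=> ? ?; apply/andP; split; lra.
exists (u k (s + r k, t)) => [|i]; first exact: u_ball.
rewrite mxE /= distrC -F_u//; apply: le_trans qe; apply: Hp.
by rewrite s1 andbT; lra.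
Qed.

Lemma holomorphic_m : holomorphic_cylinder `[0, +oo[ (row_of fm).
Proof.
have oA : open [set s : R | - 1 / 2 < s] by exact: open_gt.
apply: (weakhol_holomorphic oA _ _ weakhol_m).
- by move=> s /=; rewrite in_itv/= andbT => s1; lra.
- apply: (closure_strip (J := `]0, +oo[%classic)); first exact: interval_open.
    by move=> s /=; rewrite !in_itv/= !andbT; exact: ltW.
  move=> s e /=; rewrite in_itv/= andbT => s1 e1; exists (s + e / 2).
  rewrite /= in_itv/= andbT; split; first by lra.
  by rewrite ltr_norml; apply/andP; split; lra.
- by move=> s t /=; rewrite in_itv/= andbT => s1; apply: ball_m; lra.
Qed.

Lemma holomorphic_p : holomorphic_cylinder `]-oo, 0] (row_of fp).
Proof.
have oA : open [set s : R | s < 1 / 2] by exact: open_lt.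
apply: (weakhol_holomorphic oA _ _ weakhol_p).
- by move=> s /=; rewrite in_itv/= => s1; lra.
- apply: (closure_strip (J := `]-oo, 0[%classic)); first exact: interval_open.
    by move=> s /=; rewrite !in_itv/=; exact: ltW.
  move=> s e /=; rewrite in_itv/= => s1 e1; exists (s - e / 2).
  rewrite /= in_itv/=; split; first by lra.
  by rewrite ltr_norml; apply/andP; split; lra.
- by move=> s t /=; rewrite in_itv/= => s1; apply: ball_p; lra.
Qed.

Lemma center_rescaled k s : - (r k - rho k) <= (eps k)^-1 * clamp (c k) s <= r k - rho k.
Proof.
have /andP[h1 h2] := clamp_itv s (ltW (c0 k)).
by rewrite mulrC ler_pdivrMr// ler_pdivlMr// mulNr ![_ * eps k]mulrC h1 h2.
Qed.

Lemma a_rescaled_lip k i x x' : - c k <= x <= c k -> - c k <= x' <= c k ->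
  `|a k i ((eps k)^-1 * x) - a k i ((eps k)^-1 * x')| <= C * `|x - x'|.
Proof.
move=> xI x'I.
have := center_rescaled k x; have := center_rescaled k x'.
rewrite (clamp_id xI) (clamp_id x'I) => /andP[h1 h2] /andP[h3 h4]; have h5 := rho0 k.
apply: le_trans (estimates_lip i (Hest k) _ _) _; [apply/andP; split; lra..|].
rewrite -mulrBr normrM gtr0_norm ?invr_gt0// mulrACA mulfV ?gt_eqF// mul1r.
by [].
Qed.

Lemma cE k : (eps k)^-1 * c k = r k - rho k.
Proof. by rewrite /c mulrA mulVf ?mul1r// gt_eqF. Qed.

Lemma triangle3 (x y z w e1 e2 e3 : R) : `|x - y| <= e1 -> `|y - z| <= e2 ->
  `|z - w| <= e3 -> `|x - w| <= e1 + e2 + e3.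
Proof.
by rewrite !ler_norml => /andP[? ?] /andP[? ?] /andP[? ?]; apply/andP; split; lra.
Qed.

(** Over an end the mean moves by at most [eps * rho * C]. At the junction [s'] with the central
    cylinder it is a rescaled mean, [C]-Lipschitz, and is compared with its value at the clamped
    point of [sl], where [Hv] applies. *)
Lemma a_end k i (s s' : R) : - r k - 1 < s < r k + 1 -> `|s - (eps k)^-1 * s'| <= rho k ->
  (s' = - c k \/ s' = c k) -> forall sl, sl = - l \/ sl = l -> `|s' - sl| <= q k ->
  `|a k i s - v i sl| <= (2 + C) * q k.
Proof.
move=> sI ss' s'c sl slE ssl.
have s'I : - c k <= s' <= c k by have := c0 k; case: s'c => -> ?; apply/andP; split; lra.
have ll : - l <= l by rewrite (le_trans _ l0)// oppr_le0.
have slI : - l <= sl <= l by case: slE => ->; rewrite lexx ll.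
have s'r : - r k - 1 < (eps k)^-1 * s' < r k + 1.
  have := center_rescaled k s'; rewrite (clamp_id s'I) => /andP[h1 h2].
  by have h5 := rho0 k; apply/andP; split; lra.
have h1 : `|a k i s - a k i ((eps k)^-1 * s')| <= q k.
  apply: le_trans (estimates_lip i (Hest k) sI s'r) _; apply: le_trans (h_er k).
  by rewrite mulrAC ler_wpM2r ?(ltW C0)// ler_wpM2l// ltW.
have h2 : `|a k i ((eps k)^-1 * s') - a k i ((eps k)^-1 * clamp (c k) sl)| <= C * q k.
  apply: le_trans (a_rescaled_lip i s'I (clamp_itv sl (ltW (c0 k)))) _.
  rewrite ler_wpM2l ?(ltW C0)//; apply: le_trans ssl.
  by rewrite -[X in `|X - _|](clamp_id s'I); exact: clamp_lip (ltW (c0 k)).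
have h3 := Hv k i slI.
by apply: le_trans (triangle3 h1 h2 h3) _; lra.
Qed.

Lemma a_left k i s : 0 <= s <= rho k -> `|a k i (s - r k) - v i (- l)| <= (2 + C) * q k.
Proof.
move=> /andP[s1 s2]; have h1 := rho0 k; have h2 := rhor k.
apply: (a_end i (s' := - c k)).
- by apply/andP; split; lra.
- by rewrite mulrN cE ler_norml; apply/andP; split; lra.
- by left.
- by left.
- by rewrite opprK addrC distrC; exact: h_c.
Qed.

Lemma a_right k i s : - rho k <= s <= 0 -> `|a k i (s + r k) - v i l| <= (2 + C) * q k.
Proof.
move=> /andP[s1 s2]; have h1 := rho0 k; have h2 := rhor k.
apply: (a_end i (s' := c k)).
- by apply/andP; split; lra.
- by rewrite cE ler_norml; apply/andP; split; lra.
- by right.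
- by right.
- exact: h_c.
Qed.

Lemma osc_left k i s t (j : nat) : j%:R <= s -> s <= rho k ->
  `|F k i (s - r k) t - a k i (s - r k)| <= wk B j.
Proof.
move=> js sr; have h1 := rho0 k; have h2 := rhor k.
have j0 : 0 <= j%:R :> R by [].
by apply: (osc_small i t js); try lra; apply/andP; split; lra.
Qed.

Lemma osc_right k i s t (j : nat) : j%:R <= - s -> - s <= rho k ->
  `|F k i (s + r k) t - a k i (s + r k)| <= wk B j.
Proof.
move=> js sr; have h1 := rho0 k; have h2 := rhor k.
have j0 : 0 <= j%:R :> R by [].
by apply: (osc_small i t js); try lra; apply/andP; split; lra.
Qed.

(** At fixed s let k tend to infinity: [fm] is near u_k, which is within [wk B j] of its mean for
    all large k, and the mean is near [v (- l)]. This identifies x_- with the left end of the flow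
    line. *)
Lemma fm_end i s t (j : nat) : j%:R <= s -> `|fm i s t - v i (- l)| <= wk B j.
Proof.
move=> js; have j0 : 0 <= j%:R :> R by [].
have [K HK] := ex_nat_ge s.
apply: (@le_of_small _ _ _ (3 + C) 0 0 K) => k Kk.
have sk : s <= k%:R by apply: le_trans HK _; rewrite ler_nat.
have h1 : `|fm i s t - F k i (s - r k) t| <= q k.
  by rewrite distrC; apply: Hm; apply/andP; split; lra.
have srho : s <= rho k by have := rk k; lra.
have h2 := osc_left i t js srho.
have h3 : `|a k i (s - r k) - v i (- l)| <= (2 + C) * q k by apply: a_left; apply/andP; split; lra.
have := triangle3 h1 h2 h3; rewrite -/(q k) => h; apply: le_trans h _.
by rewrite mul0r; lra.
Qed.

Lemma fp_end i s t (j : nat) : j%:R <= - s -> `|fp i s t - v i l| <= wk B j.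
Proof.
move=> js; have j0 : 0 <= j%:R :> R by [].
have [K HK] := ex_nat_ge (- s).
apply: (@le_of_small _ _ _ (3 + C) 0 0 K) => k Kk.
have sk : - s <= k%:R by apply: le_trans HK _; rewrite ler_nat.
have h1 : `|fp i s t - F k i (s + r k) t| <= q k.
  by rewrite distrC; apply: Hp; apply/andP; split; lra.
have srho : - s <= rho k by have := rk k; lra.
have h2 := osc_right i t js srho.
have h3 : `|a k i (s + r k) - v i l| <= (2 + C) * q k by apply: a_right; apply/andP; split; lra.
have := triangle3 h1 h2 h3; rewrite -/(q k) => h; apply: le_trans h _.
by rewrite mul0r; lra.
Qed.

Definition err k : R := (3 + C) * q k + 2 * wk B k.

Lemma err_ge0 k : 0 <= err k.
Proof.
have := q0 k; have := sqrtr_ge0 (B * (k.+1%:R)^-1); rewrite -/(wk B k) => h1 h2.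
by have C1 := C0; rewrite /err addr_ge0// mulr_ge0//; lra.
Qed.

(** Up to s = k this is locally uniform convergence. Beyond, u_k is close to its mean and [fm] to
    [v (- l)], each up to [wk B k], and [a_left] compares these two: convergence is uniform although
    [rho k] may far exceed the window. *)
Lemma left_bound k i s t : 0 <= s <= rho k ->
  `|u k (s - r k, t) ord0 i - fm i s t| <= err k.
Proof.
move=> sI; have /andP[s1 s2] := sI; have h1 := rho0 k; have h2 := rhor k.
have qk := q0 k; have w0 : 0 <= wk B k by exact: sqrtr_ge0.
have Cq : 0 <= C * q k by apply: mulr_ge0; apply: ltW.
rewrite -F_u; last by apply/andP; split; lra.
have [sk|ks] := leP s k%:R.
  apply: le_trans (Hm i t (_ : - 1 / 2 <= s <= k%:R)) _; first by apply/andP; split; lra.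
  by rewrite /err; lra.
have := triangle3 (osc_left i t (ltW ks) s2) (a_left i sI).
move=> /(_ (fm i s t) (wk B k)); rewrite distrC => /(_ (fm_end i t (ltW ks))) h.
by apply: le_trans h _; rewrite /err; lra.
Qed.

Lemma right_bound k i s t : - rho k <= s <= 0 ->
  `|u k (s + r k, t) ord0 i - fp i s t| <= err k.
Proof.
move=> sI; have /andP[s1 s2] := sI; have h1 := rho0 k; have h2 := rhor k.
have qk := q0 k; have w0 : 0 <= wk B k by exact: sqrtr_ge0.
have Cq : 0 <= C * q k by apply: mulr_ge0; apply: ltW.
rewrite -F_u; last by apply/andP; split; lra.
have [sk|ks] := leP (- s) k%:R.
  apply: le_trans (Hp i t (_ : - k%:R <= s <= 1 / 2)) _; first by apply/andP; split; lra.
  by rewrite /err; lra.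
have s3 : - s <= rho k by lra.
have := triangle3 (osc_right i t (ltW ks) s3) (a_right i sI).
move=> /(_ (fp i s t) (wk B k)); rewrite distrC => /(_ (fp_end i t (ltW ks))) h.
by apply: le_trans h _; rewrite /err; lra.
Qed.

Lemma osc_center k i s t : - (r k - rho k) <= s <= r k - rho k ->
  `|F k i s t - a k i s| <= wk B k.
Proof.
move=> /andP[s1 s2]; have h1 := rho0 k; have h2 := rhor k; have h3 := rk k.
by apply: (osc_small i t (x := rho k)); try lra; apply/andP; split; lra.
Qed.

Lemma center_bound k i s t : - c k <= s <= c k -> - l <= s <= l ->
  `|u k ((eps k)^-1 * s, t) ord0 i - v i s| <= err k.
Proof.
move=> sc sl; have qk := q0 k; have w0 : 0 <= wk B k by exact: sqrtr_ge0.
have Cq : 0 <= C * q k by apply: mulr_ge0; apply: ltW.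
have sI := center_rescaled k s; have := Hv k i sl.
rewrite clamp_id// in sI * => h3; have h1 := rho0 k; have /andP[s1 s2] := sI.
rewrite -F_u; last by apply/andP; split; lra.
have := triangle3 (osc_center i t sI) h3 (_ : `|v i s - v i s| <= 0).
rewrite subrr normr0 => /(_ (lexx _)) h.
by apply: le_trans h _; rewrite /err; lra.
Qed.

Definition vrow s : E := \row_i v i s.

Lemma vrow_ball s : - l <= s <= l -> unit_cball (vrow s).
Proof.
move=> sl; apply: ball_limit => e e0.
have : q k + wk B k @[k --> \oo] --> (0 : R).
  have := @small_cvg R 1 1 B; under eq_fun do rewrite !mul1r.
  by [].
move=> /cvgrPdist_le /(_ e e0) [k _ /(_ k (leqnn k))]; rewrite /= sub0r normrN => h.
have qk := q0 k; have w0 : 0 <= wk B k by exact: sqrtr_ge0.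
have {}h : q k + wk B k <= e by apply: le_trans (ler_norm _) h.
have sI := center_rescaled k s; have h1 := rho0 k; have /andP[s1 s2] := sI.
have s3 : - r k - 1 < (eps k)^-1 * clamp (c k) s < r k + 1 by apply/andP; split; lra.
exists (u k ((eps k)^-1 * clamp (c k) s, 0)) => [|i]; first exact: u_ball.
rewrite mxE distrC -F_u//; have h3 := Hv k i sl.
have := triangle3 (osc_center i 0 sI) h3 (_ : `|v i s - v i s| <= 0).
rewrite subrr normr0 => /(_ (lexx _)) h4.
by apply: le_trans h4 _; lra.
Qed.

Lemma removable_m : removable_singularity (row_of fm) +oo (vrow (- l)).
Proof.
apply: removable_of_bound; first by apply: vrow_ball; rewrite lexx (le_trans _ l0)// oppr_le0.
move=> e e0; have /cvgrPdist_le /(_ e e0) [j _ /(_ j (leqnn j))] := @wk_cvg R B.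
rewrite /= sub0r normrN => h.
near=> s => t i; rewrite !mxE /=; apply: le_trans (fm_end i t (j := j) _) _.
  by near: s; exact: nbhs_pinfty_ge.
exact: le_trans (ler_norm _) h.
Unshelve. all: by end_near. Qed.

Lemma removable_p : removable_singularity (row_of fp) -oo (vrow l).
Proof.
apply: removable_of_bound; first by apply: vrow_ball; rewrite lexx andbT (le_trans _ l0)// oppr_le0.
move=> e e0; have /cvgrPdist_le /(_ e e0) [j _ /(_ j (leqnn j))] := @wk_cvg R B.
rewrite /= sub0r normrN => h.
near=> s => t i; rewrite !mxE /=; apply: le_trans (fp_end i t (j := j) _) _.
  by rewrite lerNr; near: s; exact: nbhs_ninfty_le.
exact: le_trans (ler_norm _) h.
Unshelve. all: by end_near. Qed.

(** A second-order estimate yields interior and one-sided derivatives alike. The increment of the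
    rescaled mean is its derivative at an intermediate point times the length; up to vanishing
    errors this derivative is V at a point within [C * d] of [vrow s], hence the quadratic term. *)
Lemma flow_estimate i s s' : - l <= s <= l -> - l <= s' <= l ->
  `|v i s' - v i s - (s' - s) * V (vrow s) ord0 i| <=
  C ^+ 2 * N%:R * `|s' - s| ^+ 2.
Proof.
move=> sl s'l; set d := `|s' - s|; have d0 : 0 <= d by exact: normr_ge0.
have vb := vrow_ball sl.
(* The two coefficients collect all terms in [q k] and [wk B k], so that the final comparison is an
   identity. *)
apply: (@le_of_small _ _ _ (2 + 2 * C + d * (C * N%:R + 1)) (3 * C * N%:R * d) B 0) => k _.
rewrite -/(q k); have qk := q0 k; have w0 : 0 <= wk B k by exact: sqrtr_ge0.
set x := clamp (c k) s; set x' := clamp (c k) s'.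
have ck := ltW (c0 k); have xI := clamp_itv s ck; have x'I := clamp_itv s' ck.
have xx' : `|x' - x| <= d by exact: clamp_lip.
have xs : `|x - s| <= q k by apply: le_trans (clamp_close ck sl) (h_c k).
have xs' : `|x' - s'| <= q k by apply: le_trans (clamp_close ck s'l) (h_c k).
have e1 := Hv k i sl; have e2 := Hv k i s'l.
rewrite -/x in e1; rewrite -/x' in e2.
have e10 := rho0 k.
pose al y := a k i ((eps k)^-1 * y).
pose be y := (eps k)^-1 * b k i ((eps k)^-1 * y).
have IS y : Num.min x x' <= y <= Num.max x x' -> - c k <= y <= c k.
  by move=> /between_itv; apply.
have IS' y : - c k <= y <= c k -> - (r k - rho k) <= (eps k)^-1 * y <= r k - rho k.
  by move=> yI; have := center_rescaled k y; rewrite clamp_id.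
have dal (y : R) : Num.min x x' <= y <= Num.max x x' -> is_derive y 1 al (be y).
  move=> /IS /IS' /andP[h1 h2].
  have := @is_derive_comp_affine _ (a k i) (b k i ((eps k)^-1 * y)) 0 (eps k)^-1 y.
  rewrite add0r; have -> : (fun y => a k i (0 + (eps k)^-1 * y)) = al.
    by apply/funext => z; rewrite add0r.
  by apply; apply: (es_da (Hest k) i); apply/andP; split; lra.
have [y yb Ey] := mvt_sym dal.
have yI := IS y yb; have /andP[y1 y2] := IS' y yI.
have ybl : - r k - 1 < (eps k)^-1 * y < r k + 1 by apply/andP; split; lra.
set z := u k ((eps k)^-1 * y, 0); have zb : unit_cball z by exact: u_ball.
have yx : `|y - x| <= d.
  by apply: le_trans xx'; exact: between_dist.
have zv j : `|z ord0 j - vrow s ord0 j| <= wk B k + C * d + q k.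
  rewrite mxE; apply: (triangle3 (y := a k j ((eps k)^-1 * y)) (z := a k j ((eps k)^-1 * x))).
  - by rewrite /z -F_u//; apply: osc_center; apply/andP; split.
  - apply: le_trans (a_rescaled_lip j yI xI) _.
    by rewrite ler_wpM2l ?(ltW C0).
  - exact: Hv.
have V1 : `|V_ k z ord0 i - V_ k (vrow s) ord0 i| <= C * (N%:R * (wk B k + C * d + q k)).
  have Cd : 0 <= C * d by rewrite mulr_ge0// ltW.
  have eta0 : 0 <= wk B k + C * d + q k by lra.
  apply: abs_le_of_sqr; first by rewrite !mulr_ge0// ltW.
  apply: (@le_trans _ _ (\sum_j (V_ k z ord0 j - V_ k (vrow s) ord0 j) ^+ 2)).
    by rewrite (bigD1 i)//= lerDl; apply: sumr_ge0 => j _; exact: sqr_ge0.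
  apply: le_trans (VLip k zb vb) _; rewrite [leRHS]exprMn ler_wpM2l ?sqr_ge0//.
  apply: (@le_trans _ _ (\sum_(j < N) (wk B k + C * d + q k) ^+ 2)).
    by apply: ler_sum => j _; rewrite -real_normK ?num_real// ler_sqr ?nnegrE.
  rewrite sumr_const card_ord -[X in X <= _]mulr_natl exprMn ler_wpM2r ?sqr_ge0//.
  by rewrite -natrX ler_nat; case: (N) => // j; rewrite expnS leq_pmulr// expn_gt0.
have V2 : `|V_ k (vrow s) ord0 i - V (vrow s) ord0 i| <= q k by exact: h_V.
have V3 : `|be y - V_ k z ord0 i| <= C * (2 * N%:R * wk B k).
  have ei : 0 < (eps k)^-1 by rewrite invr_gt0.
  have yI2 : - r k - 1 / 2 <= (eps k)^-1 * y <= r k + 1 / 2 by apply/andP; split; lra.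
  have := es_bV (Hest k) i 0 yI2; rewrite -/z => h.
  have -> : be y - V_ k z ord0 i = (eps k)^-1 * (b k i ((eps k)^-1 * y) - eps k * V_ k z ord0 i).
    by rewrite mulrBr mulKf// gt_eqF.
  rewrite normrM gtr0_norm//; apply: le_trans (ler_wpM2l (ltW ei) h) _.
  rewrite -mulrA mulKf ?gt_eqF// ler_wpM2l ?(ltW C0)//.
  have rs : @rate R m (r k) ((eps k)^-1 * y) <= B * q k.
    by apply: (@rate_small _ _ k (rho k)); have h3 := rk k; have h4 := rhor k; lra.
  have -> : 2 * N%:R * wk B k = Num.sqrt ((2 * N%:R) ^+ 2 * (B * q k)).
    by rewrite sqrtrM ?sqr_ge0// sqrtr_sqr ger0_norm// mulr_ge0.
  rewrite ler_wsqrtr//.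
  apply: (@le_trans _ _ (4 * N%:R * (B * q k))); first by rewrite ler_wpM2l// mulr_ge0.
  rewrite ler_wpM2r//; first by rewrite !mulr_ge0 ?decay_const_ge0 ?(ltW qk).
  rewrite exprMn -natrX ler_wpM2l// -natrX ler_nat.
  by case: (N) => // j; rewrite expnS leq_pmulr// expn_gt0.
have VC : `|V (vrow s) ord0 i| <= C by exact: h_VC.
have T : `|be y - V (vrow s) ord0 i| <=
    C * (2 * N%:R * wk B k) + C * (N%:R * (wk B k + C * d + q k)) + q k.
  exact: triangle3 V3 V1 V2.
have Eal : al x' - al x = be y * (x' - x) by exact: Ey.
(* The first two terms replace [v] by the mean at the clamped points, the third replaces its
   derivative by V at [vrow s], and the last undoes the clamping of the length. *)
have -> : v i s' - v i s - (s' - s) * V (vrow s) ord0 i =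
   - (al x' - v i s') + (al x - v i s) + (be y - V (vrow s) ord0 i) * (x' - x)
   + ((x' - s') - (x - s)) * V (vrow s) ord0 i.
  have -> : (be y - V (vrow s) ord0 i) * (x' - x) = (al x' - al x) - V (vrow s) ord0 i * (x' - x).
    by rewrite Eal; ring.
  by ring.
set W := V (vrow s) ord0 i in VC T *.
have P1 : `|(be y - W) * (x' - x)| <=
   (C * (2 * N%:R * wk B k) + C * (N%:R * (wk B k + C * d + q k)) + q k) * d.
  by rewrite normrM; apply: ler_pM.
have P2 : `|((x' - s') - (x - s)) * W| <= (q k + q k) * C.
  rewrite normrM; apply: ler_pM => //.
  by apply: le_trans (ler_normB _ _) _; apply: lerD.
apply: le_trans (ler_normD _ _) _.
apply: le_trans (lerD (ler_normD _ _) P2) _.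
apply: le_trans (lerD (lerD (ler_normD _ _) P1) (lexx _)) _.
rewrite normrN; apply: le_trans (lerD (lerD (lerD e2 e1) (lexx _)) (lexx _)) _.
by rewrite le_eqVlt; apply/orP; left; apply/eqP; ring.
Qed.

Lemma flow_line_v : flow_line V l (vrow (- l)) (vrow l) vrow.
Proof.
split => // s; rewrite /= in_itv/=; first exact: vrow_ball.
move=> sl; rewrite /is_derive_within; apply: cvg_row => i.
apply/cvgrPdist_le => e e0.
pose K : R := C ^+ 2 * N%:R + 1.
have K0 : 0 < K by rewrite ltr_wpDl// mulr_ge0// sqr_ge0.
rewrite near_withinE /dnbhs near_withinE; near=> h => h0 sh.
rewrite /= in_itv/= in sh.
have hK : `|h| <= e / K.
  near: h; apply/nbhs_ballP; exists (e / K) => /=; first by rewrite divr_gt0.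
  by move=> h; rewrite /ball/= sub0r normrN => /ltW.
have est := flow_estimate i sl sh.
have hh : 0 < `|h| by rewrite normr_gt0.
rewrite !mxE -(ler_pM2r hh) -normrM.
have -> : (V (vrow s) ord0 i - h^-1 * (v i (s + h) - v i s)) * h =
    - (v i (s + h) - v i s - (s + h - s) * V (vrow s) ord0 i).
  rewrite mulrBl mulrAC mulVf// mul1r; ring.
rewrite normrN; apply: le_trans est _.
have -> : s + h - s = h by ring.
rewrite expr2 mulrA ler_wpM2r ?(ltW hh)//.
apply: (@le_trans _ _ (K * `|h|)); first by rewrite ler_wpM2r// /K; lra.
by rewrite mulrC -ler_pdivlMr.
Unshelve. all: by end_near. Qed.

Lemma err_cvg : err k @[k --> \oo] --> (0 : R).
Proof. exact: small_cvg. Qed.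

Lemma cvge_of_bound (x : nat -> \bar R) (K : R) : (forall k, 0 <= x k)%E ->
  (forall k, x k <= (K * err k)%:E)%E -> x k @[k --> \oo] --> 0%E.
Proof.
move=> x0 xK.
have h1 : \forall k \near \oo, (0 <= x k <= (K * err k)%:E)%E.
  by near=> k; rewrite x0 xK.
have h2 : K * err k @[k --> \oo] --> (0 : R).
  by rewrite -[X in _ --> X](mulr0 K); apply: cvgM; [exact: cvg_cst|exact: err_cvg].
have h3 : (K * err k)%:E @[k --> \oo] --> (0 : R)%:E.
  by apply: cvg_EFin => //; near=> k.
exact: (squeeze_cvge h1 (cvg_cst _) h3).
Unshelve. all: by end_near. Qed.

Lemma convergence_summary :
  [/\ holomorphic_cylinder `[0, +oo[ (row_of fm) /\
        removable_singularity (row_of fm) +oo (vrow (- l)),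
      holomorphic_cylinder `]-oo, 0] (row_of fp) /\
        removable_singularity (row_of fp) -oo (vrow l),
      (let dm k := sup_dist (strip `[0, rho k])
         (fun p => u k (p.1 - r k, p.2)) (row_of fm) in
       let dp k := sup_dist (strip `[- rho k, 0])
         (fun p => u k (p.1 + r k, p.2)) (row_of fp) in
       (dm k + dp k)%E @[k --> \oo] --> 0%E),
      flow_line V l (vrow (- l)) (vrow l) vrow &
      sup_dist (strip (`[- c k, c k] `&` `[- l, l]))
        (fun p => u k ((eps k)^-1 * p.1, (eps k)^-1 * p.2)) (fun p => vrow p.1)
        @[k --> \oo] --> 0%E].
Proof.
split.
- by split; [exact: holomorphic_m|exact: removable_m].
- by split; [exact: holomorphic_p|exact: removable_p].
- apply: (cvge_of_bound (K := N%:R + N%:R)) => k.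
    apply: adde_ge0.
      by apply: (@sup_dist_ge0 _ _ _ _ _ _ (0, 0)); split; rewrite //= in_itv/= lexx ltW.
    apply: (@sup_dist_ge0 _ _ _ _ _ _ (0, 0)); split; rewrite //= in_itv/= lexx andbT.
    by rewrite oppr_le0 ltW.
  rewrite mulrDl EFinD; apply: leeD; apply: sup_dist_le; try exact: err_ge0.
    move=> [s t] i [/= sI _]; rewrite in_itv/= in sI.
    by rewrite [row_of _ _ _ _]mxE; exact: left_bound.
  move=> [s t] i [/= sI _]; rewrite in_itv/= in sI.
  by rewrite [row_of _ _ _ _]mxE; exact: right_bound.
- exact: flow_line_v.
- apply: (cvge_of_bound (K := N%:R)) => k.
    apply: (@sup_dist_ge0 _ _ _ _ _ _ (0, 0)); split=> //=; split; rewrite /= in_itv/=.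
      by rewrite oppr_le0 ltW.
    by rewrite oppr_le0 l0.
  apply: sup_dist_le; first exact: err_ge0.
  move=> [s t] i [/= [sc sl] _]; rewrite /= in_itv/= in sc; rewrite /= in_itv/= in sl.
  by rewrite [vrow _ _ _]mxE; exact: center_bound.
Qed.

End Convergence.

(** * Choice of the length of the ends *)

Section Scales.
Context {R : realType}.
Variables (eps r : nat -> R) (l : R).
Hypothesis eps0 : forall n, 0 < eps n.
Hypothesis eps_cvg : eps n @[n --> \oo] --> (0 : R).
Hypothesis r0 : forall n, 0 < r n.
Hypothesis l0 : 0 <= l.
Hypothesis er_cvg : eps n * r n @[n --> \oo] --> l.
Hypothesis r_cvg : l = 0 -> r n @[n --> \oo] --> +oo.

(** [r n / 2] keeps the ends shorter than the cylinder; the other bound tends to infinity and gives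
    [eps * rho <= sqrt eps], which tends to 0. *)
Definition width n := Num.min (r n / 2) (Num.sqrt (eps n))^-1.

(** For [l > 0] this is forced: [eps * r] eventually exceeds [l / 2] while [eps] tends to 0. *)
Lemma length_cvg : r n @[n --> \oo] --> +oo.
Proof.
have [l_eq|l_neq] := eqVneq l 0; first exact: r_cvg.
have lp : 0 < l by rewrite lt_neqAle eq_sym l_neq.
apply/cvgryPge => A.
near=> n.
have h1 : l / 2 < eps n * r n.
  by near: n; apply: (cvgr_gt _ er_cvg); lra.
have h2 : eps n < l / 2 / (`|A| + 1).
  near: n; apply: (cvgr_lt _ eps_cvg).
  by rewrite !divr_gt0// ltr_wpDl.
have A1 : 0 < `|A| + 1 by rewrite ltr_wpDl.
move: h2; rewrite ltr_pdivlMr// => h2.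
have : eps n * (`|A| + 1) < eps n * r n by lra.
rewrite ltr_pM2l// => h3; have := ler_norm A; lra.
Unshelve. all: by end_near. Qed.

Lemma width_gt0 n : 0 < width n.
Proof. by rewrite lt_min divr_gt0//= invr_gt0 sqrtr_gt0. Qed.

Lemma width_lt n : width n < r n.
Proof. by rewrite gt_min; apply/orP; left; have := r0 n; lra. Qed.

Lemma width_cvg : width n @[n --> \oo] --> +oo.
Proof.
apply/cvgryPge => A; near=> n.
have rA : 2 * A <= r n by near: n; move/cvgryPge: length_cvg; exact.
have A1 : 0 < `|A| + 1 by rewrite ltr_wpDl.
have h : eps n < (`|A| + 1)^-1 ^+ 2.
  by near: n; apply: (cvgr_lt _ eps_cvg); rewrite exprn_gt0// invr_gt0.
rewrite le_min; apply/andP; split; first by lra.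
apply: (@le_trans _ _ (`|A| + 1)); first by rewrite ler_wpDr// ler_norm.
rewrite -[leLHS]invrK lef_pV2 ?posrE ?invr_gt0 ?sqrtr_gt0//.
rewrite -[leRHS]ger0_norm ?invr_ge0 ?(ltW A1)// -sqrtr_sqr.
by rewrite ler_wsqrtr// ltW.
Unshelve. all: by end_near. Qed.

Lemma eps_width_cvg : eps n * width n @[n --> \oo] --> (0 : R).
Proof.
apply/cvgr0Pnorm_le => e e0; near=> n.
have h : eps n < e ^+ 2.
  by near: n; apply: (cvgr_lt _ eps_cvg); rewrite exprn_gt0.
rewrite ger0_norm ?mulr_ge0 ?(ltW (eps0 n)) ?(ltW (width_gt0 n))//.
have s0 : 0 < Num.sqrt (eps n) by rewrite sqrtr_gt0.
apply: (@le_trans _ _ (eps n * (Num.sqrt (eps n))^-1)).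
  by rewrite ler_wpM2l ?(ltW (eps0 n))// ge_min lexx orbT.
rewrite -[X in X * _](@sqr_sqrtr _ (eps n)) ?(ltW (eps0 n))// expr2 mulfK ?gt_eqF//.
by rewrite -[leRHS]gtr0_norm// -sqrtr_sqr ler_wsqrtr// ltW.
Unshelve. all: by end_near. Qed.

Lemma scales_near (C e : R) (k : nat) : 0 < C -> 0 < e ->
  \forall n \near \oo, [/\ eps n * C <= e, k%:R <= width n,
    eps n * width n * C <= e & `|eps n * (r n - width n) - l| <= e].
Proof.
move=> C0 e0; near=> n; split.
- rewrite -ler_pdivlMr//; near: n.
  by apply: (cvgr_le _ eps_cvg); exact: divr_gt0.
- by near: n; move/cvgryPge: width_cvg; exact.
- rewrite -ler_pdivlMr//; near: n.
  by apply: (cvgr_le _ eps_width_cvg); exact: divr_gt0.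
- rewrite distrC; near: n; apply: cvgr_dist_le => //.
  rewrite (_ : (fun n => _) = (fun n => eps n * r n - eps n * width n)).
    by rewrite -[X in _ --> X]subr0; apply: cvgB; [exact: er_cvg|exact: eps_width_cvg].
  by apply/funext => k'; rewrite mulrBr.
Unshelve. all: by end_near. Qed.

End Scales.

Theorem theorem1 (R : realType) (m : nat)
    (V_ : nat -> 'rV[R]_(m + m) -> 'rV[R]_(m + m))
    (V : 'rV[R]_(m + m) -> 'rV[R]_(m + m))
    (eps r : nat -> R) (u : nat -> R * R -> 'rV[R]_(m + m)) (l : R) :
  (1 <= m)%N ->
  (forall n, smooth_on unit_cball (V_ n)) ->
  smooth_on unit_cball V ->
  Cinfty_cvg_on unit_cball V_ V ->
  (forall n, 0 < eps n) ->
  eps n @[n --> \oo] --> (0 : R) ->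
  (forall n, 0 < r n) ->
  (forall n,
    perturbed_cylinder `[- r n - 1, r n + 1] (eps n) (V_ n) (u n)) ->
  0 <= l ->
  eps n * r n @[n --> \oo] --> l ->
  (l = 0 -> r n @[n --> \oo] --> +oo) ->
  exists rho : nat -> R,
    [/\ forall n, 0 < rho n,
        rho n @[n --> \oo] --> +oo,
        eps n * rho n @[n --> \oo] --> (0 : R),
        forall n, rho n < r n &
        exists phi : nat -> nat,
          {homo phi : i j / (i < j)%N} /\
          exists (um up : R * R -> 'rV[R]_(m + m)) (xm xp : 'rV[R]_(m + m))
                 (v : R -> 'rV[R]_(m + m)),
            [/\ holomorphic_cylinder `[0, +oo[ um /\
                  removable_singularity um +oo xm,
                holomorphic_cylinder `]-oo, 0] up /\
                  removable_singularity up -oo xp,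
                (let dm k := sup_dist (strip `[0, rho (phi k)])
                   (fun p => u (phi k) (p.1 - r (phi k), p.2)) um in
                 let dp k := sup_dist (strip `[- rho (phi k), 0])
                   (fun p => u (phi k) (p.1 + r (phi k), p.2)) up in
                 (dm k + dp k)%E @[k --> \oo] --> 0%E),
                flow_line V l xm xp v &
                (let c k := eps (phi k) * (r (phi k) - rho (phi k)) in
                 sup_dist (strip (`[- c k, c k] `&` `[- l, l]))
                   (fun p => u (phi k) ((eps (phi k))^-1 * p.1,
                                        (eps (phi k))^-1 * p.2))
                   (fun p => v p.1)
                   @[k --> \oo] --> 0%E)]].
Proof.
move=> m1 sV_ sV cV eps0 eps_cvg r0 pc l0 er_cvg r_cvg.
have rhor := @width_lt R eps r r0.
have rho0 := @width_gt0 R eps r eps0 r0.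
(* The lengths are chosen for the whole sequence, before the subsequence. *)
exists (width eps r); split => //.
- exact: width_cvg eps0 eps_cvg l0 er_cvg r_cvg.
- exact: eps_width_cvg.
have [C [C0 nearC]] := vf_estimates sV_ sV cV.
have near_eps : \forall n \near \oo, eps n * C <= 1 / 8.
  near=> n; rewrite -ler_pdivlMr//; near: n.
  by apply: (cvgr_le _ eps_cvg); rewrite !divr_gt0.
have [n0 _ Hn0] : \forall n \near \oo, eps n * C <= 1 / 8 /\
    [/\ forall x i, unit_cball x -> `|V_ n x ord0 i| <= C,
        forall x i, unit_cball x -> `|V x ord0 i| <= C &
        forall x y, unit_cball x -> unit_cball y ->
        \sum_i (V_ n x ord0 i - V_ n y ord0 i) ^+ 2 <=
          C ^+ 2 * \sum_i (x ord0 i - y ord0 i) ^+ 2].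
  by near=> n; split; near: n.
have ub n s t : - r n - 1 <= s <= r n + 1 -> unit_cball (u n (s, t)).
  by move=> sI; have [[_ _ h] _] := pc n; apply: h; rewrite /= in_itv.
have /choice[Fab est] n : exists Fab : ('I_(m + m) -> R -> R -> R) *
    ('I_(m + m) -> R -> R) * ('I_(m + m) -> R -> R), (n0 <= n)%N ->
    estimates (r n) (eps n) C (V_ n) (u n) Fab.1.1 Fab.1.2 Fab.2.
  (* For the finitely many n below [n0] no estimate is claimed, and zero families are the
     default. *)
  have [le_n|] := boolP (n0 <= n)%N; last by exists (fun _ _ _ => 0, fun _ _ => 0, fun _ _ => 0).
  have [eC [VC _ VL]] := Hn0 n le_n.
  have [f [a [b H]]] := cylinder_estimates (r0 n) (eps0 n) C0 eC (pc n) VC VL.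
  by exists (f, a, b).
have /choice[M HM] k : exists M, forall n, (M <= n)%N ->
    [/\ (n0 <= n)%N, eps n * C <= k.+1%:R^-1,
      forall x i, unit_cball x -> `|V_ n x ord0 i - V x ord0 i| <= k.+1%:R^-1,
      k.+1%:R <= width eps r n & eps n * width eps r n * C <= k.+1%:R^-1 /\
      `|eps n * (r n - width eps r n) - l| <= k.+1%:R^-1].
  have k0 : 0 < k.+1%:R^-1 :> R by rewrite invr_gt0.
  have [N1 _ HN1] := coord_near sV_ sV cV k0.
  have [N2 _ HN2] := @scales_near R eps r l eps0 eps_cvg r0 l0 er_cvg r_cvg C k.+1%:R^-1 k.+1 C0 k0.
  exists (maxn n0 (maxn N1 N2)) => n; rewrite !geq_max => /and3P[h0 h1 h2].
  by have [? ? ? ?] := HN2 n h2; split => //; exact: HN1.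
have [fm [fp [v [phi [hphi H]]]]] := limit_data eps0 r0 rho0 rhor C0 ub est HM.
exists phi; split => //.
have n0phi k : (n0 <= phi k)%N by have [/HM[]] := H k.
(* x_- and x_+ are taken to be the end values of the flow line; [fm_end] and [fp_end] show that they
   are the limits of the two cylinders. *)
exists (row_of fm), (row_of fp), (vrow v (- l)), (vrow v l), (vrow v).
apply: (@convergence_summary R m (fun k => V_ (phi k)) V (fun k => eps (phi k))
  (fun k => r (phi k)) (fun k => width eps r (phi k)) (fun k => u (phi k)) l C
  (fun k => (Fab (phi k)).1.1) (fun k => (Fab (phi k)).1.2) (fun k => (Fab (phi k)).2)
  fm fp v) => //.
- by move=> k s t; exact: ub.
- by move=> k; exact: est.
- by move=> k; have [_ [_ _]] := Hn0 _ (n0phi k).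
- by move=> k; have [/HM[]] := H k.
- by move=> k; have [/HM[]] := H k.
- by have [_ []] := Hn0 _ (n0phi 0%N).
- by move=> k; have [/HM[]] := H k.
- by move=> k; have [/HM[_ _ _ _ []]] := H k.
- by move=> k; have [/HM[_ _ _ _ []]] := H k.
- by move=> k; have [] := H k.
- by move=> k; have [] := H k.
- by move=> k; have [] := H k.
Unshelve. all: by end_near. Qed.
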